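(* Let $c\in\mathbb{C}$ and $\kappa\in\mathbb{C}\setminus\{2,1,0,-1,-2,\dots\}$. Let $\Omega\subset\mathbb{C}$, let $q\in\mathcal{Q}_1\cap\mathcal{H}_1$, and let $\phi\in\Phi_{H,1}[\Omega,q]$. If $f\in\mathcal{A}$ (such that the quotients below are defined on $\mathbb{D}$) satisfies $$\left\{\phi\left(\frac{B_{\kappa}^{c}f(z)}{B_{\kappa+1}^{c}f(z)},\frac{B_{\kappa-1}^{c}f(z)}{B_{\kappa}^{c}f(z)},\frac{B_{\kappa-2}^{c}f(z)}{B_{\kappa-1}^{c}f(z)};z\right):z\in\mathbb{D}\right\}\subset\Omega,$$ then $$\frac{B_{\kappa}^{c}f}{B_{\kappa+1}^{c}f}\prec q\quad\text{in }\mathbb{D}.$$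
   Context: $\mathbb{D}=\{z\in\mathbb{C}:|z|<1\}$. $\mathcal{A}$ is the class of functions $f(z)=z+\sum_{n\geq1}a_{n+1}z^{n+1}$ analytic in $\mathbb{D}$. For $c\in\mathbb{C}$, $\lambda\in\mathbb{C}\setminus\{0,-1,-2,\dots\}$ and $f\in\mathcal{A}$, put $$B_\lambda^c f(z)=z+\sum_{n\geq1}\frac{(-c)^n a_{n+1}}{4^n(\lambda)_n}\frac{z^{n+1}}{n!},\qquad (\lambda)_n=\lambda(\lambda+1)\cdots(\lambda+n-1).$$ The three quotients are required to be defined on $\mathbb{D}$, i.e. $B_{\kappa+1}^cf$, $B_\kappa^cf$, $B_{\kappa-1}^cf$ have no zeros in $\mathbb{D}\setminus\{0\}$; at $z=0$ each quotient takes the value $1$ (removable singularity). For $f,F$ analytic in $\mathbb{D}$, $f\prec F$ means that there is $w$ analytic in $\mathbb{D}$ with $w(0)=0$, $|w(z)|<1$ and $f(z)=F(w(z))$ for all $z\in\mathbb{D}$. $\mathcal{H}_1$ is the class of analytic functions in $\mathbb{D}$ taking the value $1$ at $0$. $\mathcal{Q}$ is the class of functions $q$ that are analytic and injective on $\overline{\mathbb{D}}\setminus E(q)$, where $E(q)=\{\zeta\in\partial\mathbb{D}:\lim_{z\to\zeta}q(z)=\infty\}$, and such that $q'(\zeta)\neq0$ for $\zeta\in\partial\mathbb{D}\setminus E(q)$; $\mathcal{Q}_1=\{q\in\mathcal{Q}:q(0)=1\}$. For $\Omega\subset\mathbb{C}$ and $q\in\mathcal{Q}_1\cap\mathcal{H}_1$,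 the class of admissible functions $\Phi_{H,1}[\Omega,q]$ consists of all functions $\phi:\mathbb{C}^3\times\mathbb{D}\to\mathbb{C}$ such that $\phi(u,v,w;z)\notin\Omega$ whenever $$u=q(\zeta),\qquad v=\frac{1}{\kappa-1}\left(\frac{k\zeta q'(\zeta)}{q(\zeta)}+\kappa q(\zeta)-1\right),\qquad q(\zeta)\neq0,$$ $$\operatorname{Re}\left(\frac{(\kappa-1)v\left[(\kappa-1)(w-v)+1-w\right]}{(\kappa-1)v+1-\kappa u}-\left[2\kappa u-1-(\kappa-1)v\right]\right)\geq k\operatorname{Re}\left(\frac{\zeta q''(\zeta)}{q'(\zeta)}+1\right),$$ with $z\in\mathbb{D}$, $\zeta\in\partial\mathbb{D}\setminus E(q)$ and real $k\geq1$. *)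

(* Defs.v *)
From Stdlib Require Import Reals Factorial.
From Coquelicot Require Import Coquelicot.

Open Scope C_scope.

Definition unit_disc (z : C) : Prop := (Cmod z < 1)%R.
Definition closed_unit_disc (z : C) : Prop := (Cmod z <= 1)%R.
Definition unit_circle (z : C) : Prop := Cmod z = 1%R.

Definition analytic_at (f : C -> C) (z0 : C) : Prop :=
  exists (r : posreal) (a : nat -> C), forall z : C, (Cmod (z - z0) < r)%R ->
    @is_pseries C_AbsRing C_NormedModule a (z - z0) (f z).

Definition analytic_on (D : C -> Prop) (f : C -> C) : Prop :=
  forall z : C, D z -> analytic_at f z.

(* A function given by its Taylor expansion at 0, valid on the whole disc:
   the coefficients are determined by the values on the disc. The values
   outside the disc are irrelevant. *)
Record class_A : Type := {
  A_fun :> C -> C;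
  A_coef : nat -> C;
  A_coef0 : A_coef 0%nat = 0;
  A_coef1 : A_coef 1%nat = 1;
  A_expansion : forall z : C, unit_disc z ->
    @is_pseries C_AbsRing C_NormedModule A_coef z (A_fun z)
}.

Fixpoint pochhammer (l : C) (n : nat) : C :=
  match n with
  | O => 1
  | S m => pochhammer l m * (l + INR m)
  end.

(* Coquelicot's Series is real-valued; on a convergent complex series this is
   its sum. *)
Definition Cseries (u : nat -> C) : C :=
  (Series (fun n => Re (u n)), Series (fun n => Im (u n))).

(* The term of index 0 is z, because the coefficient of index 1 of f is 1. *)
Definition bessel_op (c l : C) (f : class_A) (z : C) : C :=
  Cseries (fun n => (- c) ^ n * A_coef f (S n) / (4 ^ n * pochhammer l n)
                    * (z ^ (S n) / INR (fact n))).

(* B_l^c f / B_m^c f, with its removable singularity at 0 filled in. *)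
Definition bessel_quot (c l m : C) (f : class_A) (z : C) : C :=
  if Ceq_dec z 0 then 1 else bessel_op c l f z / bessel_op c m f z.

Definition no_zero_in_punctured_disc (g : C -> C) : Prop :=
  forall z : C, unit_disc z -> z <> 0 -> g z <> 0.

Definition subordinate (f F : C -> C) : Prop :=
  exists w : C -> C,
    analytic_on unit_disc w /\ w 0 = 0 /\
    (forall z : C, unit_disc z -> unit_disc (w z)) /\
    (forall z : C, unit_disc z -> f z = F (w z)).

Definition class_H1 (q : C -> C) : Prop := analytic_on unit_disc q /\ q 0 = 1.

(* E(q); as q is given on the disc and part of its boundary only, the limit is
   taken from inside the disc. *)
Definition exceptional (q : C -> C) (zeta : C) : Prop :=
  unit_circle zeta /\
  filterlim (fun z => Cmod (q z)) (within unit_disc (locally zeta))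
    (Rbar_locally p_infty).

Definition regular_set (q : C -> C) (z : C) : Prop :=
  closed_unit_disc z /\ ~ exceptional q z.

(* Analytic on a set that is not open means analytic in a neighbourhood of
   each of its points. *)
Definition class_Q (q : C -> C) : Prop :=
  analytic_on (regular_set q) q /\
  (forall z1 z2 : C, regular_set q z1 -> regular_set q z2 ->
     q z1 = q z2 -> z1 = z2) /\
  (forall zeta : C, unit_circle zeta -> ~ exceptional q zeta ->
     C_derive q zeta <> 0).

Definition class_Q1 (q : C -> C) : Prop := class_Q q /\ q 0 = 1.

Definition admissible (kappa : C) (Omega : C -> Prop) (q : C -> C)
    (phi : C -> C -> C -> C -> C) : Prop :=
  forall (u v w z zeta : C) (k : R),
    unit_disc z -> unit_circle zeta -> ~ exceptional q zeta -> (1 <= k)%R ->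
    u = q zeta ->
    v = 1 / (kappa - 1)
        * (k * zeta * C_derive q zeta / q zeta + kappa * q zeta - 1) ->
    q zeta <> 0 ->
    (Re ((kappa - 1) * v * ((kappa - 1) * (w - v) + 1 - w)
           / ((kappa - 1) * v + 1 - kappa * u)
         - (2 * kappa * u - 1 - (kappa - 1) * v))
     >= k * Re (zeta * C_derive (C_derive q) zeta / C_derive q zeta + 1))%R ->
    ~ Omega (phi u v w z).

(* Main.v *)
Require Import Defs.
From Stdlib Require Import Reals Factorial Lra Lia Classical ClassicalEpsilon.
From Coquelicot Require Import Coquelicot.

(* Writing B_l f = z G_l, the coefficients give z G_(l+1)' = l (G_l - G_(l+1)), so that
   p = B_kappa f / B_(kappa+1) f and v = B_(kappa-1) f / B_kappa f satisfy first-order differential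
   equations, and these turn the quotient in the admissibility condition into z p'' / p' + 1. The
   theorem is then the lemma of Miller and Mocanu: if p is not subordinate to q, let z0 have least
   modulus among the points with p(z0) not in q(D). On |z| < |z0| the function w = q^-1 o p maps
   into D and fixes 0, so |w(z)| <= |z| / |z0| by Schwarz; by injectivity of q, w tends at z0 to a
   boundary point zeta where q is regular, and w continues analytically past z0 as a local inverse
   of q composed with p. Jack's lemma for this continuation gives z0 p'(z0) = m zeta q'(zeta) with
   m >= 1 and the second-order inequality, contradicting admissibility at zeta.

   Analytic functions are handled through complex differentiability with continuous derivative
   (hol below), which is equivalent to local power series expansion by Cauchy's formula. *)

Local Open Scope C_scope.

(** * Complex derivatives *)


(** The obstacle is that [q] is controlled only on the closed disc minus E(q), and that a local
    inverse of [q] at a boundary point may leave the disc. Compactness supplies the boundary point.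
    A cluster value zeta of [w] at [z0] is not exceptional, because |q(w)| = |p| stays bounded; then
    q(zeta) = p(z0), which is not in q(D), so |zeta| = 1. Injectivity of [q] on its regular set
    leaves only one cluster value, so [w] has a limit. Inside the disc q' is nonzero by injectivity;
    on the circle it is nonzero by the definition of the class. The absence of zeros of the Bessel
    transforms makes the quotients finite and gives q(zeta) = p(z0) <> 0, while the excluded values
    of [kappa] are those for which a parameter among [kappa - 2], ..., [kappa + 1] is a non-positive
    integer. Cauchy's formula is obtained from real calculus: the circle is contracted to z by a
    homothety, and the derivative of the integral in the contraction parameter vanishes, being the
    integral of a derivative along a closed curve. *)

Lemma Cmod_minus_sym (x y : C) : Cmod (x - y) = Cmod (y - x).
Proof. rewrite <- Cmod_opp. f_equal. ring. Qed.

Lemma Cmod_minus_triangle (x y z : C) :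
  (Cmod (x - z) <= Cmod (x - y) + Cmod (y - z))%R.
Proof. replace (x - z) with ((x - y) + (y - z)) by ring. apply Cmod_triangle. Qed.

Lemma Cmod_minus_le (x y : C) : (Cmod (x - y) <= Cmod x + Cmod y)%R.
Proof. rewrite <- (Cmod_opp y). apply Cmod_triangle. Qed.

Lemma Cmod_le_plus (x y : C) : (Cmod x <= Cmod y + Cmod (x - y))%R.
Proof. replace x with (y + (x - y)) at 1 by ring. apply Cmod_triangle. Qed.

Lemma im_le_Cmod (z : C) : (Rabs (Im z) <= Cmod z)%R.
Proof.
  eapply Rle_trans; [ apply (Rmax_r (Rabs (fst z))) | apply Rmax_Cmod ].
Qed.

Lemma Cmod_le_ReIm (z : C) : (Cmod z <= Rabs (Re z) + Rabs (Im z))%R.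
Proof.
  destruct z as [x y]. simpl.
  replace (x, y) with (RtoC x + Ci * RtoC y)
    by (unfold RtoC, Ci, Cplus, Cmult; simpl; f_equal; ring).
  eapply Rle_trans; [ apply Cmod_triangle | ].
  rewrite Cmod_mult, Cmod_Ci, !Cmod_R. lra.
Qed.

Lemma Ceq_ReIm (x y : C) : Re x = Re y -> Im x = Im y -> x = y.
Proof. destruct x, y; simpl; intros; subst; reflexivity. Qed.

(** Round neighbourhoods make estimates with [Cmod] direct; [near_locally] identifies them with the
    neighbourhoods of the product uniform structure on [C]. *)
Definition near (z : C) (P : C -> Prop) : Prop :=
  exists d : R, (0 < d)%R /\ forall u, (Cmod (u - z) < d)%R -> P u.

Lemma near_and (z : C) (P Q : C -> Prop) :
  near z P -> near z Q -> near z (fun u => P u /\ Q u).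
Proof.
  intros [d [Hd HP]] [e [He HQ]]. exists (Rmin d e). split.
  - now apply Rmin_pos.
  - intros u Hu. split; [ apply HP | apply HQ ]; eapply Rlt_le_trans; eauto.
    apply Rmin_l. apply Rmin_r.
Qed.

Lemma near_impl (z : C) (P Q : C -> Prop) :
  near z P -> (forall u, P u -> Q u) -> near z Q.
Proof. intros [d [Hd HP]] H. exists d. auto. Qed.

Lemma near_at (z : C) (P : C -> Prop) : near z P -> P z.
Proof.
  intros [d [Hd HP]]. apply HP.
  replace (z - z) with (RtoC 0) by ring. now rewrite Cmod_0.
Qed.

Lemma near_near (z : C) (P : C -> Prop) : near z P -> near z (fun u => near u P).
Proof.
  intros [d [Hd HP]]. exists (d / 2)%R. split; [ lra | ].
  intros u Hu. exists (d / 2)%R. split; [ lra | ].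
  intros v Hv. apply HP.
  pose proof (Cmod_minus_triangle v u z). lra.
Qed.

Lemma near_ball (z c : C) (r : R) :
  (Cmod (z - c) < r)%R -> near z (fun u => (Cmod (u - c) < r)%R).
Proof.
  intros H. exists (r - Cmod (z - c))%R. split; [ lra | ].
  intros u Hu. pose proof (Cmod_minus_triangle u z c). lra.
Qed.

Definition ccont (f : C -> C) (z : C) : Prop :=
  forall eps : R, (0 < eps)%R -> near z (fun u => (Cmod (f u - f z) < eps)%R).

(** Stated without a quotient and with [<=], so that the point u = z needs no separate treatment. *)
Definition cder (f : C -> C) (z l : C) : Prop :=
  forall eps : R, (0 < eps)%R ->
    near z (fun u => (Cmod (f u - f z - l * (u - z)) <= eps * Cmod (u - z))%R).

Lemma ccont_near (f : C -> C) (z : C) (P : C -> Prop) :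
  ccont f z -> near (f z) P -> near z (fun u => P (f u)).
Proof.
  intros Hf [d [Hd HP]]. apply near_impl with (1 := Hf d Hd). intros u Hu. auto.
Qed.

Lemma cder_ext_near (f g : C -> C) (z l : C) :
  near z (fun u => f u = g u) -> cder f z l -> cder g z l.
Proof.
  intros H Hf eps Heps. pose proof (near_at _ _ H) as Hz.
  apply near_impl with (1 := near_and _ _ _ H (Hf eps Heps)).
  intros u [Hu Hu']. now rewrite <- Hu, <- Hz.
Qed.

Lemma ccont_ext_near (f g : C -> C) (z : C) :
  near z (fun u => f u = g u) -> ccont f z -> ccont g z.
Proof.
  intros H Hf eps Heps. pose proof (near_at _ _ H) as Hz.
  apply near_impl with (1 := near_and _ _ _ H (Hf eps Heps)).
  intros u [Hu Hu']. now rewrite <- Hu, <- Hz.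
Qed.

Lemma cder_ccont (f : C -> C) (z l : C) : cder f z l -> ccont f z.
Proof.
  intros Hf eps Heps. destruct (Hf 1%R Rlt_0_1) as [d [Hd H]].
  pose proof (Cmod_ge_0 l) as Hl.
  exists (Rmin d (eps / (Cmod l + 2))). split.
  - apply Rmin_pos; [ lra | ]. apply Rdiv_lt_0_compat; lra.
  - intros u Hu.
    assert (H1 : (Cmod (u - z) < d)%R) by (eapply Rlt_le_trans; [ apply Hu | apply Rmin_l ]).
    assert (H2 : (Cmod (u - z) < eps / (Cmod l + 2))%R)
      by (eapply Rlt_le_trans; [ apply Hu | apply Rmin_r ]).
    specialize (H u H1).
    pose proof (Cmod_le_plus (f u - f z) (l * (u - z))) as H3.
    rewrite Cmod_mult in H3.
    apply Rlt_div_r in H2; [ | lra ].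
    pose proof (Cmod_ge_0 (u - z)). nra.
Qed.

Lemma cder_const (k z : C) : cder (fun _ => k) z 0.
Proof.
  intros eps Heps. exists 1%R. split; [ lra | ]. intros u _.
  replace (k - k - 0 * (u - z)) with (RtoC 0) by ring. rewrite Cmod_0.
  pose proof (Cmod_ge_0 (u - z)). nra.
Qed.

Lemma cder_id (z : C) : cder (fun u => u) z 1.
Proof.
  intros eps Heps. exists 1%R. split; [ lra | ]. intros u _.
  replace (u - z - 1 * (u - z)) with (RtoC 0) by ring. rewrite Cmod_0.
  pose proof (Cmod_ge_0 (u - z)). nra.
Qed.

Lemma cder_plus (f g : C -> C) (z l m : C) :
  cder f z l -> cder g z m -> cder (fun u => f u + g u) z (l + m).
Proof.
  intros Hf Hg eps Heps.
  assert (H2 : (0 < eps / 2)%R) by lra.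
  apply near_impl with (1 := near_and _ _ _ (Hf _ H2) (Hg _ H2)).
  intros u [H H'].
  replace (f u + g u - (f z + g z) - (l + m) * (u - z))
    with ((f u - f z - l * (u - z)) + (g u - g z - m * (u - z))) by ring.
  eapply Rle_trans; [ apply Cmod_triangle | ]. lra.
Qed.

Lemma cder_comp (f g : C -> C) (z l m : C) :
  cder f (g z) l -> cder g z m -> cder (fun u => f (g u)) z (l * m).
Proof.
  intros Hf Hg eps Heps.
  pose proof (Cmod_ge_0 l) as Hl. pose proof (Cmod_ge_0 m) as Hm.
  (* The cap 1 bounds |g u - g z| by (|m| + 1)|u - z|; the total error is then at most e1 (|l| + |m|
     + 1)|u - z|. *)
  set (e1 := Rmin 1 (eps / (Cmod l + Cmod m + 2))).
  assert (He : (0 < eps / (Cmod l + Cmod m + 2))%R) by (apply Rdiv_lt_0_compat; lra).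
  assert (He1 : (0 < e1)%R) by (apply Rmin_pos; lra).
  assert (He1' : (e1 <= 1)%R) by apply Rmin_l.
  assert (He2 : (e1 * (Cmod l + Cmod m + 2) <= eps)%R).
  { apply Rle_div_r; [ lra | apply Rmin_r ]. }
  pose proof (ccont_near _ _ _ (cder_ccont _ _ _ Hg) (Hf e1 He1)) as H1.
  apply near_impl with (1 := near_and _ _ _ H1 (Hg e1 He1)).
  intros u [H H'].
  replace (f (g u) - f (g z) - l * m * (u - z))
    with ((f (g u) - f (g z) - l * (g u - g z)) + l * (g u - g z - m * (u - z))) by ring.
  eapply Rle_trans; [ apply Cmod_triangle | ]. rewrite Cmod_mult.
  pose proof (Cmod_le_plus (g u - g z) (m * (u - z))) as H3. rewrite Cmod_mult in H3.
  pose proof (Cmod_ge_0 (u - z)) as H4.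
  assert (Cmod (g u - g z) <= (Cmod m + 1) * Cmod (u - z))%R by nra.
  assert (e1 * Cmod (g u - g z) <= e1 * ((Cmod m + 1) * Cmod (u - z)))%R
    by (apply Rmult_le_compat_l; lra).
  assert (Cmod l * Cmod (g u - g z - m * (u - z)) <= Cmod l * (e1 * Cmod (u - z)))%R
    by (apply Rmult_le_compat_l; lra).
  assert (e1 * (Cmod l + Cmod m + 2) * Cmod (u - z) <= eps * Cmod (u - z))%R
    by (apply Rmult_le_compat_r; lra).
  nra.
Qed.

Lemma cder_scal (k : C) (f : C -> C) (z l : C) :
  cder f z l -> cder (fun u => k * f u) z (k * l).
Proof.
  intros Hf. apply (cder_comp (fun v => k * v) f z k l); [ | exact Hf ].
  intros eps Heps. exists 1%R. split; [ lra | ]. intros u _.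
  replace (k * u - k * f z - k * (u - f z)) with (RtoC 0) by ring. rewrite Cmod_0.
  pose proof (Cmod_ge_0 (u - f z)). nra.
Qed.

Lemma cder_minus (f g : C -> C) (z l m : C) :
  cder f z l -> cder g z m -> cder (fun u => f u - g u) z (l - m).
Proof.
  intros Hf Hg. replace (l - m) with (l + (-1) * m) by ring.
  apply cder_ext_near with (fun u => f u + (-1) * g u).
  - exists 1%R. split; [ lra | ]. intros u _. ring.
  - apply cder_plus; [ assumption | now apply cder_scal ].
Qed.

Lemma cder_sqr (z : C) : cder (fun u => u * u) z (2 * z).
Proof.
  intros eps Heps. exists eps. split; [ lra | ]. intros u Hu.
  replace (u * u - z * z - 2 * z * (u - z)) with ((u - z) * (u - z)) by ring.
  rewrite Cmod_mult. pose proof (Cmod_ge_0 (u - z)). nra.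
Qed.

(* Polarisation reduces products to squares. *)
Lemma cder_mult (f g : C -> C) (z l m : C) :
  cder f z l -> cder g z m -> cder (fun u => f u * g u) z (l * g z + f z * m).
Proof.
  intros Hf Hg.
  pose proof (cder_comp (fun v => v * v) (fun u => f u + g u) z _ _ (cder_sqr (f z + g z)) (cder_plus _ _ _ _ _ Hf Hg)) as H1.
  pose proof (cder_comp (fun v => v * v) f z _ _ (cder_sqr (f z)) Hf) as H2.
  pose proof (cder_comp (fun v => v * v) g z _ _ (cder_sqr (g z)) Hg) as H3.
  pose proof (cder_scal (/ 2) _ _ _ (cder_minus _ _ _ _ _ (cder_minus _ _ _ _ _ H1 H2) H3)) as H4.
  assert (T : RtoC 2 <> 0) by (intros H; apply RtoC_inj in H; lra).
  replace (l * g z + f z * m)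
    with (/ 2 * (2 * (f z + g z) * (l + m) - 2 * f z * l - 2 * g z * m)) by (field; exact T).
  apply cder_ext_near with (2 := H4).
  exists 1%R. split; [ lra | ]. intros u _. field.
Qed.

Lemma cder_inv (z : C) : z <> 0 -> cder (fun u => / u) z (- / (z * z)).
Proof.
  intros Hz eps Heps. pose proof (proj1 (Cmod_gt_0 z) Hz) as Hz'.
  set (a := Cmod z) in *.
  (* The remainder equals (u - z)^2 / (u z^2). The first radius gives 1/|u| <= 2/a, and the second
     absorbs the resulting factor 2/a^3. *)
  exists (Rmin (a / 2) (eps * (a * a * a) / 2)). 
  assert (0 < a * a * a)%R by (repeat apply Rmult_lt_0_compat; lra).
  split.
  - apply Rmin_pos; [ lra | ]. nra.
  - intros u Hu.
    assert (H1 : (Cmod (u - z) < a / 2)%R) by (eapply Rlt_le_trans; [ apply Hu | apply Rmin_l ]).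
    assert (H2 : (Cmod (u - z) < eps * (a * a * a) / 2)%R)
      by (eapply Rlt_le_trans; [ apply Hu | apply Rmin_r ]).
    pose proof (Cmod_le_plus z u) as H3. rewrite (Cmod_minus_sym z u) in H3. fold a in H3.
    assert (Hu0 : u <> 0) by (apply Cmod_gt_0; lra).
    replace (/ u - / z - - / (z * z) * (u - z))
      with ((u - z) * (u - z) * (/ u * (/ z * / z))) by (field; auto).
    rewrite !Cmod_mult, !Cmod_inv by auto. fold a.
    assert (H4 : (0 < Cmod u)%R) by lra.
    pose proof (Cmod_ge_0 (u - z)) as H5.
    assert (H6 : (/ Cmod u <= 2 * / a)%R).
    { replace (2 * / a)%R with (/ (a / 2))%R by (field; lra).
      apply Rinv_le_contravar; lra. }
    assert (H7 : (0 < / a)%R) by now apply Rinv_0_lt_compat.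
    rewrite Rmult_assoc, (Rmult_comm eps). apply Rmult_le_compat_l; [ lra | ].
    apply Rle_trans with (eps * (a * a * a) / 2 * (2 * / a * (/ a * / a)))%R.
    + apply Rmult_le_compat; try lra.
      * apply Rmult_le_pos; [ left; now apply Rinv_0_lt_compat | nra ].
      * apply Rmult_le_compat_r; nra.
    + right. field. lra.
Qed.

Lemma cder_div (f g : C -> C) (z l m : C) :
  cder f z l -> cder g z m -> g z <> 0 ->
  cder (fun u => f u / g u) z ((l * g z - f z * m) / (g z * g z)).
Proof.
  intros Hf Hg H.
  replace ((l * g z - f z * m) / (g z * g z))
    with (l * / g z + f z * (- / (g z * g z) * m)) by (field; auto).
  apply (cder_mult f (fun u => / g u)); [ exact Hf | ].
  apply (cder_comp (fun v => / v)); [ now apply cder_inv | exact Hg ].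
Qed.

Lemma cder_pow (n : nat) (z : C) : cder (fun u => u ^ S n) z (INR (S n) * z ^ n).
Proof.
  induction n as [ | n IH ].
  - simpl. replace (1 * 1) with (RtoC 1) by ring.
    apply cder_ext_near with (fun u => u); [ | apply cder_id ].
    exists 1%R. split; [ lra | ]. intros u _. ring.
  - pose proof (cder_mult _ _ _ _ _ (cder_id z) IH) as H.
    rewrite S_INR, RtoC_plus.
    replace ((INR (S n) + 1) * z ^ S n) with (1 * z ^ S n + z * (INR (S n) * z ^ n))
      by (rewrite Cpow_S; ring).
    exact H.
Qed.

Lemma cder_unique (f : C -> C) (z l m : C) : cder f z l -> cder f z m -> l = m.
Proof.
  intros Hl Hm. apply NNPP. intros Hne.
  assert (Hd : (0 < Cmod (l - m))%R) by (apply Cmod_gt_0, Cminus_eq_contra, Hne).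
  set (e := (Cmod (l - m) / 4)%R). assert (He : (0 < e)%R) by (unfold e; lra).
  destruct (near_and _ _ _ (Hl e He) (Hm e He)) as [d [Hd0 H]].
  assert (Hmod : Cmod (z + RtoC (d / 2) - z) = (d / 2)%R).
  { replace (z + RtoC (d / 2) - z) with (RtoC (d / 2)) by ring.
    rewrite Cmod_R. apply Rabs_pos_eq. lra. }
  destruct (H (z + RtoC (d / 2))) as [H1 H2]; [ rewrite Hmod; lra | ].
  set (u := z + RtoC (d / 2)) in *.
  assert (H3 : (Cmod ((l - m) * (u - z)) <= 2 * e * Cmod (u - z))%R).
  { replace ((l - m) * (u - z))
      with ((f u - f z - m * (u - z)) - (f u - f z - l * (u - z))) by ring.
    eapply Rle_trans; [ apply Cmod_minus_le | ]. lra. }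
  rewrite Cmod_mult, Hmod in H3. unfold e in H3. nra.
Qed.

(** An arbitrary filter lets the same limit rules serve complex points ([near]), real parameters and
    pairs ([locally]) and sequences ([eventually]). *)
Definition ctends {T : Type} (F : (T -> Prop) -> Prop) (g : T -> C) (l : C) : Prop :=
  forall eps : R, (0 < eps)%R -> F (fun x => (Cmod (g x - l) < eps)%R).

Lemma ctends_const {T : Type} (F : (T -> Prop) -> Prop) {FF : Filter F} (k : C) :
  ctends F (fun _ => k) k.
Proof.
  intros eps Heps. apply filter_forall. intros _.
  replace (k - k) with (RtoC 0) by ring. now rewrite Cmod_0.
Qed.

Lemma ctends_plus {T : Type} (F : (T -> Prop) -> Prop) {FF : Filter F} (f g : T -> C) (l m : C) :
  ctends F f l -> ctends F g m -> ctends F (fun x => f x + g x) (l + m).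
Proof.
  intros Hf Hg eps Heps. assert (H2 : (0 < eps / 2)%R) by lra.
  generalize (filter_and _ _ (Hf _ H2) (Hg _ H2)). apply filter_imp. intros x [H H'].
  replace (f x + g x - (l + m)) with ((f x - l) + (g x - m)) by ring.
  eapply Rle_lt_trans; [ apply Cmod_triangle | lra ].
Qed.

Lemma ctends_mult {T : Type} (F : (T -> Prop) -> Prop) {FF : Filter F} (f g : T -> C) (l m : C) :
  ctends F f l -> ctends F g m -> ctends F (fun x => f x * g x) (l * m).
Proof.
  intros Hf Hg eps Heps.
  pose proof (Cmod_ge_0 l) as H1. pose proof (Cmod_ge_0 m) as H2.
  set (D := (Cmod l + Cmod m + 1)%R).
  set (e := Rmin 1 (eps / (2 * D))).
  assert (He0 : (0 < eps / (2 * D))%R) by (apply Rdiv_lt_0_compat; unfold D; lra).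
  assert (He : (0 < e)%R) by (apply Rmin_pos; lra).
  assert (He1 : (e <= 1)%R) by apply Rmin_l.
  assert (He2 : (e * (2 * D) <= eps)%R).
  { apply Rle_div_r; [ unfold D; lra | apply Rmin_r ]. }
  generalize (filter_and _ _ (Hf e He) (Hg e He)). apply filter_imp. intros x [H H'].
  replace (f x * g x - l * m)
    with ((f x - l) * (g x - m) + ((f x - l) * m + l * (g x - m))) by ring.
  eapply Rle_lt_trans; [ apply Cmod_triangle | ].
  eapply Rle_lt_trans; [ apply Rplus_le_compat_l, Cmod_triangle | ].
  rewrite !Cmod_mult.
  pose proof (Cmod_ge_0 (f x - l)). pose proof (Cmod_ge_0 (g x - m)).
  unfold D in *. nra.
Qed.

Lemma ctends_ccont {T : Type} (F : (T -> Prop) -> Prop) {FF : Filter F} (f : C -> C) (g : T -> C) (l : C) :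
  ctends F g l -> ccont f l -> ctends F (fun x => f (g x)) (f l).
Proof.
  intros Hg Hf eps Heps. destruct (Hf eps Heps) as [d [Hd H]].
  generalize (Hg d Hd). apply filter_imp. auto.
Qed.

Global Instance near_filter (z : C) : Filter (near z).
Proof.
  constructor.
  - exists 1%R. split; [ lra | auto ].
  - intros P Q. apply near_and.
  - intros P Q H HP. now apply near_impl with P.
Qed.

Lemma ccont_mult (f g : C -> C) (z : C) :
  ccont f z -> ccont g z -> ccont (fun u => f u * g u) z.
Proof. apply (ctends_mult (near z)). Qed.

Lemma ccont_comp (f g : C -> C) (z : C) :
  ccont f (g z) -> ccont g z -> ccont (fun u => f (g u)) z.
Proof. intros Hf Hg eps Heps. exact (ccont_near _ _ _ Hg (Hf eps Heps)). Qed.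

Lemma cder_shift (f : C -> C) (c z l : C) :
  cder f (c + z) l -> cder (fun u => f (c + u)) z l.
Proof.
  intros H. replace l with (l * (0 + 1)) by ring.
  apply (cder_comp f (fun u => c + u)); [ exact H | ].
  apply cder_plus; [ apply cder_const | apply cder_id ].
Qed.

(** * Complex power series *)


(** Convertible with [ctends eventually], so that the rules for filters apply to sequences as they
    stand. *)
Definition clim (s : nat -> C) (l : C) : Prop :=
  forall eps : R, (0 < eps)%R ->
    exists N, forall n, (N <= n)%nat -> (Cmod (s n - l) < eps)%R.

Fixpoint psum (a : nat -> C) (n : nat) : C :=
  match n with O => a O | S m => psum a m + a (S m) end.

Lemma psum_S (a : nat -> C) (n : nat) : psum a (S n) = psum a n + a (S n).
Proof. reflexivity. Qed.

Definition csum (a : nat -> C) (l : C) : Prop := clim (psum a) l.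

Lemma clim_le (s : nat -> C) (l k : C) (K : R) :
  clim s l -> (forall n, (Cmod (s n - k) <= K)%R) -> (Cmod (l - k) <= K)%R.
Proof.
  intros Hs HK. apply Rnot_lt_le. intros H.
  destruct (Hs (Cmod (l - k) - K)%R ltac:(lra)) as [N HN].
  specialize (HN N (Nat.le_refl N)). specialize (HK N).
  pose proof (Cmod_minus_triangle l (s N) k). rewrite (Cmod_minus_sym l (s N)) in H0. lra.
Qed.

Lemma clim_unique (s : nat -> C) (l m : C) : clim s l -> clim s m -> l = m.
Proof.
  intros Hl Hm. apply NNPP. intros Hne.
  assert (Hd : (0 < Cmod (l - m))%R) by (apply Cmod_gt_0, Cminus_eq_contra, Hne).
  destruct (Hl (Cmod (l - m) / 2)%R ltac:(lra)) as [N HN].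
  destruct (Hm (Cmod (l - m) / 2)%R ltac:(lra)) as [N' HN'].
  specialize (HN (N + N')%nat ltac:(lia)). specialize (HN' (N + N')%nat ltac:(lia)).
  pose proof (Cmod_minus_triangle l (s (N + N')%nat) m).
  rewrite (Cmod_minus_sym l (s _)) in H. lra.
Qed.

Lemma clim_ext (s t : nat -> C) (l : C) : (forall n, s n = t n) -> clim s l -> clim t l.
Proof. intros H Hs eps He. destruct (Hs eps He) as [N HN]. exists N. intros n Hn. rewrite <- H. auto. Qed.

Lemma clim_S (s : nat -> C) (l : C) : clim s l -> clim (fun n => s (S n)) l.
Proof. intros Hs eps He. destruct (Hs eps He) as [N HN]. exists N. intros n Hn. apply HN. lia. Qed.

Lemma clim_plus (s t : nat -> C) (l m : C) :
  clim s l -> clim t m -> clim (fun n => s n + t n) (l + m).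
Proof.
  intros Hs Ht eps He.
  destruct (Hs (eps / 2)%R ltac:(lra)) as [N HN].
  destruct (Ht (eps / 2)%R ltac:(lra)) as [N' HN'].
  exists (N + N')%nat. intros n Hn.
  specialize (HN n ltac:(lia)). specialize (HN' n ltac:(lia)).
  replace (s n + t n - (l + m)) with ((s n - l) + (t n - m)) by ring.
  eapply Rle_lt_trans; [ apply Cmod_triangle | lra ].
Qed.

Lemma clim_scal (k : C) (s : nat -> C) (l : C) : clim s l -> clim (fun n => k * s n) (k * l).
Proof.
  intros Hs eps He. pose proof (Cmod_ge_0 k).
  destruct (Hs (eps / (Cmod k + 1))%R) as [N HN]; [ apply Rdiv_lt_0_compat; lra | ].
  exists N. intros n Hn. specialize (HN n Hn).
  replace (k * s n - k * l) with (k * (s n - l)) by ring. rewrite Cmod_mult.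
  apply Rlt_div_r in HN; [ | lra ].
  pose proof (Cmod_ge_0 (s n - l)). nra.
Qed.

Lemma psum_sum_n (a : nat -> C) (n : nat) :
  @sum_n C_AbelianMonoid a n = psum a n.
Proof.
  induction n as [ | n IH ]; [ now rewrite sum_O | ].
  rewrite sum_Sn, IH. reflexivity.
Qed.

Lemma is_series_csum (a : nat -> C) (l : C) :
  @is_series C_AbsRing C_NormedModule a l <-> csum a l.
Proof.
  split.
  - intros H eps He.
    (* Balls of [C] are products of intervals, so a ball of radius e only bounds the modulus by sqrt
       2 * e. *)
    assert (Hs : (0 < sqrt 2)%R) by (apply sqrt_lt_R0; lra).
    assert (He' : (0 < eps / sqrt 2)%R) by (apply Rdiv_lt_0_compat; lra).
    pose proof (proj1 (filterlim_locally _ _) H (mkposreal _ He')) as [N HN].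
    exists N. intros n Hn. specialize (HN n Hn).
    apply C_NormedModule_mixin_compat2 in HN. simpl in HN.
    rewrite <- psum_sum_n.
    eapply Rlt_le_trans; [ exact HN | ]. right. field. lra.
  - intros H. apply (proj2 (filterlim_locally _ _)). intros eps.
    destruct (H eps (cond_pos eps)) as [N HN]. exists N. intros n Hn.
    apply C_NormedModule_mixin_compat1. specialize (HN n Hn).
    rewrite <- psum_sum_n in HN. exact HN.
Qed.

Lemma pow_n_Cpow (z : C) (n : nat) : @pow_n C_Ring z n = z ^ n.
Proof. induction n as [ | n IH ]; [ reflexivity | simpl; now rewrite IH ]. Qed.

Lemma csum_ext (a b : nat -> C) (l : C) : (forall n, a n = b n) -> csum a l -> csum b l.
Proof.
  intros H. apply clim_ext. intros n. induction n as [ | n IH ]; simpl; [ auto | ].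
  now rewrite IH, H.
Qed.

Lemma is_pseries_csum (a : nat -> C) (z l : C) :
  @is_pseries C_AbsRing C_NormedModule a z l <-> csum (fun n => a n * z ^ n) l.
Proof.
  unfold is_pseries. rewrite is_series_csum.
  split; apply csum_ext; intros n; rewrite <- pow_n_Cpow; apply Cmult_comm.
Qed.

Lemma psum_Re (a : nat -> C) (n : nat) : sum_n (fun k => Re (a k)) n = Re (psum a n).
Proof.
  induction n as [ | n IH ]; [ now rewrite sum_O | ].
  rewrite sum_Sn, IH. symmetry. apply re_plus.
Qed.

Lemma psum_Im (a : nat -> C) (n : nat) : sum_n (fun k => Im (a k)) n = Im (psum a n).
Proof.
  induction n as [ | n IH ]; [ now rewrite sum_O | ].
  rewrite sum_Sn, IH. symmetry. apply im_plus.
Qed.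

Lemma Cseries_unique (a : nat -> C) (l : C) : csum a l -> Cseries a = l.
Proof.
  intros H. apply Ceq_ReIm; simpl; apply is_series_unique;
    apply (proj2 (filterlim_locally _ _)); intros eps;
    destruct (H eps (cond_pos eps)) as [N HN]; exists N; intros n Hn;
    specialize (HN n Hn).
  - rewrite psum_Re. unfold ball; simpl; unfold AbsRing_ball, abs, minus, plus, opp; simpl.
    eapply Rle_lt_trans; [ | exact HN ].
    replace (Re (psum a n) + - Re l)%R with (Re (psum a n - l)) by (unfold Cminus; now rewrite re_plus, re_opp).
    apply re_le_Cmod.
  - rewrite psum_Im. unfold ball; simpl; unfold AbsRing_ball, abs, minus, plus, opp; simpl.
    eapply Rle_lt_trans; [ | exact HN ].
    replace (Im (psum a n) + - Im l)%R with (Im (psum a n - l)) by (unfold Cminus; now rewrite im_plus, im_opp).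
    apply im_le_Cmod.
Qed.

(** Comparison with a convergent real series; the limit exists because [C] is complete. *)
Lemma csum_le (a : nat -> C) (b : nat -> R) :
  (forall n, (Cmod (a n) <= b n)%R) -> ex_series b -> csum a (Cseries a).
Proof.
  intros H Hb.
  destruct (@ex_series_le C_AbsRing C_CompleteNormedModule a b H Hb) as [l Hl].
  apply (proj1 (is_series_csum a l)) in Hl.
  now rewrite (Cseries_unique _ _ Hl).
Qed.

(* The power series with coefficients [a] has radius of convergence at least [r]. *)
Definition conv_radius (a : nat -> C) (r : R) : Prop :=
  forall rho : R, (0 <= rho < r)%R -> exists M : R, forall n, (Cmod (a n) * rho ^ n <= M)%R.

Definition PS (a : nat -> C) (z : C) : C := Cseries (fun n => a n * z ^ n).

Definition dcoef (a : nat -> C) (n : nat) : C := INR (S n) * a (S n).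

Lemma csum_term_bounded (a : nat -> C) (l : C) :
  csum a l -> exists M : R, forall n, (Cmod (a n) <= M)%R.
Proof.
  intros H. destruct (H 1%R Rlt_0_1) as [N HN].
  assert (HB : forall k, exists M : R, forall n, (n <= k)%nat -> (Cmod (a n) <= M)%R).
  { induction k as [ | k [M HM] ].
    - exists (Cmod (a 0%nat)). intros n Hn. replace n with 0%nat by lia. lra.
    - exists (Rmax M (Cmod (a (S k)))). intros n Hn.
      destruct (Nat.eq_dec n (S k)) as [-> | Hne]; [ apply Rmax_r | ].
      eapply Rle_trans; [ apply HM; lia | apply Rmax_l ]. }
  (* Beyond [S N] a term is the difference of two partial sums that both lie within 1 of the limit,
     hence the bound 2. *)
  destruct (HB (S N)) as [M HM]. exists (Rmax M 2). intros n.
  destruct (Nat.le_gt_cases n (S N)) as [Hle | Hlt].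
  - eapply Rle_trans; [ apply HM; lia | apply Rmax_l ].
  - destruct n as [ | n ]; [ lia | ].
    pose proof (HN n ltac:(lia)) as H1. pose proof (HN (S n) ltac:(lia)) as H2.
    replace (a (S n)) with ((psum a (S n) - l) - (psum a n - l)) by (simpl; ring).
    eapply Rle_trans; [ apply Cmod_minus_le | ].
    eapply Rle_trans; [ | apply Rmax_r ]. lra.
Qed.

Lemma conv_radius_of_csum (a : nat -> C) (r : R) :
  (forall z, (Cmod z < r)%R -> exists l, csum (fun n => a n * z ^ n) l) -> conv_radius a r.
Proof.
  intros H rho Hrho.
  destruct (H (RtoC rho)) as [l Hl]; [ rewrite Cmod_R, Rabs_pos_eq; lra | ].
  destruct (csum_term_bounded _ _ Hl) as [M HM]. exists M. intros n.
  specialize (HM n). rewrite Cmod_mult, Cmod_pow, Cmod_R, Rabs_pos_eq in HM; lra.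
Qed.

Lemma conv_radius_tail (a : nat -> C) (k : nat) (r : R) :
  conv_radius a r -> conv_radius (fun n => a (k + n)%nat) r.
Proof.
  intros Hr s Hs'. destruct (Hr ((s + r) / 2)%R ltac:(lra)) as [M HM].
  (* The intermediate radius is positive even when s = 0, so that division by t^k is legitimate. *)
  set (t := ((s + r) / 2)%R) in *. assert (Ht : (0 < t)%R) by (unfold t; lra).
  exists (M / t ^ k)%R. intros n. apply (proj1 (Rle_div_r _ _ (t ^ k) ltac:(now apply pow_lt))).
  specialize (HM (k + n)%nat). rewrite pow_add in HM.
  assert (s ^ n <= t ^ n)%R by (apply pow_incr; unfold t; lra).
  assert (0 <= Cmod (a (k + n)%nat) * t ^ k)%R
    by (apply Rmult_le_pos; [ apply Cmod_ge_0 | left; now apply pow_lt ]).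
  nra.
Qed.

(** Abel's lemma: the terms are bounded at the radius t midway between s and r, and passing from t
    to s gains the ratio s/t < 1. *)
Lemma geom_bound (a : nat -> C) (r s : R) :
  conv_radius a r -> (0 <= s < r)%R ->
  exists M x : R, (0 <= x < 1)%R /\ (0 <= M)%R /\
    forall n, (Cmod (a n) * s ^ n <= M * x ^ n)%R.
Proof.
  intros Ha Hs. set (t := ((s + r) / 2)%R).
  destruct (Ha t) as [M HM]; [ unfold t; lra | ].
  exists M, (s / t)%R. assert (Ht : (0 < t)%R) by (unfold t; lra).
  repeat split.
  - apply Rmult_le_pos; [ lra | left; now apply Rinv_0_lt_compat ].
  - apply Rlt_div_l; unfold t in *; lra.
  - eapply Rle_trans; [ | apply (HM O) ]. simpl. rewrite Rmult_1_r. apply Cmod_ge_0.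
  - intros n. replace (s ^ n)%R with (t ^ n * (s / t) ^ n)%R.
    + rewrite <- Rmult_assoc. apply Rmult_le_compat_r; [ | apply HM ].
      apply pow_le, Rmult_le_pos; [ lra | left; now apply Rinv_0_lt_compat ].
    + rewrite <- Rpow_mult_distr. f_equal. field. lra.
Qed.

Lemma PS_csum (a : nat -> C) (r : R) (z : C) :
  conv_radius a r -> (Cmod z < r)%R -> csum (fun n => a n * z ^ n) (PS a z).
Proof.
  intros Ha Hz. pose proof (Cmod_ge_0 z) as Hz0.
  destruct (geom_bound a r (Cmod z) Ha ltac:(lra)) as [M [x [Hx [HM H]]]].
  apply csum_le with (b := fun n => (M * x ^ n)%R).
  - intros n. rewrite Cmod_mult, Cmod_pow. apply H.
  - apply (@ex_series_scal R_AbsRing R_NormedModule M (fun n => (x ^ n)%R)). apply ex_series_geom. rewrite Rabs_pos_eq; lra.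
Qed.

Lemma PS_0 (a : nat -> C) : PS a 0 = a 0%nat.
Proof.
  apply Cseries_unique. intros eps Heps. exists 0%nat. intros n _.
  replace (psum (fun n => a n * 0 ^ n) n) with (a 0%nat).
  - replace (a 0%nat - a 0%nat) with (RtoC 0) by ring. now rewrite Cmod_0.
  - induction n as [ | n IH ]; [ cbn [psum Cpow]; ring | ].
    rewrite psum_S, <- IH, Cpow_S. ring.
Qed.

(** By Bernoulli, (1/x)^n >= 1 + n h with h = 1/x - 1, whence n x^n <= 1/h. *)
Lemma linear_geom_bound (x : R) :
  (0 <= x < 1)%R -> exists K : R, forall n, (INR (S n) * x ^ n <= K)%R.
Proof.
  intros Hx. destruct (Req_dec x 0) as [-> | Hx0].
  - exists 1%R. intros [ | n ]; [ simpl; lra | ]. rewrite pow_i; [ lra | lia ].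
  - set (h := (/ x - 1)%R).
    assert (Hh : (0 < h)%R).
    { unfold h. assert (1 < / x)%R; [ | lra ]. rewrite <- Rinv_1. apply Rinv_lt_contravar; lra. }
    exists (1 + / h)%R. intros n.
    assert (HB : (1 + INR n * h <= (/ x) ^ n)%R).
    { replace (/ x)%R with (1 + h)%R by (unfold h; ring). apply poly. exact Hh. }
    rewrite pow_inv in HB.
    assert (Hxn : (0 < x ^ n)%R) by (apply pow_lt; lra).
    assert (Hxn1 : (x ^ n <= 1)%R) by (rewrite <- (pow1 n); apply pow_incr; lra).
    assert (H1 : ((1 + INR n * h) * x ^ n <= 1)%R).
    { apply Rmult_le_compat_r with (r := (x ^ n)%R) in HB; [ | lra ].
      rewrite Rinv_l in HB; lra. }
    rewrite S_INR.
    assert (INR n * x ^ n <= / h)%R.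
    { apply Rmult_le_reg_r with h; [ lra | ]. rewrite Rinv_l; [ | lra ]. nra. }
    lra.
Qed.

(** The factor n + 1 is absorbed by the geometric gain between rho and a larger radius t. *)
Lemma conv_radius_dcoef (a : nat -> C) (r : R) : conv_radius a r -> conv_radius (dcoef a) r.
Proof.
  intros Ha rho Hrho. set (t := ((rho + r) / 2)%R).
  destruct (Ha t) as [M HM]; [ unfold t; lra | ].
  assert (Ht : (0 < t)%R) by (unfold t; lra).
  assert (Hx : (0 <= rho / t < 1)%R).
  { split; [ apply Rmult_le_pos; [ lra | left; now apply Rinv_0_lt_compat ]
           | apply Rlt_div_l; unfold t in *; lra ]. }
  destruct (linear_geom_bound _ Hx) as [K HK].
  exists (M / t * K)%R. intros n. unfold dcoef.
  rewrite Cmod_mult, Cmod_R, Rabs_pos_eq by apply pos_INR.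
  assert (H1 : (Cmod (a (S n)) * t ^ n <= M / t)%R).
  { apply (proj1 (Rle_div_r _ _ _ Ht)). specialize (HM (S n)). simpl pow in HM.
    eapply Rle_trans; [ right | exact HM ]. ring. }
  replace (rho ^ n)%R with (t ^ n * (rho / t) ^ n)%R
    by (rewrite <- Rpow_mult_distr; f_equal; field; lra).
  replace (INR (S n) * Cmod (a (S n)) * (t ^ n * (rho / t) ^ n))%R
    with ((Cmod (a (S n)) * t ^ n) * (INR (S n) * (rho / t) ^ n))%R by ring.
  apply Rmult_le_compat; auto.
  - apply Rmult_le_pos; [ apply Cmod_ge_0 | apply pow_le; lra ].
  - apply Rmult_le_pos; [ apply pos_INR | apply pow_le; lra ].
Qed.

(** The Taylor remainders of consecutive powers satisfy E_{n+1} = u E_n + n z^(n-1) (u - z)^2, E_n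
    being that of the n-th power. The constant is twice the sharp one; it is chosen to match the
    coefficients of [dcoef (dcoef a)]. *)
Lemma pow_diff_bound (u z : C) (s : R) (n : nat) :
  (Cmod u <= s)%R -> (Cmod z <= s)%R ->
  (Cmod (u ^ S (S n) - z ^ S (S n) - INR (S (S n)) * z ^ S n * (u - z))
    <= INR (S (S n)) * INR (S n) * s ^ n * (Cmod (u - z) * Cmod (u - z)))%R.
Proof.
  intros Hu Hz. pose proof (Cmod_ge_0 u) as Hu0. pose proof (Cmod_ge_0 z) as Hz0.
  set (d := Cmod (u - z)). assert (Hd : (0 <= d)%R) by apply Cmod_ge_0.
  induction n as [ | n IH ].
  - replace (u ^ 2 - z ^ 2 - INR 2 * z ^ 1 * (u - z)) with ((u - z) * (u - z)).
    + rewrite Cmod_mult. fold d. simpl. nra.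
    + simpl. rewrite RtoC_plus. ring.
  - replace (u ^ S (S (S n)) - z ^ S (S (S n)) - INR (S (S (S n))) * z ^ S (S n) * (u - z))
      with (u * (u ^ S (S n) - z ^ S (S n) - INR (S (S n)) * z ^ S n * (u - z))
            + INR (S (S n)) * z ^ S n * ((u - z) * (u - z))).
    2:{ rewrite (S_INR (S (S n))), RtoC_plus. simpl Cpow. ring. }
    eapply Rle_trans; [ apply Cmod_triangle | ].
    rewrite !Cmod_mult, Cmod_pow, Cmod_R, Rabs_pos_eq by apply pos_INR. fold d.
    set (E := Cmod (u ^ S (S n) - z ^ S (S n) - INR (S (S n)) * z ^ S n * (u - z))) in *.
    assert (HE : (0 <= E)%R) by apply Cmod_ge_0.
    assert (Hs : (0 <= s ^ n)%R) by (apply pow_le; lra).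
    assert (H1 : (Cmod z ^ S n <= s ^ S n)%R) by (apply pow_incr; lra).
    assert (H2 : (Cmod u * E <= s * (INR (S (S n)) * INR (S n) * s ^ n * (d * d)))%R)
      by (apply Rmult_le_compat; lra).
    assert (H3 : (INR (S (S n)) * Cmod z ^ S n * (d * d) <= INR (S (S n)) * s ^ S n * (d * d))%R).
    { apply Rmult_le_compat_r; [ nra | ]. apply Rmult_le_compat_l; [ apply pos_INR | exact H1 ]. }
    rewrite (S_INR (S (S n))). rewrite (S_INR (S n)) in *.
    pose proof (pos_INR (S n)). simpl pow in *.
    set (m := INR (S n)) in *.
    assert (0 <= (m + 1) * (s * s ^ n) * (d * d))%R.
    { repeat apply Rmult_le_pos; lra. }
    nra.
Qed.

(** Summing the Taylor remainders of the powers bounds the remainder of the series by K |u - z|^2,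
    where K majorises the second derived series at a radius s between |z| and r. *)
Lemma PS_cder (a : nat -> C) (r : R) (z : C) :
  conv_radius a r -> (Cmod z < r)%R -> cder (PS a) z (PS (dcoef a) z).
Proof.
  intros Ha Hz. pose proof (Cmod_ge_0 z) as Hz0.
  set (s := ((Cmod z + r) / 2)%R).
  assert (Hs : (Cmod z < s < r)%R) by (unfold s; lra).
  pose proof (conv_radius_dcoef _ _ Ha) as Hd. pose proof (conv_radius_dcoef _ _ Hd) as Hdd.
  destruct (geom_bound _ r s Hdd ltac:(lra)) as [M [x [Hx [HM H]]]].
  set (K := (M / (1 - x))%R).
  assert (HK : (0 <= K)%R) by (apply Rmult_le_pos; [ lra | left; apply Rinv_0_lt_compat; lra ]).
  assert (HB : forall u, (Cmod u < s)%R ->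
    (Cmod (PS a u - PS a z - PS (dcoef a) z * (u - z)) <= K * (Cmod (u - z) * Cmod (u - z)))%R).
  { intros u Hu.
    (* The derived series is cut one index earlier, since its term of index n comes from [a (S n)].
       Hence [D 0] vanishes and each increment is a single Taylor remainder. *)
    set (D := fun N => psum (fun n => a n * u ^ n) (S N) - psum (fun n => a n * z ^ n) (S N)
                       - psum (fun n => dcoef a n * z ^ n) N * (u - z)).
    assert (HD : clim D (PS a u - PS a z - PS (dcoef a) z * (u - z))).
    { apply clim_ext with (fun N => psum (fun n => a n * u ^ n) (S N)
          + (-1) * psum (fun n => a n * z ^ n) (S N)
          + (- (u - z)) * psum (fun n => dcoef a n * z ^ n) N);
        [ intros N; unfold D; ring | ].
      replace (PS a u - PS a z - PS (dcoef a) z * (u - z))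
        with (PS a u + (-1) * PS a z + (- (u - z)) * PS (dcoef a) z) by ring.
      repeat apply clim_plus; try apply clim_scal; try apply (clim_S (psum _));
        eapply PS_csum; eauto; lra. }
    set (d := (Cmod (u - z) * Cmod (u - z))%R) in *.
    assert (Hd0 : (0 <= d)%R) by (unfold d; pose proof (Cmod_ge_0 (u - z)); nra).
    (* The increments are at most M x^N d, so the bound is their finite geometric sum. *)
    assert (HDb : forall N, (Cmod (D N) <= M * (1 - x ^ N) / (1 - x) * d)%R).
    { induction N as [ | N IH ].
      - replace (D 0%nat) with (RtoC 0).
        + rewrite Cmod_0. simpl. right. field. lra.
        + unfold D, dcoef. simpl. ring.
      - replace (D (S N)) with (D N + a (S (S N)) * (u ^ S (S N) - z ^ S (S N)
            - INR (S (S N)) * z ^ S N * (u - z))).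
        2:{ unfold D. rewrite !psum_S. unfold dcoef. ring. }
        eapply Rle_trans; [ apply Cmod_triangle | ]. rewrite Cmod_mult.
        specialize (H N). unfold dcoef in H.
        rewrite !Cmod_mult, !Cmod_R, !Rabs_pos_eq in H by apply pos_INR.
        pose proof (pow_diff_bound u z s N ltac:(lra) ltac:(lra)) as HP. fold d in HP.
        pose proof (Cmod_ge_0 (a (S (S N)))) as Ha0.
        assert (HQ : (Cmod (a (S (S N))) * Cmod (u ^ S (S N) - z ^ S (S N)
            - INR (S (S N)) * z ^ S N * (u - z)) <= M * x ^ N * d)%R).
        { eapply Rle_trans; [ apply Rmult_le_compat_l; [ exact Ha0 | exact HP ] | ].
          apply Rle_trans with
            ((INR (S N) * (INR (S (S N)) * Cmod (a (S (S N)))) * s ^ N) * d)%R;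
            [ right; ring | ].
          apply Rmult_le_compat_r; assumption. }
        apply Rle_trans with (M * (1 - x ^ N) / (1 - x) * d + M * x ^ N * d)%R; [ lra | ].
        right. simpl pow. field. lra. }
    assert (HDK : forall N, (Cmod (D N - 0) <= K * d)%R).
    { intros N. replace (D N - 0) with (D N) by ring.
      eapply Rle_trans; [ apply HDb | ]. apply Rmult_le_compat_r; [ exact Hd0 | ].
      unfold K. apply Rmult_le_compat_r; [ left; apply Rinv_0_lt_compat; lra | ].
      assert (0 <= x ^ N)%R by (apply pow_le; lra). nra. }
    pose proof (clim_le _ _ _ _ HD HDK) as HF.
    replace (PS a u - PS a z - PS (dcoef a) z * (u - z) - 0)
      with (PS a u - PS a z - PS (dcoef a) z * (u - z)) in HF by ring.
    exact HF. }
  intros eps Heps.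
  exists (Rmin (s - Cmod z) (eps / (K + 1))). split.
  - apply Rmin_pos; [ lra | apply Rdiv_lt_0_compat; lra ].
  - intros u Hu.
    assert (H1 : (Cmod (u - z) < s - Cmod z)%R) by (eapply Rlt_le_trans; [ apply Hu | apply Rmin_l ]).
    assert (H2 : (Cmod (u - z) < eps / (K + 1))%R) by (eapply Rlt_le_trans; [ apply Hu | apply Rmin_r ]).
    apply Rlt_div_r in H2; [ | lra ].
    pose proof (Cmod_le_plus u z) as H3.
    eapply Rle_trans; [ apply HB; lra | ].
    rewrite <- Rmult_assoc. pose proof (Cmod_ge_0 (u - z)).
    apply Rmult_le_compat_r; nra.
Qed.

(** * Integration over circles *)


Definition rcont (g : R -> C) (t : R) : Prop := ctends (locally t) g (g t).

Definition rder (g : R -> C) (t : R) (l : C) : Prop :=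
  forall eps : R, (0 < eps)%R ->
    locally t (fun s => (Cmod (g s - g t - l * RtoC (s - t)) <= eps * Rabs (s - t))%R).

Lemma locally_R (t : R) (P : R -> Prop) :
  locally t P <-> exists d : R, (0 < d)%R /\ forall s, (Rabs (s - t) < d)%R -> P s.
Proof.
  split.
  - intros [d Hd]. exists d. split; [ apply cond_pos | exact Hd ].
  - intros [d [Hd H]]. exists (mkposreal d Hd). exact H.
Qed.

Lemma is_derive_eps (f : R -> R) (t l : R) :
  (forall eps : R, (0 < eps)%R ->
     locally t (fun s => (Rabs (f s - f t - l * (s - t)) <= eps * Rabs (s - t))%R)) <->
  is_derive f t l.
Proof.
  split.
  - intros H. apply is_derive_Reals. intros eps Heps.
    destruct (proj1 (locally_R _ _) (H (eps / 2)%R ltac:(lra))) as [d [Hd Hs]].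
    exists (mkposreal d Hd). simpl. intros h Hh Hhd.
    specialize (Hs (t + h)%R).
    replace (t + h - t)%R with h in Hs by ring. specialize (Hs Hhd).
    replace ((f (t + h) - f t) / h - l)%R with ((f (t + h) - f t - l * h) / h)%R by (field; auto).
    unfold Rdiv. rewrite Rabs_mult, Rabs_inv.
    pose proof (Rabs_pos_lt h Hh).
    apply Rle_lt_trans with (eps / 2 * Rabs h * / Rabs h)%R.
    + apply Rmult_le_compat_r; [ left; now apply Rinv_0_lt_compat | exact Hs ].
    + rewrite Rmult_assoc, Rinv_r; lra.
  - intros H eps Heps. apply is_derive_Reals in H.
    destruct (H eps Heps) as [d Hd]. apply locally_R. exists d. split; [ apply cond_pos | ].
    intros s Hs. destruct (Req_dec s t) as [-> | Hne].
    + replace (f t - f t - l * (t - t))%R with 0%R by ring.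
      rewrite Rabs_R0. pose proof (Rabs_pos (t - t)). nra.
    + specialize (Hd (s - t)%R ltac:(lra) Hs).
      replace (t + (s - t))%R with s in Hd by ring.
      replace (f s - f t - l * (s - t))%R with (((f s - f t) / (s - t) - l) * (s - t))%R
        by (field; lra).
      rewrite Rabs_mult. apply Rmult_le_compat_r; [ apply Rabs_pos | lra ].
Qed.

Lemma Re_minus (x y : C) : Re (x - y) = (Re x - Re y)%R.
Proof. reflexivity. Qed.

Lemma Im_minus (x y : C) : Im (x - y) = (Im x - Im y)%R.
Proof. reflexivity. Qed.

Lemma rder_Re (g : R -> C) (t : R) (l : C) : rder g t l -> is_derive (fun s => Re (g s)) t (Re l).
Proof.
  intros H. apply is_derive_eps. intros eps Heps. generalize (H eps Heps).
  apply filter_imp. intros s Hs. eapply Rle_trans; [ | exact Hs ].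
  rewrite <- re_scal_r, <- !Re_minus. apply re_le_Cmod.
Qed.

Lemma rder_Im (g : R -> C) (t : R) (l : C) : rder g t l -> is_derive (fun s => Im (g s)) t (Im l).
Proof.
  intros H. apply is_derive_eps. intros eps Heps. generalize (H eps Heps).
  apply filter_imp. intros s Hs. eapply Rle_trans; [ | exact Hs ].
  rewrite <- im_scal_r, <- !Im_minus. apply im_le_Cmod.
Qed.

Lemma rder_of_ReIm (g : R -> C) (t : R) (l : C) :
  is_derive (fun s => Re (g s)) t (Re l) -> is_derive (fun s => Im (g s)) t (Im l) -> rder g t l.
Proof.
  intros H1 H2 eps Heps. assert (He : (0 < eps / 2)%R) by lra.
  generalize (filter_and _ _ (proj2 (is_derive_eps _ _ _) H1 _ He) (proj2 (is_derive_eps _ _ _) H2 _ He)).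
  apply filter_imp. intros s [Hs Hs'].
  eapply Rle_trans; [ apply Cmod_le_ReIm | ].
  rewrite !Re_minus, !Im_minus, re_scal_r, im_scal_r. lra.
Qed.

Lemma rder_rcont (g : R -> C) (t : R) (l : C) : rder g t l -> rcont g t.
Proof.
  intros Hg eps Heps. destruct (proj1 (locally_R _ _) (Hg 1%R Rlt_0_1)) as [d [Hd H]].
  pose proof (Cmod_ge_0 l) as Hl. apply locally_R.
  exists (Rmin d (eps / (Cmod l + 2))). split.
  - apply Rmin_pos; [ lra | ]. apply Rdiv_lt_0_compat; lra.
  - intros u Hu.
    assert (H1 : (Rabs (u - t) < d)%R) by (eapply Rlt_le_trans; [ apply Hu | apply Rmin_l ]).
    assert (H2 : (Rabs (u - t) < eps / (Cmod l + 2))%R)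
      by (eapply Rlt_le_trans; [ apply Hu | apply Rmin_r ]).
    specialize (H u H1).
    pose proof (Cmod_le_plus (g u - g t) (l * RtoC (u - t))) as H3.
    rewrite Cmod_mult, Cmod_R in H3.
    apply Rlt_div_r in H2; [ | lra ].
    pose proof (Rabs_pos (u - t)). nra.
Qed.

Lemma rder_comp (f : C -> C) (g : R -> C) (t : R) (l m : C) :
  cder f (g t) l -> rder g t m -> rder (fun s => f (g s)) t (l * m).
Proof.
  intros Hf Hg eps Heps.
  pose proof (Cmod_ge_0 l) as Hl. pose proof (Cmod_ge_0 m) as Hm.
  (* The same choice of error as for the composition of two complex functions. *)
  set (e1 := Rmin 1 (eps / (Cmod l + Cmod m + 2))).
  assert (He : (0 < eps / (Cmod l + Cmod m + 2))%R) by (apply Rdiv_lt_0_compat; lra).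
  assert (He1 : (0 < e1)%R) by (apply Rmin_pos; lra).
  assert (He1' : (e1 <= 1)%R) by apply Rmin_l.
  assert (He2 : (e1 * (Cmod l + Cmod m + 2) <= eps)%R).
  { apply Rle_div_r; [ lra | apply Rmin_r ]. }
  destruct (Hf e1 He1) as [d [Hd Hfd]].
  generalize (filter_and _ _ (rder_rcont _ _ _ Hg d Hd) (Hg e1 He1)).
  apply filter_imp. intros u [Hu H']. specialize (Hfd _ Hu). 
  replace (f (g u) - f (g t) - l * m * RtoC (u - t))
    with ((f (g u) - f (g t) - l * (g u - g t)) + l * (g u - g t - m * RtoC (u - t))) by ring.
  eapply Rle_trans; [ apply Cmod_triangle | ]. rewrite Cmod_mult.
  pose proof (Cmod_le_plus (g u - g t) (m * RtoC (u - t))) as H3. rewrite Cmod_mult, Cmod_R in H3.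
  pose proof (Rabs_pos (u - t)) as H4.
  assert (Cmod (g u - g t) <= (Cmod m + 1) * Rabs (u - t))%R by nra.
  assert (e1 * Cmod (g u - g t) <= e1 * ((Cmod m + 1) * Rabs (u - t)))%R
    by (apply Rmult_le_compat_l; lra).
  assert (Cmod l * Cmod (g u - g t - m * RtoC (u - t)) <= Cmod l * (e1 * Rabs (u - t)))%R
    by (apply Rmult_le_compat_l; lra).
  assert (e1 * (Cmod l + Cmod m + 2) * Rabs (u - t) <= eps * Rabs (u - t))%R
    by (apply Rmult_le_compat_r; lra).
  nra.
Qed.

Lemma rcont_comp (f : C -> C) (g : R -> C) (t : R) :
  ccont f (g t) -> rcont g t -> rcont (fun s => f (g s)) t.
Proof. intros Hf Hg. exact (ctends_ccont _ _ _ _ Hg Hf). Qed.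

Lemma rcont_mult (f g : R -> C) (t : R) : rcont f t -> rcont g t -> rcont (fun s => f s * g s) t.
Proof. apply (ctends_mult (locally t)). Qed.

Lemma rcont_const (k : C) (t : R) : rcont (fun _ => k) t.
Proof. apply (ctends_const (locally t)). Qed.

Lemma rder_line (z d : C) (t : R) : rder (fun s => z + RtoC s * d) t d.
Proof.
  intros eps Heps. apply filter_forall. intros s.
  rewrite RtoC_minus.
  replace (z + s * d - (z + t * d) - d * (s - t)) with (RtoC 0) by ring.
  rewrite Cmod_0. pose proof (Rabs_pos (s - t)). nra.
Qed.

Lemma rcont_Re (g : R -> C) (t : R) : rcont g t -> continuous (fun s => Re (g s)) t.
Proof.
  intros H. apply (proj2 (filterlim_locally _ _)). intros eps.
  generalize (H eps (cond_pos eps)). apply filter_imp. intros s Hs.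
  change (Rabs (Re (g s - g t)) < eps)%R.
  eapply Rle_lt_trans; [ apply re_le_Cmod | exact Hs ].
Qed.

Lemma rcont_Im (g : R -> C) (t : R) : rcont g t -> continuous (fun s => Im (g s)) t.
Proof.
  intros H. apply (proj2 (filterlim_locally _ _)). intros eps.
  generalize (H eps (cond_pos eps)). apply filter_imp. intros s Hs.
  change (Rabs (Im (g s - g t)) < eps)%R.
  eapply Rle_lt_trans; [ apply im_le_Cmod | exact Hs ].
Qed.

Lemma Ci_sqr : Ci * Ci = - (1).
Proof. apply Ceq_ReIm; simpl; ring. Qed.

Definition cis (t : R) : C := (cos t, sin t).

Lemma Cmod_cis (t : R) : Cmod (cis t) = 1%R.
Proof.
  unfold Cmod, cis. simpl.
  replace (cos t * (cos t * 1) + sin t * (sin t * 1))%R with 1%R.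
  - apply sqrt_1.
  - pose proof (sin2_cos2 t). unfold Rsqr in H. lra.
Qed.

Lemma rder_cis (t : R) : rder cis t (Ci * cis t).
Proof.
  apply rder_of_ReIm; unfold cis; simpl; auto_derive; auto; ring.
Qed.

(** Defined by components, because the fundamental theorem and the differentiation of parametric
    integrals are applied to real integrands. *)
Definition CI (g : R -> C) : C :=
  (RInt (fun t => Re (g t)) 0 (2 * PI), RInt (fun t => Im (g t)) 0 (2 * PI)).

Lemma Re_CI (g : R -> C) : Re (CI g) = RInt (fun t => Re (g t)) 0 (2 * PI).
Proof. reflexivity. Qed.

Lemma Im_CI (g : R -> C) : Im (CI g) = RInt (fun t => Im (g t)) 0 (2 * PI).
Proof. reflexivity. Qed.

Lemma ex_RInt_Re (g : R -> C) : (forall t, rcont g t) -> ex_RInt (fun t => Re (g t)) 0 (2 * PI).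
Proof. intros H. apply (ex_RInt_continuous (V:=R_CompleteNormedModule)). intros t _. now apply rcont_Re. Qed.

Lemma ex_RInt_Im (g : R -> C) : (forall t, rcont g t) -> ex_RInt (fun t => Im (g t)) 0 (2 * PI).
Proof. intros H. apply (ex_RInt_continuous (V:=R_CompleteNormedModule)). intros t _. now apply rcont_Im. Qed.

Lemma RInt_ext_all (f g : R -> R) (a b : R) :
  (forall t, f t = g t) -> RInt f a b = RInt g a b.
Proof. intros H. apply RInt_ext. intros t _. apply H. Qed.

Lemma CI_ext (f g : R -> C) : (forall t, f t = g t) -> CI f = CI g.
Proof. intros H. unfold CI. f_equal; apply RInt_ext_all; intros t; now rewrite H. Qed.

Lemma CI_plus (f g : R -> C) :
  (forall t, rcont f t) -> (forall t, rcont g t) -> CI (fun t => f t + g t) = CI f + CI g.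
Proof.
  intros Hf Hg. apply Ceq_ReIm; simpl.
  - apply (RInt_plus (fun t => Re (f t)) (fun t => Re (g t))); now apply ex_RInt_Re.
  - apply (RInt_plus (fun t => Im (f t)) (fun t => Im (g t))); now apply ex_RInt_Im.
Qed.

Lemma RInt_lin (f g : R -> R) (a b x y : R) :
  ex_RInt f a b -> ex_RInt g a b ->
  RInt (fun t => (x * f t + y * g t)%R) a b = (x * RInt f a b + y * RInt g a b)%R.
Proof.
  intros Hf Hg. apply is_RInt_unique.
  apply (is_RInt_plus (V:=R_NormedModule) (fun t => (x * f t)%R) (fun t => (y * g t)%R));
    apply (is_RInt_scal (V:=R_NormedModule)); now apply (RInt_correct (V:=R_CompleteNormedModule)).
Qed.

Lemma CI_scal (k : C) (g : R -> C) :
  (forall t, rcont g t) -> CI (fun t => k * g t) = k * CI g.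
Proof.
  intros Hg. pose proof (ex_RInt_Re g Hg) as H1. pose proof (ex_RInt_Im g Hg) as H2.
  apply Ceq_ReIm.
  - rewrite re_mult, !Re_CI, !Im_CI.
    rewrite (RInt_ext_all _ (fun t => (Re k * Re (g t) + - Im k * Im (g t))%R))
      by (intros t; rewrite re_mult; ring).
    rewrite RInt_lin by assumption. ring.
  - rewrite im_mult, !Re_CI, !Im_CI.
    rewrite (RInt_ext_all _ (fun t => (Re k * Im (g t) + Im k * Re (g t))%R))
      by (intros t; rewrite im_mult; ring).
    now rewrite RInt_lin.
Qed.

(** Bounding the two components separately costs a factor 2 against the optimal 2 PI M;
    [max_modulus] removes the loss later. *)
Lemma CI_bound (g : R -> C) (M : R) :
  (forall t, rcont g t) -> (forall t, (Cmod (g t) <= M)%R) -> (Cmod (CI g) <= 4 * PI * M)%R.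
Proof.
  intros Hg HM. pose proof PI_RGT_0 as Hpi.
  eapply Rle_trans; [ apply Cmod_le_ReIm | ]. simpl.
  pose proof (abs_RInt_le_const (fun t => Re (g t)) 0 (2 * PI) M ltac:(lra) (ex_RInt_Re g Hg)
    (fun t _ => Rle_trans _ _ _ (re_le_Cmod _) (HM t))).
  pose proof (abs_RInt_le_const (fun t => Im (g t)) 0 (2 * PI) M ltac:(lra) (ex_RInt_Im g Hg)
    (fun t _ => Rle_trans _ _ _ (im_le_Cmod _) (HM t))).
  lra.
Qed.

Lemma RInt_Re_closed (G g : R -> C) :
  (forall t, rder G t (g t)) -> (forall t, rcont g t) -> G (2 * PI)%R = G 0%R ->
  RInt (fun t => Re (g t)) 0 (2 * PI) = 0%R.
Proof.
  intros HG Hg Heq. apply is_RInt_unique.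
  replace 0%R with (minus (Re (G (2 * PI)%R)) (Re (G 0%R))) at 2
    by (rewrite Heq; unfold minus, plus, opp; simpl; ring).
  apply (is_RInt_derive (V:=R_CompleteNormedModule) (fun t => Re (G t))).
  - intros t _. now apply rder_Re.
  - intros t _. now apply rcont_Re.
Qed.

Lemma rder_scal (k : C) (g : R -> C) (t : R) (l : C) :
  rder g t l -> rder (fun s => k * g s) t (k * l).
Proof.
  intros H. apply (rder_comp (fun u => k * u) g t k l); [ | exact H ].
  pose proof (cder_scal k (fun u => u) (g t) 1 (cder_id (g t))) as H1.
  now rewrite Cmult_1_r in H1.
Qed.

Lemma CI_closed (G g : R -> C) :
  (forall t, rder G t (g t)) -> (forall t, rcont g t) -> G (2 * PI)%R = G 0%R -> CI g = 0.
Proof.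
  intros HG Hg Heq. apply Ceq_ReIm; simpl.
  - now apply (RInt_Re_closed G).
  (* Im x = Re (-i x) reduces the imaginary part to the case already treated. *)
  - transitivity (RInt (fun t => Re (- Ci * g t)) 0 (2 * PI)).
    + apply RInt_ext_all. intros t. rewrite re_mult. simpl. ring.
    + apply (RInt_Re_closed (fun t => - Ci * G t) (fun t => - Ci * g t)).
      * intros t. now apply rder_scal.
      * intros t. apply rcont_mult; [ apply rcont_const | apply Hg ].
      * now rewrite Heq.
Qed.

Section Circle.

Variable r : R.
Hypothesis Hr : (0 < r)%R.

Definition circ (t : R) : C := r * cis t.

Lemma Cmod_circ (t : R) : Cmod (circ t) = r.
Proof. unfold circ. rewrite Cmod_mult, Cmod_cis, Cmod_R, Rabs_pos_eq; lra. Qed.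

Lemma circ_neq (z : C) (t : R) : (Cmod z < r)%R -> circ t - z <> 0.
Proof.
  intros Hz H. apply Ceq_minus in H. rewrite <- H, Cmod_circ in Hz. lra.
Qed.

Lemma circ_neq_0 (t : R) : circ t <> 0.
Proof. apply Cmod_gt_0. now rewrite Cmod_circ. Qed.

Lemma rder_circ (t : R) : rder circ t (Ci * circ t).
Proof.
  replace (Ci * circ t) with (r * (Ci * cis t)) by (unfold circ; ring).
  apply rder_scal, rder_cis.
Qed.

Lemma rcont_circ (t : R) : rcont circ t.
Proof. exact (rder_rcont _ _ _ (rder_circ t)). Qed.

Lemma circ_period : circ (2 * PI) = circ 0.
Proof. unfold circ, cis. now rewrite cos_2PI, sin_2PI, cos_0, sin_0. Qed.

Lemma rcont_kernel (z : C) (t : R) :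
  (Cmod z < r)%R -> rcont (fun s => circ s / (circ s - z)) t.
Proof.
  intros Hz. apply (rcont_comp (fun u => u / (u - z)) circ); [ | apply rcont_circ ].
  eapply cder_ccont, (cder_div (fun u => u) (fun u => u - z)).
  - apply cder_id.
  - apply cder_minus; [ apply cder_id | apply cder_const ].
  - now apply circ_neq.
Qed.

Lemma rcont_circ_inv_pow (n : nat) (t : R) : rcont (fun s => (/ circ s) ^ n) t.
Proof.
  induction n as [ | n IH ]; [ exact (rcont_const 1 t) | ].
  apply (rcont_mult (fun s => / circ s)); [ | exact IH ].
  apply (rcont_comp (fun u => / u) circ); [ | apply rcont_circ ].
  eapply cder_ccont, cder_inv, circ_neq_0.
Qed.

(** The kernel is the geometric series in z / circ t. Working with its exact remainder replaces the
    exchange of sum and integral by one estimate of an integral. *)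
Lemma CI_kernel_series (h : R -> C) (M : R) (z : C) :
  (forall t, rcont h t) -> (forall t, (Cmod (h t) <= M)%R) -> (Cmod z < r)%R ->
  csum (fun n => CI (fun t => h t * (/ circ t) ^ n) * z ^ n)
       (CI (fun t => h t * (circ t / (circ t - z)))).
Proof.
  intros Hh HM Hz. pose proof (Cmod_ge_0 z) as Hz0.
  (* What is left after the terms of index below n; since |circ t - z| >= r - |z|, it decays like
     (|z|/r)^n. *)
  set (Rem := fun n => CI (fun t => z ^ n * (h t * (/ circ t) ^ n * (circ t / (circ t - z))))).
  assert (Hc : forall n t, rcont (fun t => h t * (/ circ t) ^ n) t).
  { intros n t. apply rcont_mult; [ apply Hh | apply rcont_circ_inv_pow ]. }
  assert (Hck : forall n t, rcont (fun t => h t * (/ circ t) ^ n * (circ t / (circ t - z))) t).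
  { intros n t. apply rcont_mult; [ apply Hc | now apply rcont_kernel ]. }
  assert (HS : forall n, Rem n = CI (fun t => h t * (/ circ t) ^ n) * z ^ n + Rem (S n)).
  { intros n. rewrite Cmult_comm. rewrite <- CI_scal by apply Hc.
    unfold Rem. rewrite <- CI_plus.
    - apply CI_ext. intros t. rewrite !Cpow_S.
      pose proof (circ_neq_0 t). pose proof (circ_neq z t Hz). field. auto.
    - intros t. apply (rcont_mult (fun _ => z ^ n)); [ apply rcont_const | apply Hc ].
    - intros t. apply (rcont_mult (fun _ => z ^ S n)); [ apply rcont_const | apply Hck ]. }
  assert (HT : forall n, CI (fun t => h t * (circ t / (circ t - z)))
      = psum (fun n => CI (fun t => h t * (/ circ t) ^ n) * z ^ n) n + Rem (S n)).
  { induction n as [ | n IH ].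
    - transitivity (Rem 0%nat); [ | rewrite HS; reflexivity ].
      unfold Rem. apply CI_ext. intros t. simpl. ring.
    - rewrite IH, (HS (S n)), psum_S. ring. }
  assert (HM0 : (0 <= M)%R) by (eapply Rle_trans; [ apply Cmod_ge_0 | apply (HM 0%R) ]).
  assert (HB : forall n, (Cmod (Rem n) <= 4 * PI * (M * (r / (r - Cmod z))) * (Cmod z / r) ^ n)%R).
  { intros n.
    rewrite Rmult_assoc. apply CI_bound.
    - intros t. apply (rcont_mult (fun _ => z ^ n)); [ apply rcont_const | apply Hck ].
    - intros t. rewrite !Cmod_mult, !Cmod_pow, Cmod_inv, Cmod_div, Cmod_circ
        by (try apply circ_neq; auto; apply circ_neq_0).
      replace ((Cmod z / r) ^ n)%R with (Cmod z ^ n * (/ r) ^ n)%R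
        by (unfold Rdiv; now rewrite Rpow_mult_distr).
      assert (Hq : (r / Cmod (circ t - z) <= r / (r - Cmod z))%R).
      { apply Rmult_le_compat_l; [ lra | ]. apply Rinv_le_contravar; [ lra | ].
        pose proof (Cmod_le_plus (circ t) z) as H1. rewrite Cmod_circ in H1. lra. }
      assert (Hq0 : (0 <= r / Cmod (circ t - z))%R).
      { apply Rmult_le_pos; [ lra | ]. left. apply Rinv_0_lt_compat.
        apply Cmod_gt_0. now apply circ_neq. }
      assert (Hp : (0 <= Cmod z ^ n * (/ r) ^ n)%R).
      { apply Rmult_le_pos; apply pow_le; [ lra | left; now apply Rinv_0_lt_compat ]. }
      apply Rle_trans with ((Cmod (h t) * (r / Cmod (circ t - z))) * (Cmod z ^ n * (/ r) ^ n))%R;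
        [ right; ring | ].
      apply Rmult_le_compat_r; [ exact Hp | ].
      apply Rmult_le_compat; auto. apply Cmod_ge_0. }
  intros eps Heps.
  set (K := (4 * PI * (M * (r / (r - Cmod z))))%R) in *.
  assert (HK : (0 <= K)%R).
  { unfold K. pose proof PI_RGT_0.
    assert (0 < / (r - Cmod z))%R by (apply Rinv_0_lt_compat; lra).
    unfold Rdiv. apply Rmult_le_pos; [ lra | ]. repeat apply Rmult_le_pos; lra. }
  assert (Hx : (0 <= Cmod z / r < 1)%R).
  { split; [ apply Rmult_le_pos; [ lra | left; now apply Rinv_0_lt_compat ]
           | apply Rlt_div_l; lra ]. }
  destruct (pow_lt_1_zero (Cmod z / r) ltac:(rewrite Rabs_pos_eq; lra) (eps / (K + 1))%R
              ltac:(apply Rdiv_lt_0_compat; lra)) as [N HN].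
  exists N. intros n Hn. rewrite (HT n).
  match goal with |- (Cmod (?p - (?p + ?q)) < _)%R => replace (p - (p + q)) with (- q) by ring end.
  rewrite Cmod_opp. eapply Rle_lt_trans; [ apply HB | ].
  specialize (HN (S n) ltac:(lia)). rewrite Rabs_pos_eq in HN by (apply pow_le; lra).
  apply Rlt_div_r in HN; [ | lra ].
  assert (0 <= (Cmod z / r) ^ S n)%R by (apply pow_le; lra). lra.
Qed.

(** The kernel series with h = 1: the coefficient of index 0 is 2 PI, and every other one integrates
    a negative power of [circ], which has a periodic antiderivative. *)
Lemma CI_kernel_one (z : C) :
  (Cmod z < r)%R -> CI (fun t => circ t / (circ t - z)) = RtoC (2 * PI).
Proof.
  intros Hz.
  assert (H : csum (fun n => CI (fun t => 1 * (/ circ t) ^ n) * z ^ n)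
       (CI (fun t => 1 * (circ t / (circ t - z))))).
  { apply (CI_kernel_series (fun _ => 1) 1 z); auto.
    - intros t. apply rcont_const.
    - intros t. rewrite Cmod_1. lra. }
  rewrite (CI_ext (fun t => circ t / (circ t - z)) (fun t => 1 * (circ t / (circ t - z))))
    by (intros t; ring).
  apply (clim_unique _ _ _ H).
  assert (H0 : CI (fun t => 1 * (/ circ t) ^ 0) = RtoC (2 * PI)).
  { rewrite (CI_ext _ (fun _ => RtoC 1)) by (intros t; simpl; ring).
    unfold CI. simpl. rewrite !RInt_const. unfold scal; simpl; unfold mult; simpl.
    unfold RtoC. f_equal; ring. }
  assert (Hn : forall n, CI (fun t => 1 * (/ circ t) ^ S n) = 0).
  { intros n.
    rewrite (CI_ext _ (fun t => INR (S n) * (/ circ t) ^ n * (- / (circ t * circ t) * (Ci * circ t))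
                                 * (Ci / INR (S n)))).
    2:{ intros t. rewrite Cpow_S.
        assert (RtoC (INR (S n)) <> 0) by (intros HH; apply RtoC_inj in HH; revert HH; apply not_0_INR; lia).
        pose proof (circ_neq_0 t).
        replace (1 * (/ circ t * (/ circ t) ^ n)) with (- (Ci * Ci) * (/ circ t * (/ circ t) ^ n)).
        - field. auto.
        - rewrite Ci_sqr. ring. }
    rewrite (CI_ext _ (fun t => Ci / INR (S n) * (INR (S n) * (/ circ t) ^ n * - / (circ t * circ t) * (Ci * circ t))))
      by (intros t; ring).
    (* With k = n + 1, the t-derivative of circ^(-k) is -i k circ^(-k); multiplying by i/k leaves
       circ^(-k). *)
    apply (CI_closed (fun t => Ci / INR (S n) * (/ circ t) ^ S n)).
    - intros t. apply rder_scal.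
      apply (rder_comp (fun u => (/ u) ^ S n) circ); [ | apply rder_circ ].
      apply (cder_comp (fun v => v ^ S n) (fun u => / u)); [ apply cder_pow | ].
      apply cder_inv, circ_neq_0.
    - intros t. apply rcont_mult; [ apply rcont_const | ].
      apply rcont_mult.
      + apply rcont_mult.
        * apply rcont_mult; [ apply rcont_const | apply rcont_circ_inv_pow ].
        * apply (rcont_comp (fun u => - / (u * u)) circ); [ | apply rcont_circ ].
          apply (ccont_ext_near (fun u => (-1) * / (u * u))).
          { exists 1%R. split; [ lra | ]. intros u _. ring. }
          eapply cder_ccont, cder_scal, (cder_comp (fun v => / v) (fun u => u * u)).
          { apply cder_inv. apply Cmult_neq_0; apply circ_neq_0. }
          apply cder_sqr.
      + apply rcont_mult; [ apply rcont_const | apply rcont_circ ].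
    - now rewrite circ_period. }
  intros eps Heps. exists 0%nat. intros n _.
  replace (psum (fun n => CI (fun t => 1 * (/ circ t) ^ n) * z ^ n) n) with (RtoC (2 * PI)).
  - replace (RtoC (2 * PI) - RtoC (2 * PI)) with (RtoC 0) by ring. now rewrite Cmod_0.
  - induction n as [ | n IH ].
    + change (RtoC (2 * PI) = CI (fun t => 1 * (/ circ t) ^ 0) * 1). rewrite H0. ring.
    + rewrite psum_S, <- IH, Hn. ring.
Qed.

End Circle.

(** * Cauchy's formula *)


Lemma ctends_fst (x y : R) :
  ctends (locally ((x, y) : R * R)) (fun p => RtoC (fst p)) (RtoC x).
Proof.
  intros eps Heps. exists (mkposreal eps Heps). intros [u v] [Hu _].
  rewrite <- RtoC_minus, Cmod_R. exact Hu.
Qed.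

Lemma ctends_snd (g : R -> C) (x y : R) :
  rcont g y -> ctends (locally ((x, y) : R * R)) (fun p => g (snd p)) (g y).
Proof.
  intros H eps Heps. destruct (H eps Heps) as [d Hd]. exists d.
  intros [u v] [_ Hv]. apply Hd. exact Hv.
Qed.

Lemma ctends_2d_Re (F : R * R -> C) (x y : R) :
  ctends (locally ((x, y) : R * R)) F (F (x, y)) ->
  continuity_2d_pt (fun u v => Re (F (u, v))) x y.
Proof.
  intros H eps. apply locally_2d_locally.
  generalize (H eps (cond_pos eps)). apply filter_imp. intros [u v] Huv.
  cbn [fst snd]. rewrite <- Re_minus. eapply Rle_lt_trans; [ apply re_le_Cmod | exact Huv ].
Qed.

Section Cauchy.

Variables (f f' : C -> C) (R0 r : R) (z : C).
Hypothesis Hf : forall u, (Cmod u < R0)%R -> cder f u (f' u).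
Hypothesis Hf' : forall u, (Cmod u < R0)%R -> ccont f' u.
Hypothesis Hr : (0 < r < R0)%R.
Hypothesis Hz : (Cmod z < r)%R.

Local Notation g := (circ r).
(** The points z + x w(t), for x from 0 to 1, expand from the centre z to the full circle. The
    kernel satisfies w k = g, which cancels its singular denominator after differentiation in x. *)
Let w (t : R) : C := g t - z.
Let k (t : R) : C := g t / (g t - z).

Lemma Cauchy_w_neq (t : R) : w t <> 0.
Proof. apply circ_neq; lra. Qed.

Lemma Cauchy_w_bound (t : R) : (Cmod (w t) <= 2 * r)%R.
Proof.
  unfold w. eapply Rle_trans; [ apply Cmod_minus_le | ].
  rewrite Cmod_circ; lra.
Qed.

Lemma Cauchy_in_ball (x t : R) : (0 <= x <= 1)%R -> (Cmod (z + x * w t) <= r)%R.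
Proof.
  intros Hx. replace (z + x * w t) with (RtoC (1 - x) * z + x * g t)
    by (unfold w; rewrite RtoC_minus; ring).
  eapply Rle_trans; [ apply Cmod_triangle | ].
  rewrite !Cmod_mult, Cmod_circ, !Cmod_R, !Rabs_pos_eq by lra.
  pose proof (Cmod_ge_0 z). nra.
Qed.

(** Two-sided derivatives at x = 0 and x = 1 require values of the parameter slightly outside
    [0, 1]; the margin comes from |w| <= 2r. *)
Lemma Cauchy_near_ball (x y t : R) :
  (0 <= x <= 1)%R -> (Rabs (y - x) < (R0 - r) / (2 * r))%R -> (Cmod (z + y * w t) < R0)%R.
Proof.
  intros Hx Hy. replace (z + y * w t) with ((z + x * w t) + RtoC (y - x) * w t)
    by (rewrite RtoC_minus; ring).
  eapply Rle_lt_trans; [ apply Cmod_triangle | ].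
  pose proof (Cauchy_in_ball x t Hx). pose proof (Cauchy_w_bound t).
  rewrite Cmod_mult, Cmod_R. apply Rlt_div_r in Hy; [ | lra ].
  pose proof (Rabs_pos (y - x)). nra.
Qed.

Lemma rcont_w (t : R) : rcont w t.
Proof.
  apply (rcont_comp (fun u => u - z) g).
  - eapply cder_ccont, cder_minus; [ apply cder_id | apply cder_const ].
  - apply rcont_circ.
Qed.

Lemma Cauchy_is_derive (x t : R) : (Cmod (z + x * w t) < R0)%R ->
  is_derive (fun y => Re (f (z + RtoC y * w t) * k t)) x (Re (f' (z + x * w t) * g t)).
Proof.
  intros H.
  assert (H1 : rder (fun y => k t * f (z + RtoC y * w t)) x (k t * (f' (z + x * w t) * w t))).
  { apply rder_scal. apply (rder_comp f (fun y => z + RtoC y * w t)); [ now apply Hf | ].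
    apply rder_line. }
  apply rder_Re in H1.
  replace (f' (z + x * w t) * g t) with (k t * (f' (z + x * w t) * w t)).
  - apply is_derive_ext with (2 := H1). intros y. now rewrite Cmult_comm.
  - unfold k. pose proof (Cauchy_w_neq t). unfold w in *. field. auto.
Qed.

Lemma rcont_integrand (h : C -> C) (x t : R) :
  ccont h (z + x * w t) -> rcont (fun s => h (z + x * w s)) t.
Proof.
  intros H. apply (rcont_comp h (fun s => z + x * w s)); [ exact H | ].
  apply (ctends_plus (locally t)); [ apply (ctends_const (locally t)) | ].
  apply (rcont_mult (fun _ => RtoC x)); [ apply rcont_const | apply rcont_w ].
Qed.

(** Up to a constant factor the integrand is the t-derivative of f along the closed curve z + x
    w(t). *)
Lemma Cauchy_deriv_integral (x : R) : (0 <= x <= 1)%R ->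
  RInt (fun t => Re (f' (z + x * w t) * g t)) 0 (2 * PI) = 0%R.
Proof.
  intros Hx.
  assert (Hc : forall t, rcont (fun t => f' (z + x * w t) * g t) t).
  { intros t. apply rcont_mult; [ | apply rcont_circ ].
    apply rcont_integrand, Hf'. pose proof (Cauchy_in_ball x t Hx). lra. }
  (* The antiderivative carries a factor 1/x. At x = 0 the integrand is f'(z) g(t), whose
     antiderivative is explicit. *)
  destruct (Req_dec x 0) as [-> | Hx0].
  - apply (RInt_Re_closed (fun t => f' z * (- Ci) * g t) (fun t => f' (z + RtoC 0 * w t) * g t)).
    + intros t. replace (f' (z + RtoC 0 * w t) * g t) with (f' z * - Ci * (Ci * g t)).
      * apply rder_scal, rder_circ.
      * replace (z + RtoC 0 * w t) with z by ring.
        replace (f' z * - Ci * (Ci * g t)) with (f' z * (- (Ci * Ci)) * g t) by ring.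
        rewrite Ci_sqr. ring.
    + exact Hc.
    + now rewrite circ_period.
  - assert (Hx' : RtoC x <> 0) by (intros H; apply RtoC_inj in H; lra).
    apply (RInt_Re_closed (fun t => - Ci / x * f (z + x * w t)) (fun t => f' (z + x * w t) * g t)).
    + intros t. replace (f' (z + x * w t) * g t)
        with (- Ci / x * (f' (z + x * w t) * (x * (Ci * g t)))).
      * apply rder_scal. apply (rder_comp f (fun t => z + x * w t)).
        { apply Hf. pose proof (Cauchy_in_ball x t Hx). lra. }
        replace (x * (Ci * g t)) with (x * 1 * (Ci * g t)) by ring.
        apply (rder_comp (fun u => z + x * (u - z)) g); [ | apply rder_circ ].
        replace (x * 1) with (0 + x * (1 - 0)) by ring.
        apply cder_plus; [ apply cder_const | ].
        apply cder_scal, cder_minus; [ apply cder_id | apply cder_const ].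
      * transitivity (- (Ci * Ci) * (f' (z + x * w t) * g t)); [ field; auto | ].
        rewrite Ci_sqr. ring.
    + exact Hc.
    + unfold w. now rewrite circ_period.
Qed.

Lemma rcont_k (t : R) : rcont k t.
Proof. apply rcont_kernel; lra. Qed.

Lemma Cauchy_param_derive (x : R) : (0 <= x <= 1)%R ->
  is_derive (fun y => RInt (fun t => Re (f (z + RtoC y * w t) * k t)) 0 (2 * PI)) x 0%R.
Proof.
  intros Hx.
  set (e := ((R0 - r) / (2 * r))%R).
  assert (He : (0 < e)%R) by (apply Rdiv_lt_0_compat; lra).
  assert (Hball : forall y t, (Rabs (y - x) < e)%R -> (Cmod (z + RtoC y * w t) < R0)%R)
    by (intros y t Hy; exact (Cauchy_near_ball x y t Hx Hy)).
  assert (Hx0 : (Rabs (x - x) < e)%R) by (rewrite Rminus_eq_0, Rabs_R0; exact He).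
  pose proof (is_derive_RInt_param (fun y t => Re (f (z + RtoC y * w t) * k t)) 0 (2 * PI) x) as H.
  cbn beta in H.
  assert (E : RInt (fun t => Derive (fun u => Re (f (z + RtoC u * w t) * k t)) x) 0 (2 * PI) = 0%R).
  { eapply eq_trans; [ | exact (Cauchy_deriv_integral x Hx) ]. apply RInt_ext_all. intros t.
    apply is_derive_unique, Cauchy_is_derive. auto. }
  rewrite E in H. apply H; clear H E.
    + apply locally_R. exists e. split; [ exact He | ]. intros y Hy t _.
      eexists. apply Cauchy_is_derive. auto.
    + intros t _.
      (* Joint continuity is demanded of the partial derivative; near the point it is replaced by
         its explicit formula, where continuity of [f'] enters. *)
      apply continuity_2d_pt_ext_loc with (fun u v => Re ((fun p => f' (z + RtoC (fst p) * w (snd p)) * g (snd p)) (u, v))).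
      * exists (mkposreal e He). intros u v Hu _. symmetry. apply is_derive_unique.
        apply Cauchy_is_derive. auto.
      * apply (ctends_2d_Re (fun p => f' (z + RtoC (fst p) * w (snd p)) * g (snd p))).
        apply (ctends_mult (locally _)); [ | apply ctends_snd, rcont_circ ].
        apply (ctends_ccont (locally _) f'); [ | apply Hf', Hball; exact Hx0 ].
        apply (ctends_plus (locally _)); [ apply (ctends_const (locally _)) | ].
        apply (ctends_mult (locally _)); [ apply ctends_fst | apply ctends_snd, rcont_w ].
    + apply locally_R. exists e. split; [ exact He | ]. intros y Hy.
      apply (ex_RInt_Re (fun t => f (z + RtoC y * w t) * k t)). intros t.
      apply rcont_mult; [ | apply rcont_k ].
      apply rcont_integrand. eapply cder_ccont, Hf. auto.
Qed.

(** The integral does not depend on x; x = 1 gives the left side and x = 0 the right side. *)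
Lemma Cauchy_formula_Re :
  RInt (fun t => Re (f (g t) * k t)) 0 (2 * PI) = RInt (fun t => Re (f z * k t)) 0 (2 * PI).
Proof.
  pose proof (eq_is_derive (fun y => RInt (fun t => Re (f (z + RtoC y * w t) * k t)) 0 (2 * PI)) 0 1
                Cauchy_param_derive Rlt_0_1) as H.
  cbn beta in H.
  transitivity (RInt (fun t => Re (f (z + RtoC 1 * w t) * k t)) 0 (2 * PI)).
  - apply RInt_ext_all. intros t. do 3 f_equal. unfold w. ring.
  - rewrite <- H. apply RInt_ext_all. intros t. do 3 f_equal. ring.
Qed.

End Cauchy.

Lemma Cauchy_formula (f f' : C -> C) (R0 r : R) (z : C) :
  (forall u, (Cmod u < R0)%R -> cder f u (f' u)) ->
  (forall u, (Cmod u < R0)%R -> ccont f' u) ->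
  (0 < r < R0)%R -> (Cmod z < r)%R ->
  CI (fun t => f (circ r t) * (circ r t / (circ r t - z))) = RtoC (2 * PI) * f z.
Proof.
  intros Hf Hf' Hr Hz.
  rewrite <- (CI_kernel_one r ltac:(lra) z Hz), Cmult_comm.
  rewrite <- CI_scal by (intros t; apply rcont_kernel; lra).
  apply Ceq_ReIm; rewrite ?Re_CI, ?Im_CI.
  - apply (Cauchy_formula_Re f f' R0 r z); auto.
  (* The imaginary part is the real part of the formula for -i f. *)
  - pose proof (Cauchy_formula_Re (fun u => - Ci * f u) (fun u => - Ci * f' u) R0 r z) as H.
    cbn beta in H.
    assert (HI : forall a b : C, Im (a * b) = Re (- Ci * a * b)).
    { intros [a1 a2] [b1 b2]. simpl. ring. }
    transitivity (RInt (fun t => Re (- Ci * f (circ r t) * (circ r t / (circ r t - z)))) 0 (2 * PI)).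
    { apply RInt_ext_all. intros t. apply HI. }
    transitivity (RInt (fun t => Re (- Ci * f z * (circ r t / (circ r t - z)))) 0 (2 * PI)).
    2:{ apply RInt_ext_all. intros t. symmetry. apply HI. }
    apply H; auto.
    + intros u Hu. now apply cder_scal, Hf.
    + intros u Hu. apply (ccont_mult (fun _ => - Ci)); [ | now apply Hf' ].
      eapply cder_ccont, cder_const.
Qed.

(** Expanding the kernel in Cauchy's formula yields the coefficients (1 / 2 PI) times the integral
    of f(circ) circ^(-n). The 2 in the estimate is inherited from [CI_bound]. *)
Lemma Cauchy_Taylor (f f' : C -> C) (R0 r M : R) :
  (forall u, (Cmod u < R0)%R -> cder f u (f' u)) ->
  (forall u, (Cmod u < R0)%R -> ccont f' u) ->
  (0 < r < R0)%R -> (forall t, (Cmod (f (circ r t)) <= M)%R) ->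
  exists a : nat -> C,
    (forall z, (Cmod z < r)%R -> csum (fun n => a n * z ^ n) (f z)) /\
    (forall n, (Cmod (a n) * r ^ n <= 2 * M)%R).
Proof.
  intros Hf Hf' Hr HM. pose proof PI_RGT_0 as Hpi.
  assert (Hc : forall t, rcont (fun t => f (circ r t)) t).
  { intros t. apply (rcont_comp f (circ r)); [ | apply rcont_circ ].
    eapply cder_ccont, Hf. rewrite Cmod_circ; lra. }
  assert (H2pi : RtoC (2 * PI) <> 0) by (intros H; apply RtoC_inj in H; lra).
  set (A := fun n => CI (fun t => f (circ r t) * (/ circ r t) ^ n)).
  exists (fun n => / RtoC (2 * PI) * A n). split.
  - intros z Hz.
    pose proof (CI_kernel_series r ltac:(lra) (fun t => f (circ r t)) M z Hc HM Hz) as H.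
    cbn beta in H. rewrite (Cauchy_formula f f' R0 r z Hf Hf' Hr Hz) in H.
    replace (f z) with (/ RtoC (2 * PI) * (RtoC (2 * PI) * f z)) by (field; exact H2pi).
    apply clim_ext with (2 := clim_scal (/ RtoC (2 * PI)) _ _ H).
    intros n. induction n as [ | n IH ]; [ cbn [psum]; unfold A; ring | ].
    rewrite !psum_S, <- IH. unfold A. ring.
  - intros n. rewrite Cmod_mult, Cmod_inv by exact H2pi.
    rewrite Cmod_R, Rabs_pos_eq by lra.
    assert (HB : (Cmod (A n) <= 4 * PI * (M * (/ r) ^ n))%R).
    { apply CI_bound.
      - intros t. apply rcont_mult; [ apply Hc | apply rcont_circ_inv_pow; lra ].
      - intros t. rewrite Cmod_mult, Cmod_pow, Cmod_inv, Cmod_circ; try lra.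
        + apply Rmult_le_compat_r; [ | apply HM ]. apply pow_le. left. apply Rinv_0_lt_compat. lra.
        + apply circ_neq_0. lra. }
    assert (Hrn : (0 < r ^ n)%R) by (apply pow_lt; lra).
    assert (H1 : (Cmod (A n) * r ^ n <= 4 * PI * M)%R).
    { apply Rle_trans with (4 * PI * (M * (/ r) ^ n) * r ^ n)%R.
      - apply Rmult_le_compat_r; lra.
      - right. rewrite pow_inv. field. lra. }
    apply Rle_trans with (/ (2 * PI) * (4 * PI * M))%R.
    + rewrite Rmult_assoc. apply Rmult_le_compat_l; [ | exact H1 ].
      left. apply Rinv_0_lt_compat. lra.
    + right. field. lra.
Qed.

(** * Holomorphic functions *)


Lemma near_locally (z : C) (P : C -> Prop) : near z P <-> @locally C_UniformSpace z P.
Proof.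
  split.
  - intros [d [Hd H]]. assert (Hs : (0 < sqrt 2)%R) by (apply sqrt_lt_R0; lra).
    assert (Hd' : (0 < d / sqrt 2)%R) by (apply Rdiv_lt_0_compat; lra).
    exists (mkposreal _ Hd'). intros y Hy. apply H.
    apply C_NormedModule_mixin_compat2 in Hy. simpl in Hy.
    eapply Rlt_le_trans; [ exact Hy | ]. right. field. lra.
  - intros [d H]. exists d. split; [ apply cond_pos | ].
    intros y Hy. apply H. now apply C_NormedModule_mixin_compat1.
Qed.

Lemma cder_C_derive (f : C -> C) (z l : C) : cder f z l -> C_derive f z = l.
Proof.
  intros H. apply is_C_lim_unique. intros P HP.
  apply near_locally in HP. destruct HP as [e [He HP]].
  unfold filtermap, locally', within. apply near_locally.
  apply near_impl with (1 := H (e / 2)%R ltac:(lra)).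
  intros u Hu Hne. apply HP.
  pose proof (Cminus_eq_contra _ _ Hne) as Hd.
  replace ((f u - f z) / (u - z) - l) with ((f u - f z - l * (u - z)) / (u - z)) by (field; exact Hd).
  rewrite Cmod_div by exact Hd.
  pose proof (proj1 (Cmod_gt_0 _) Hd).
  apply Rlt_div_l; [ lra | ]. nra.
Qed.

(** The derivative is required to be continuous because Cauchy's formula differentiates under the
    integral sign. *)
Definition hol (f : C -> C) (z : C) : Prop :=
  exists f' : C -> C, near z (fun u => cder f u (f' u) /\ ccont f' u).

Lemma hol_ext (f g : C -> C) (z : C) : near z (fun u => f u = g u) -> hol f z -> hol g z.
Proof.
  intros H [f' Hf]. exists f'.
  apply near_impl with (1 := near_and _ _ _ (near_near _ _ H) Hf).
  intros u [Hu [H1 H2]]. split; [ | exact H2 ]. now apply cder_ext_near with f.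
Qed.

Lemma PS_hol (a : nat -> C) (r : R) (z : C) :
  conv_radius a r -> (Cmod z < r)%R -> hol (PS a) z.
Proof.
  intros Ha Hz. exists (PS (dcoef a)).
  exists (r - Cmod z)%R. split; [ lra | ]. intros u Hu.
  pose proof (Cmod_le_plus u z). split.
  - apply PS_cder with r; [ exact Ha | lra ].
  - eapply cder_ccont, PS_cder with r; [ now apply conv_radius_dcoef | lra ].
Qed.

Lemma hol_const (k z : C) : hol (fun _ => k) z.
Proof.
  exists (fun _ => 0). exists 1%R. split; [ lra | ]. intros u _. split; [ apply cder_const | ].
  eapply cder_ccont, cder_const.
Qed.

Lemma hol_id (z : C) : hol (fun u => u) z.
Proof.
  exists (fun _ => 1). exists 1%R. split; [ lra | ]. intros u _. split; [ apply cder_id | ].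
  eapply cder_ccont, cder_const.
Qed.

Lemma hol_plus (f g : C -> C) (z : C) : hol f z -> hol g z -> hol (fun u => f u + g u) z.
Proof.
  intros [f' Hf] [g' Hg]. exists (fun u => f' u + g' u).
  apply near_impl with (1 := near_and _ _ _ Hf Hg). intros u [[H1 H2] [H3 H4]].
  split; [ now apply cder_plus | ]. now apply (ctends_plus (near u)).
Qed.

Lemma hol_mult (f g : C -> C) (z : C) : hol f z -> hol g z -> hol (fun u => f u * g u) z.
Proof.
  intros [f' Hf] [g' Hg]. exists (fun u => f' u * g u + f u * g' u).
  apply near_impl with (1 := near_and _ _ _ Hf Hg). intros u [[H1 H2] [H3 H4]].
  split; [ now apply cder_mult | ].
  apply (ctends_plus (near u)); apply (ctends_mult (near u)); auto; eapply cder_ccont; eauto.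
Qed.

Lemma hol_minus (f g : C -> C) (z : C) : hol f z -> hol g z -> hol (fun u => f u - g u) z.
Proof.
  intros Hf Hg. apply hol_ext with (fun u => f u + (-1) * g u).
  - exists 1%R. split; [ lra | ]. intros u _. ring.
  - apply hol_plus; [ exact Hf | ]. apply hol_mult; [ apply hol_const | exact Hg ].
Qed.

Lemma hol_comp (f g : C -> C) (z : C) : hol f (g z) -> hol g z -> hol (fun u => f (g u)) z.
Proof.
  intros [f' Hf] [g' Hg]. exists (fun u => f' (g u) * g' u).
  pose proof (ccont_near g z _ (cder_ccont _ _ _ (proj1 (near_at _ _ Hg))) Hf) as Hf1.
  apply near_impl with (1 := near_and _ _ _ Hf1 Hg). intros u [[H1 H2] [H3 H4]].
  split; [ now apply cder_comp | ].
  apply (ctends_mult (near u)); [ | exact H4 ].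
  apply (ccont_comp f' g); [ exact H2 | ]. eapply cder_ccont; eauto.
Qed.

Lemma near_neq (z k : C) : z <> k -> near z (fun u => u <> k).
Proof.
  intros H. exists (Cmod (z - k)). split; [ now apply Cmod_gt_0, Cminus_eq_contra | ].
  intros u Hu ->. rewrite Cmod_minus_sym in Hu. lra.
Qed.

Lemma hol_inv (z : C) : z <> 0 -> hol (fun u => / u) z.
Proof.
  intros Hz. exists (fun u => (-1) * (/ u * / u)).
  apply near_impl with (1 := near_neq _ _ Hz). intros u Hu. split.
  - replace ((-1) * (/ u * / u)) with (- / (u * u)) by (field; exact Hu). now apply cder_inv.
  - apply (ccont_mult (fun _ => RtoC (-1))); [ eapply cder_ccont, cder_const | ].
    apply (ccont_mult (fun v => / v)); eapply cder_ccont, cder_inv, Hu.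
Qed.

Lemma hol_div (f g : C -> C) (z : C) :
  hol f z -> hol g z -> g z <> 0 -> hol (fun u => f u / g u) z.
Proof.
  intros Hf Hg H. apply hol_mult; [ exact Hf | ].
  apply (hol_comp (fun v => / v)); [ now apply hol_inv | exact Hg ].
Qed.

Lemma hol_pow (n : nat) (z : C) : hol (fun u => u ^ n) z.
Proof.
  induction n as [ | n IH ]; [ apply (hol_const 1) | ].
  apply (hol_mult (fun u => u)); [ apply hol_id | exact IH ].
Qed.

Lemma analytic_at_PS (f : C -> C) (z : C) :
  analytic_at f z ->
  exists (r : R) (a : nat -> C), (0 < r)%R /\ conv_radius a r /\
    forall u, (Cmod (u - z) < r)%R -> f u = PS a (u - z).
Proof.
  intros [r [a Ha]]. exists r, a.
  assert (Hs : forall u, (Cmod (u - z) < r)%R -> csum (fun n => a n * (u - z) ^ n) (f u)).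
  { intros u Hu. now apply is_pseries_csum, Ha. }
  split; [ apply cond_pos | ]. split.
  - apply conv_radius_of_csum. intros h Hh. exists (f (z + h)).
    replace h with (z + h - z) by ring.
    replace (z + (z + h - z)) with (z + h) by ring. apply Hs.
    now replace (z + h - z) with h by ring.
  - intros u Hu. symmetry. apply Cseries_unique. now apply Hs.
Qed.

Lemma PS_sub_hol (a : nat -> C) (r : R) (z : C) :
  (0 < r)%R -> conv_radius a r -> hol (fun u => PS a (u - z)) z.
Proof.
  intros Hr Ha. apply (hol_comp (PS a) (fun u => u - z)).
  - apply PS_hol with r; [ exact Ha | ].
    replace (z - z) with (RtoC 0) by ring. now rewrite Cmod_0.
  - apply hol_minus; [ apply hol_id | apply hol_const ].
Qed.

Lemma analytic_hol (f : C -> C) (z : C) : analytic_at f z -> hol f z.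
Proof.
  intros H. destruct (analytic_at_PS f z H) as [r [a [Hr [Ha Hf]]]].
  apply hol_ext with (fun u => PS a (u - z)); [ | now apply PS_sub_hol with r ].
  exists r. split; [ exact Hr | ]. intros u Hu. symmetry. now apply Hf.
Qed.

Lemma hol_analytic (f : C -> C) (z : C) : hol f z -> analytic_at f z.
Proof.
  intros [f' Hf].
  (* Continuity provides a disc on which |f| <= |f z| + 1, the bound M that the Taylor expansion
     asks for. *)
  destruct (near_and _ _ _ Hf (cder_ccont _ _ _ (proj1 (near_at _ _ Hf)) 1%R Rlt_0_1)) as [d [Hd H]].
  assert (Hz : forall u, (Cmod (z + u - z)) = Cmod u) by (intros u; f_equal; ring).
  assert (Hd2 : (0 < d / 2)%R) by lra.
  destruct (Cauchy_Taylor (fun u => f (z + u)) (fun u => f' (z + u)) d (d / 2) (Cmod (f z) + 1))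
    as [a [Ha _]].
  - intros u Hu. apply cder_shift, H. now rewrite Hz.
  - intros u Hu. apply (ccont_comp f' (fun u => z + u)).
    + apply H. now rewrite Hz.
    + eapply cder_ccont, cder_plus; [ apply cder_const | apply cder_id ].
  - lra.
  - intros t. destruct (H (z + circ (d / 2) t)) as [_ H1].
    { rewrite Hz, Cmod_circ; lra. }
    pose proof (Cmod_le_plus (f (z + circ (d / 2) t)) (f z)). lra.
  - exists (mkposreal _ Hd2), a. simpl. intros u Hu.
    apply is_pseries_csum. pose proof (Ha (u - z) Hu) as H1. cbn beta in H1.
    now replace (z + (u - z)) with u in H1 by ring.
Qed.

Lemma hol_near (f : C -> C) (z : C) : hol f z -> near z (hol f).
Proof.
  intros [f' Hf]. apply near_impl with (1 := near_near _ _ Hf).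
  intros u Hu. now exists f'.
Qed.

Lemma hol_cder (f : C -> C) (z : C) : hol f z -> cder f z (C_derive f z).
Proof.
  intros [f' Hf]. destruct (near_at _ _ Hf) as [H _].
  now rewrite (cder_C_derive _ _ _ H).
Qed.

Lemma hol_ccont (f : C -> C) (z : C) : hol f z -> ccont f z.
Proof. intros H. exact (cder_ccont _ _ _ (hol_cder _ _ H)). Qed.

(** Near z the derivative is again a power series. This is what makes second derivatives available
    throughout. *)
Lemma hol_C_derive (f : C -> C) (z : C) : hol f z -> hol (C_derive f) z.
Proof.
  intros H. destruct (analytic_at_PS f z (hol_analytic f z H)) as [r [a [Hr [Ha Hf]]]].
  apply hol_ext with (fun u => PS (dcoef a) (u - z)).
  - exists r. split; [ exact Hr | ]. intros u Hu. symmetry. apply cder_C_derive.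
    apply cder_ext_near with (fun u => PS a (u - z)).
    + apply near_impl with (1 := near_ball u z r Hu). intros v Hv. symmetry. now apply Hf.
    + replace (PS (dcoef a) (u - z)) with (PS (dcoef a) (u - z) * (1 - 0)) by ring.
      apply (cder_comp (PS a) (fun u => u - z)).
      * now apply PS_cder with r.
      * apply cder_minus; [ apply cder_id | apply cder_const ].
  - apply PS_sub_hol with r; [ exact Hr | now apply conv_radius_dcoef ].
Qed.

(** * Maximum modulus and Schwarz's lemma *)

Lemma csum_geom_le (a : nat -> C) (l : C) (K x : R) :
  (0 <= x < 1)%R -> (forall n, (Cmod (a n) <= K * x ^ n)%R) -> csum a l ->
  (Cmod l <= K / (1 - x))%R.
Proof.
  intros Hx Ha Hl.
  assert (HK : (0 <= K)%R).
  { eapply Rle_trans; [ apply (Cmod_ge_0 (a 0%nat)) | ]. rewrite <- (Rmult_1_r K). apply (Ha 0%nat). }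
  assert (HB : forall n, (Cmod (psum a n) <= K * (1 - x ^ S n) / (1 - x))%R).
  { induction n as [ | n IH ].
    - simpl psum. eapply Rle_trans; [ apply Ha | ]. right. simpl. field. lra.
    - rewrite psum_S. eapply Rle_trans; [ apply Cmod_triangle | ].
      eapply Rle_trans; [ apply Rplus_le_compat; [ exact IH | apply Ha ] | ].
      right. simpl pow. field. lra. }
  replace l with (l - 0) by ring. apply clim_le with (1 := Hl). intros n.
  replace (psum a n - 0) with (psum a n) by ring.
  eapply Rle_trans; [ apply HB | ].
  apply Rmult_le_compat_r; [ left; apply Rinv_0_lt_compat; lra | ].
  assert (0 <= x ^ S n)%R by (apply pow_le; lra). nra.
Qed.

(* The bound lost in the Cauchy estimate is recovered by applying it to powers of [f]. *)
Lemma max_modulus (f : C -> C) (R0 r M : R) (z : C) :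
  (forall u, (Cmod u < R0)%R -> hol f u) ->
  (0 < r < R0)%R -> (forall t, (Cmod (f (circ r t)) <= M)%R) -> (Cmod z < r)%R ->
  (Cmod (f z) <= M)%R.
Proof.
  intros Hf Hr HM Hz. pose proof (Cmod_ge_0 z) as Hz0.
  set (x := (Cmod z / r)%R).
  assert (Hx : (0 <= x < 1)%R).
  { unfold x. split; [ apply Rmult_le_pos; [ lra | left; apply Rinv_0_lt_compat; lra ]
           | apply Rlt_div_l; lra ]. }
  assert (HM0 : (0 <= M)%R) by (eapply Rle_trans; [ apply Cmod_ge_0 | apply (HM 0%R) ]).
  assert (HB : forall n, (Cmod (f z) ^ n <= 2 * M ^ n / (1 - x))%R).
  { intros n. rewrite <- Cmod_pow.
    assert (Hp : forall u, (Cmod u < R0)%R -> hol (fun u => f u ^ n) u).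
    { intros u Hu. apply (hol_comp (fun v => v ^ n)); [ apply hol_pow | now apply Hf ]. }
    destruct (Cauchy_Taylor (fun u => f u ^ n) (C_derive (fun u => f u ^ n)) R0 r (M ^ n))
      as [a [Ha HaM]]; auto.
    - intros u Hu. now apply hol_cder, Hp.
    - intros u Hu. now apply hol_ccont, hol_C_derive, Hp.
    - intros t. rewrite Cmod_pow. apply pow_incr. split; [ apply Cmod_ge_0 | apply HM ].
    - apply (csum_geom_le (fun n => a n * z ^ n)) with (3 := Ha z Hz); [ exact Hx | ].
      intros m. rewrite Cmod_mult, Cmod_pow.
      replace (Cmod z ^ m)%R with (r ^ m * x ^ m)%R
        by (rewrite <- Rpow_mult_distr; unfold x; f_equal; field; lra).
      rewrite <- Rmult_assoc. apply Rmult_le_compat_r; [ apply pow_le; lra | apply HaM ]. }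
  (* If A = |f z| exceeded M, then (M/A)^n would tend to 0, whereas the bound on powers keeps it at
     least (1 - x)/2. *)
  apply Rnot_lt_le. intros Hlt. set (A := Cmod (f z)) in *.
  assert (Hy : (0 <= M / A < 1)%R).
  { split; [ apply Rmult_le_pos; [ lra | left; apply Rinv_0_lt_compat; lra ]
           | apply Rlt_div_l; lra ]. }
  destruct (pow_lt_1_zero (M / A) ltac:(rewrite Rabs_pos_eq; lra) ((1 - x) / 2)%R ltac:(lra)) as [N HN].
  specialize (HN N (Nat.le_refl N)). rewrite Rabs_pos_eq in HN by (apply pow_le; lra).
  specialize (HB N).
  assert (HA : (0 < A ^ N)%R) by (apply pow_lt; lra).
  replace (M ^ N)%R with ((M / A) ^ N * A ^ N)%R in HB
    by (rewrite <- Rpow_mult_distr; f_equal; field; lra).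
  apply (proj2 (Rle_div_r _ _ (1 - x) ltac:(lra))) in HB. nra.
Qed.

(** The maximum modulus principle for w(u)/u on the circle of radius rho < R0 gives |w(z)| <=
    |z|/rho; then rho tends to R0. *)
Lemma Schwarz (w : C -> C) (R0 : R) (z : C) :
  (forall u, (Cmod u < R0)%R -> hol w u) -> w 0 = 0 ->
  (forall u, (Cmod u < R0)%R -> (Cmod (w u) <= 1)%R) ->
  (Cmod z < R0)%R -> (R0 * Cmod (w z) <= Cmod z)%R.
Proof.
  intros Hw Hw0 Hb Hz. pose proof (Cmod_ge_0 z) as Hz0.
  assert (HB : forall rho, (Cmod z < rho < R0)%R -> (rho * Cmod (w z) <= Cmod z)%R).
  { intros rho Hrho. set (r := ((rho + R0) / 2)%R).
    assert (Hr : (rho < r < R0)%R) by (unfold r; lra).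
    destruct (Cauchy_Taylor w (C_derive w) R0 r 1) as [a [Ha HaM]].
    - intros u Hu. now apply hol_cder, Hw.
    - intros u Hu. now apply hol_ccont, hol_C_derive, Hw.
    - lra.
    - intros t. apply Hb. rewrite Cmod_circ; lra.
    (* The coefficients of w(u)/u, a power series also at 0 because w(0) = 0. *)
    - set (b := fun n => a (S n)).
      assert (Hbr : conv_radius b r).
      { intros s Hs. exists (2 / r)%R. intros n.
        apply (proj1 (Rle_div_r _ _ r ltac:(lra))).
        specialize (HaM (S n)). simpl pow in HaM. unfold b.
        pose proof (Cmod_ge_0 (a (S n))).
        assert (s ^ n <= r ^ n)%R by (apply pow_incr; lra).
        assert (0 <= Cmod (a (S n)) * r)%R by (apply Rmult_le_pos; lra).
        nra. }
      assert (Ha0 : a 0%nat = 0).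
      { rewrite <- Hw0, <- PS_0. apply Cseries_unique, Ha. rewrite Cmod_0. lra. }
      assert (Hg : forall u, (Cmod u < r)%R -> w u = u * PS b u).
      { intros u Hu. apply clim_unique with (1 := clim_S _ _ (Ha u Hu)).
        apply clim_ext with (2 := clim_scal u _ _ (PS_csum b r u Hbr Hu)).
        intros n. induction n as [ | n IH ].
        - rewrite psum_S. cbn [psum Cpow]. rewrite Ha0. unfold b. ring.
        - rewrite psum_S, (psum_S _ (S n)), <- IH. unfold b. rewrite !Cpow_S. ring. }
      assert (Hm : (Cmod (PS b z) <= / rho)%R).
      { apply (max_modulus (PS b) r rho (/ rho) z); try lra.
        - intros u Hu. now apply PS_hol with r.
        - intros t.
          assert (H1 := Cmod_circ rho ltac:(lra) t).
          assert (H2 := Hb (circ rho t) ltac:(rewrite H1; lra)).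
          rewrite Hg, Cmod_mult, H1 in H2 by (rewrite H1; lra).
          rewrite <- (Rmult_1_l (/ rho)). apply (proj1 (Rle_div_r _ _ rho ltac:(lra))). lra. }
      rewrite Hg, Cmod_mult by lra.
      assert (H3 : (Cmod (PS b z) * rho <= 1)%R).
      { apply Rmult_le_compat_r with (r := rho) in Hm; [ | lra ].
        rewrite Rinv_l in Hm; lra. }
      nra. }
  apply Rnot_lt_le. intros Hlt. set (W := Cmod (w z)) in *.
  assert (HW : (0 < W)%R).
  { destruct (Cmod_ge_0 (w z)) as [H | H]; [ exact H | ]. fold W in H. rewrite <- H in Hlt. lra. }
  set (s := (Cmod z / W)%R).
  assert (Hs : (s < R0)%R) by (unfold s; apply Rlt_div_l; lra).
  assert (HsW : (s * W = Cmod z)%R) by (unfold s; field; lra).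
  (* A failure of the inequality means s = |z|/|w(z)| < R0. This radius exceeds both |z| and s, and
     rho |w(z)| <= |z| would force rho <= s. *)
  set (rho := Rmax ((Cmod z + R0) / 2) ((s + R0) / 2)).
  assert (H1 : ((Cmod z + R0) / 2 <= rho)%R) by apply Rmax_l.
  assert (H2 : ((s + R0) / 2 <= rho)%R) by apply Rmax_r.
  assert (H3 : (rho < R0)%R) by (apply Rmax_lub_lt; lra).
  specialize (HB rho ltac:(lra)). nra.
Qed.

(** * Local inverses and injectivity *)


(** The real mean value theorem along the segment, applied to f projected on the direction of D = f
    z1 - f z2: the increment of Re(conj D * f) is exactly |D|^2. *)
Lemma lipschitz_ball (f f' : C -> C) (c : C) (d K : R) (z1 z2 : C) :
  (forall u, (Cmod (u - c) < d)%R -> cder f u (f' u) /\ (Cmod (f' u) <= K)%R) ->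
  (Cmod (z1 - c) < d)%R -> (Cmod (z2 - c) < d)%R ->
  (Cmod (f z1 - f z2) <= K * Cmod (z1 - z2))%R.
Proof.
  intros H H1 H2. set (D := f z1 - f z2).
  set (seg := fun t : R => z2 + RtoC t * (z1 - z2)).
  assert (Hseg : forall t, (0 <= t <= 1)%R -> (Cmod (seg t - c) < d)%R).
  { intros t Ht. replace (seg t - c) with (RtoC (1 - t) * (z2 - c) + t * (z1 - c))
      by (unfold seg; rewrite RtoC_minus; ring).
    eapply Rle_lt_trans; [ apply Cmod_triangle | ].
    rewrite !Cmod_mult, !Cmod_R, !Rabs_pos_eq by lra.
    destruct (Req_dec t 0) as [-> | Ht0]; [ lra | ].
    pose proof (Cmod_ge_0 (z1 - c)). pose proof (Cmod_ge_0 (z2 - c)). nra. }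
  assert (Hder : forall t, (0 <= t <= 1)%R ->
    is_derive (fun s => Re (Cconj D * f (seg s))) t (Re (Cconj D * (f' (seg t) * (z1 - z2))))).
  { intros t Ht. apply (rder_Re (fun s => Cconj D * f (seg s))), rder_scal.
    apply (rder_comp f seg); [ now apply H, Hseg | apply rder_line ]. }
  destruct (MVT_gen (fun s => Re (Cconj D * f (seg s))) 0 1
              (fun t => Re (Cconj D * (f' (seg t) * (z1 - z2))))) as [t [Ht Heq]].
  - intros t Ht. rewrite Rmin_left, Rmax_right in Ht by lra. apply Hder. lra.
  - intros t Ht. rewrite Rmin_left, Rmax_right in Ht by lra.
    apply continuity_pt_filterlim, (ex_derive_continuous (V:=R_NormedModule)).
    eexists. now apply Hder.
  - rewrite Rmin_left, Rmax_right in Ht by lra.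
    replace (seg 1) with z1 in Heq by (unfold seg; ring).
    replace (seg 0) with z2 in Heq by (unfold seg; ring).
    rewrite <- Re_minus in Heq.
    replace (Cconj D * f z1 - Cconj D * f z2) with (D * Cconj D) in Heq by (unfold D; ring).
    rewrite <- Cmod2_conj, re_RtoC in Heq.
    assert (Hb : (Cmod D ^ 2 <= Cmod D * (K * Cmod (z1 - z2)))%R).
    { rewrite Heq, Rminus_0_r, Rmult_1_r.
      eapply Rle_trans; [ apply Rle_abs | ]. eapply Rle_trans; [ apply re_le_Cmod | ].
      rewrite !Cmod_mult, Cmod_conj. apply Rmult_le_compat_l; [ apply Cmod_ge_0 | ].
      apply Rmult_le_compat_r; [ apply Cmod_ge_0 | ]. apply H, Hseg, Ht. }
    pose proof (Cmod_ge_0 D) as [HD | HD].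
    + apply Rmult_le_reg_l with (Cmod D); [ exact HD | ]. simpl in Hb. lra.
    + rewrite <- HD. apply Rmult_le_pos; [ | apply Cmod_ge_0 ].
      eapply Rle_trans; [ apply Cmod_ge_0 | apply (H z1 H1) ].
Qed.

Lemma clim_ccont (f : C -> C) (s : nat -> C) (l : C) :
  clim s l -> ccont f l -> clim (fun n => f (s n)) (f l).
Proof. intros Hs Hf. exact (ctends_ccont eventually f s l Hs Hf). Qed.

(** T contracts only on the ball and need not map it to itself. A first step below d/4 and ratio 1/2
    confine the iterates to distance d/2 of c. *)
Lemma contraction_fixpoint (T : C -> C) (c : C) (d : R) :
  (0 < d)%R ->
  (forall z1 z2, (Cmod (z1 - c) < d)%R -> (Cmod (z2 - c) < d)%R ->
     (Cmod (T z1 - T z2) <= / 2 * Cmod (z1 - z2))%R) ->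
  (Cmod (T c - c) < d / 4)%R ->
  exists z, (Cmod (z - c) < d)%R /\ T z = z.
Proof.
  intros Hd HT Hc. set (s := fun n => Nat.iter n T c).
  assert (HS : forall n, s (S n) = T (s n)) by reflexivity.
  assert (Hs : forall n, (Cmod (s n - c) <= d / 2 * (1 - (/ 2) ^ n))%R /\
                         (Cmod (s (S n) - s n) <= d / 4 * (/ 2) ^ n)%R).
  { induction n as [ | n [IH1 IH2] ].
    - change (s 1%nat) with (T c). change (s 0%nat) with c. split.
      + replace (c - c) with (RtoC 0) by ring. rewrite Cmod_0. simpl. lra.
      + simpl. lra.
    - assert (Hn : (0 < (/ 2) ^ n)%R) by (apply pow_lt; lra).
      assert (H1 : (Cmod (s (S n) - c) <= d / 2 * (1 - (/ 2) ^ S n))%R).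
      { pose proof (Cmod_minus_triangle (s (S n)) (s n) c). simpl pow. lra. }
      split; [ exact H1 | ].
      rewrite (HS (S n)), (HS n) at 1. rewrite (HS n).
      eapply Rle_trans; [ apply HT | ].
      + rewrite <- HS. simpl pow in H1. nra.
      + nra.
      + simpl pow. rewrite <- HS. lra. }
  (* The iterates converge as partial sums of the telescoping series of their increments, which is
     dominated by a geometric one. *)
  set (a := fun n => s (S n) - s n).
  assert (Ha : csum a (Cseries a)).
  { apply csum_le with (fun n => (d / 4 * (/ 2) ^ n)%R); [ apply Hs | ].
    apply (@ex_series_scal R_AbsRing R_NormedModule (d / 4)%R (fun n => ((/ 2) ^ n)%R)).
    apply ex_series_geom. rewrite Rabs_pos_eq; lra. }
  set (z := c + Cseries a).
  assert (Hlim : clim (fun n => s (S n)) z).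
  { apply clim_ext with (fun n => c + psum a n).
    - intros n. induction n as [ | n IH ].
      + cbn [psum]. unfold a. change (s 0%nat) with c. ring.
      + rewrite psum_S. transitivity (c + psum a n + a (S n)); [ ring | ]. rewrite IH. unfold a. ring.
    - apply clim_plus; [ | exact Ha ]. apply (ctends_const eventually). }
  assert (Hz : (Cmod (z - c) <= d / 2)%R).
  { apply clim_le with (1 := Hlim). intros n. destruct (Hs (S n)) as [H _].
    assert (0 < (/ 2) ^ S n)%R by (apply pow_lt; lra). nra. }
  exists z. split; [ lra | ].
  assert (HTc : ccont T z).
  { intros eps Heps. apply near_impl with
      (1 := near_and _ _ _ (near_ball z c d ltac:(lra)) (near_ball z z eps ltac:(replace (z - z) with (RtoC 0) by ring; rewrite Cmod_0; lra))).
    intros u [Hu Hu']. eapply Rle_lt_trans; [ apply HT; lra | ]. pose proof (Cmod_ge_0 (u - z)). lra. }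
  apply clim_unique with (fun n => T (s (S n))).
  - now apply clim_ccont.
  - apply clim_S in Hlim. exact Hlim.
Qed.

(** Inverse function theorem by the simplified Newton iteration with fixed slope f'(z0). The bound D
    lets the caller keep the values of the inverse in a prescribed disc. *)
Lemma hol_local_inverse (f : C -> C) (z0 : C) (D : R) :
  hol f z0 -> C_derive f z0 <> 0 -> (0 < D)%R ->
  exists (d : R) (g : C -> C), (0 < d <= D)%R /\
    (forall z1 z2, (Cmod (z1 - z0) < d)%R -> (Cmod (z2 - z0) < d)%R -> f z1 = f z2 -> z1 = z2) /\
    near (f z0) (fun y => (Cmod (g y - z0) < d)%R /\ f (g y) = y /\ hol g y).
Proof.
  intros Hf Ha HD. set (a := C_derive f z0) in *.
  pose proof (proj1 (Cmod_gt_0 a) Ha) as Ha'.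
  assert (Hn : near z0 (fun u => hol f u /\ (Cmod (C_derive f u - a) < Cmod a / 2)%R)).
  { apply near_and; [ now apply hol_near | ].
    apply (hol_ccont _ _ (hol_C_derive _ _ Hf)). lra. }
  destruct Hn as [d0 [Hd0 Hn]].
  set (d := Rmin d0 D).
  assert (Hd : (0 < d)%R) by now apply Rmin_pos.
  assert (HdD : (d <= D)%R) by apply Rmin_r.
  assert (Hn' : forall u, (Cmod (u - z0) < d)%R -> hol f u /\ (Cmod (C_derive f u - a) < Cmod a / 2)%R).
  { intros u Hu. apply Hn. eapply Rlt_le_trans; [ exact Hu | apply Rmin_l ]. }
  (* [z - (f z - y) / a] is a contraction whose fixed points solve [f z = y]. *)
  assert (HL : forall y z1 z2, (Cmod (z1 - z0) < d)%R -> (Cmod (z2 - z0) < d)%R ->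
    (Cmod ((z1 - / a * (f z1 - y)) - (z2 - / a * (f z2 - y))) <= / 2 * Cmod (z1 - z2))%R).
  { intros y z1 z2 H1 H2.
    apply (lipschitz_ball (fun z => z - / a * (f z - y)) (fun z => 1 - / a * (C_derive f z - 0)) z0 d (/ 2)); auto.
    intros u Hu. destruct (Hn' u Hu) as [Hu1 Hu2]. split.
    - apply cder_minus; [ apply cder_id | ]. apply cder_scal.
      apply cder_minus; [ now apply hol_cder | apply cder_const ].
    - replace (1 - / a * (C_derive f u - 0)) with (/ a * - (C_derive f u - a)) by (field; exact Ha).
      rewrite Cmod_mult, Cmod_opp, Cmod_inv by exact Ha.
      apply Rmult_le_reg_l with (Cmod a); [ exact Ha' | ].
      rewrite <- Rmult_assoc, Rinv_r; lra. }
  (* Since z - f(z)/a is Lipschitz with constant 1/2, f expands distances by at least |a|/2.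
     Injectivity, and continuity and differentiability of the inverse, all follow from this. *)
  assert (Hlow : forall z1 z2, (Cmod (z1 - z0) < d)%R -> (Cmod (z2 - z0) < d)%R ->
    (Cmod (z1 - z2) <= 2 / Cmod a * Cmod (f z1 - f z2))%R).
  { intros z1 z2 H1 H2. pose proof (HL 0 z1 z2 H1 H2) as H.
    set (X := (z1 - / a * (f z1 - 0)) - (z2 - / a * (f z2 - 0))) in *.
    pose proof (Cmod_le_plus (z1 - z2) X) as H3.
    replace (z1 - z2 - X) with (/ a * (f z1 - f z2)) in H3 by (unfold X; ring).
    rewrite Cmod_mult, Cmod_inv in H3 by exact Ha. unfold Rdiv. lra. }
  assert (Hinj : forall z1 z2, (Cmod (z1 - z0) < d)%R -> (Cmod (z2 - z0) < d)%R -> f z1 = f z2 -> z1 = z2).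
  { intros z1 z2 H1 H2 H. pose proof (Hlow z1 z2 H1 H2) as H3.
    rewrite H in H3. replace (f z2 - f z2) with (RtoC 0) in H3 by ring.
    rewrite Cmod_0, Rmult_0_r in H3.
    apply Ceq_minus, Cmod_eq_0. pose proof (Cmod_ge_0 (z1 - z2)). lra. }
  (* For |y - f z0| < e the first iteration step (y - f z0)/a is shorter than d/4. *)
  set (e := (Cmod a * d / 4)%R).
  assert (He : (0 < e)%R) by (unfold e; nra).
  assert (Hex : forall y, exists z, (Cmod (y - f z0) < e)%R -> (Cmod (z - z0) < d)%R /\ f z = y).
  { intros y. destruct (Rlt_dec (Cmod (y - f z0)) e) as [Hy | Hy]; [ | exists 0; intros; contradiction ].
    destruct (contraction_fixpoint (fun z => z - / a * (f z - y)) z0 d Hd (HL y)) as [z [Hz Hz']].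
    - replace (z0 - / a * (f z0 - y) - z0) with (/ a * (y - f z0)) by ring.
      rewrite Cmod_mult, Cmod_inv by exact Ha.
      apply Rmult_lt_reg_l with (Cmod a); [ exact Ha' | ].
      rewrite <- Rmult_assoc, Rinv_r; unfold e in Hy; lra.
    - exists z. intros _. split; [ exact Hz | ].
      apply Ceq_minus. replace (f z - y) with (a * (z - (z - / a * (f z - y)))) by (field; exact Ha).
      rewrite Hz'. ring. }
  destruct (choice _ Hex) as [g Hg].
  exists d, g. split; [ lra | ]. split; [ exact Hinj | ].
  assert (Hgc : forall y, (Cmod (y - f z0) < e)%R -> ccont g y).
  { intros y Hy eps Heps.
    assert (Hk : (0 < eps * Cmod a / 2)%R) by nra.
    apply near_impl with (1 := near_and _ _ _ (near_ball y (f z0) e Hy) (near_ball y y _ ltac:(replace (y - y) with (RtoC 0) by ring; rewrite Cmod_0; exact Hk))).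
    intros v [Hv Hv']. destruct (Hg v Hv) as [Hv1 Hv2]. destruct (Hg y Hy) as [Hy1 Hy2].
    eapply Rle_lt_trans; [ apply Hlow; assumption | ]. rewrite Hv2, Hy2.
    apply Rmult_lt_reg_r with (Cmod a / 2)%R; [ lra | ].
    replace (2 / Cmod a * Cmod (v - y) * (Cmod a / 2))%R with (Cmod (v - y)) by (field; lra). lra. }
  assert (Hne : forall u, (Cmod (u - z0) < d)%R -> C_derive f u <> 0).
  { intros u Hu H. destruct (Hn' u Hu) as [_ H1]. rewrite H in H1.
    rewrite Cmod_minus_sym in H1. replace (a - 0) with a in H1 by ring. lra. }
  assert (Hgd : forall y, (Cmod (y - f z0) < e)%R -> cder g y (/ C_derive f (g y))).
  { intros y Hy eps Heps. destruct (Hg y Hy) as [Hy1 Hy2].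
    destruct (Hn' _ Hy1) as [Hfy _]. pose proof (Hne _ Hy1) as Hl.
    set (l := C_derive f (g y)) in *. pose proof (proj1 (Cmod_gt_0 l) Hl) as Hl'.
    (* The tolerance for f at g(y): [Hlow] costs 2/|a| in passing from |g v - g y| to |v - y|, and
       division by l costs 1/|l|. *)
    assert (He2 : (0 < eps * Cmod l * Cmod a / 2)%R)
      by (assert (0 < eps * Cmod l)%R by nra; nra).
    pose proof (ccont_near g y _ (Hgc y Hy) (hol_cder _ _ Hfy _ He2)) as H1.
    apply near_impl with (1 := near_and _ _ _ (near_ball y (f z0) e Hy) H1).
    intros v [Hv Hv']. destruct (Hg v Hv) as [Hv1 Hv2]. rewrite Hv2, Hy2 in Hv'. fold l in Hv'.
    replace (g v - g y - / l * (v - y)) with (- / l * (v - y - l * (g v - g y))) by (field; exact Hl).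
    rewrite Cmod_mult, Cmod_opp, Cmod_inv by exact Hl.
    pose proof (Hlow _ _ Hv1 Hy1) as H2. rewrite Hv2, Hy2 in H2.
    apply Rmult_le_reg_l with (Cmod l); [ exact Hl' | ].
    rewrite <- Rmult_assoc, Rinv_r, Rmult_1_l by lra.
    eapply Rle_trans; [ exact Hv' | ].
    apply Rle_trans with (eps * Cmod l * Cmod a / 2 * (2 / Cmod a * Cmod (v - y)))%R.
    - apply Rmult_le_compat_l; lra.
    - right. field. lra. }
  exists e. split; [ exact He | ]. intros y Hy. destruct (Hg y Hy) as [Hy1 Hy2].
  split; [ exact Hy1 | ]. split; [ exact Hy2 | ].
  exists (fun v => / C_derive f (g v)).
  apply near_impl with (1 := near_ball y (f z0) e Hy). intros v Hv. split; [ now apply Hgd | ].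
  destruct (Hg v Hv) as [Hv1 _].
  apply (ccont_comp (fun u => / C_derive f u) g); [ | now apply Hgc ].
  apply (ccont_comp (fun u => / u) (C_derive f)).
  - eapply cder_ccont, cder_inv. now apply Hne.
  - apply hol_ccont, hol_C_derive. now apply Hn'.
Qed.

(** * Injectivity forces a nonzero derivative *)

Lemma least_nat (P : nat -> Prop) :
  (exists n, P n) -> exists n, P n /\ forall m, (m < n)%nat -> ~ P m.
Proof.
  intros [n Hn]. apply NNPP. intros H.
  assert (HA : forall k m, (m < k)%nat -> ~ P m).
  { induction k as [ | k IH ]; [ lia | ]. intros m Hm HP.
    apply H. exists m. split; [ exact HP | ]. intros j Hj. apply IH. lia. }
  exact (HA (S n) n ltac:(lia) Hn).
Qed.

Lemma cis_plus (s t : R) : cis (s + t) = cis s * cis t.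
Proof.
  unfold cis. apply Ceq_ReIm; simpl.
  - rewrite cos_plus. ring.
  - rewrite sin_plus. ring.
Qed.

Lemma cis_pow (t : R) (n : nat) : cis t ^ n = cis (INR n * t).
Proof.
  induction n as [ | n IH ].
  - simpl. rewrite Rmult_0_l. unfold cis. now rewrite cos_0, sin_0.
  - rewrite Cpow_S, IH, <- cis_plus, S_INR. f_equal. ring.
Qed.

Lemma root_of_unity (k : nat) : (2 <= k)%nat -> exists w : C, w <> 1 /\ w ^ k = 1 /\ Cmod w = 1%R.
Proof.
  intros Hk. exists (cis (2 * (PI / INR k))). pose proof PI_RGT_0 as Hpi.
  assert (Hk2 : (2 <= INR k)%R) by (apply (le_INR 2); lia).
  split; [ | split ].
  - intros H. apply (f_equal Re) in H. unfold cis in H. simpl in H.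
    (* The real part 1 - 2 sin^2(PI/k) is below 1, since 0 < PI/k < PI. *)
    rewrite cos_2a_sin in H.
    assert (0 < sin (PI / INR k))%R.
    { apply sin_gt_0; [ apply Rdiv_lt_0_compat; lra | ]. apply Rlt_div_l; [ lra | ]. nra. }
    nra.
  - rewrite cis_pow. replace (INR k * (2 * (PI / INR k)))%R with (2 * PI)%R by (field; lra).
    unfold cis. now rewrite cos_2PI, sin_2PI.
  - apply Cmod_cis.
Qed.

(** The local inverse of u^k at 1, where the derivative k is nonzero; local injectivity selects the
    branch with L(1) = 1. *)
Lemma local_root (k : nat) : (1 <= k)%nat ->
  exists L : C -> C, L 1 = 1 /\ near 1 (fun y => L y ^ k = y /\ hol L y).
Proof.
  intros Hk. destruct k as [ | k ]; [ lia | ].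
  assert (Hd : C_derive (fun u => u ^ S k) 1 <> 0).
  { rewrite (cder_C_derive _ _ _ (cder_pow k 1)), Cpow_1_l, Cmult_1_r.
    intros H. apply RtoC_inj in H. revert H. apply not_0_INR. lia. }
  destruct (hol_local_inverse (fun u => u ^ S k) 1 1 (hol_pow (S k) 1) Hd Rlt_0_1)
    as [d [L [Hd1 [Hinj HL]]]].
  cbn beta in HL. rewrite Cpow_1_l in HL. exists L.
  split.
  - destruct (near_at _ _ HL) as [H1 [H2 _]]. apply Hinj; [ exact H1 | | now rewrite H2, Cpow_1_l ].
    replace (1 - 1) with (RtoC 0) by ring. rewrite Cmod_0. lra.
  - apply near_impl with (1 := HL). tauto.
Qed.

(* At a zero of order [k >= 2] of [f - f z0] the function has the form [f z0 + a g^k] with [g]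
   locally invertible, so that [f] takes nearby values [k] times. *)
Lemma injective_C_derive (f : C -> C) (z0 : C) (D : R) :
  hol f z0 -> (0 < D)%R ->
  (forall z1 z2, (Cmod (z1 - z0) < D)%R -> (Cmod (z2 - z0) < D)%R -> f z1 = f z2 -> z1 = z2) ->
  C_derive f z0 <> 0.
Proof.
  intros Hf HD Hinj HC.
  destruct (analytic_at_PS f z0 (hol_analytic f z0 Hf)) as [r [a [Hr0 [Hr Ha]]]].
  assert (Hs : forall h, (Cmod h < r)%R -> csum (fun n => a n * h ^ n) (f (z0 + h))).
  { intros h Hh. rewrite Ha; replace (z0 + h - z0) with h by ring; [ | exact Hh ].
    now apply PS_csum with r. }
  (* If the coefficients of index 1 to k - 1 vanish, h^k can be factored out of f(z0 + h) -
     f(z0). *)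
  assert (Hshift : forall k, (1 <= k)%nat -> (forall m, (1 <= m < k)%nat -> a m = 0) ->
     conv_radius (fun n => a (k + n)%nat) r /\
     forall h, (Cmod h < r)%R -> f (z0 + h) = a 0%nat + h ^ k * PS (fun n => a (k + n)%nat) h).
  { intros k Hk Hm.
    pose proof (conv_radius_tail a k r Hr) as Hb.
    split; [ exact Hb | ]. intros h Hh.
    assert (H0 : forall m, (m < k)%nat -> psum (fun n => a n * h ^ n) m = a 0%nat).
    { induction m as [ | m IH ]; intros Hmk.
      - cbn [psum Cpow]. ring.
      - rewrite psum_S, IH, (Hm (S m)) by lia. ring. }
    assert (Hps : forall n, psum (fun n => a n * h ^ n) (k + n)
       = a 0%nat + h ^ k * psum (fun n => a (k + n)%nat * h ^ n) n).
    { induction n as [ | n IH ].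
      - rewrite Nat.add_0_r. destruct k as [ | k ]; [ lia | ].
        rewrite psum_S, H0 by lia. cbn [psum]. rewrite Nat.add_0_r. cbn [Cpow]. ring.
      - rewrite Nat.add_succ_r, !psum_S, IH, Nat.add_succ_r.
        replace (S (k + n)) with (k + S n)%nat by lia. rewrite Cpow_add_r. ring. }
    apply clim_unique with (fun n => psum (fun n => a n * h ^ n) (k + n)).
    - intros eps Heps. destruct (Hs h Hh eps Heps) as [N HN].
      exists N. intros n Hn. apply HN. lia.
    - apply clim_ext with (1 := fun n => eq_sym (Hps n)).
      apply clim_plus; [ apply (ctends_const eventually) | ].
      apply clim_scal. now apply PS_csum with r. }
  assert (Ha1 : a 1%nat = 0).
  { destruct (Hshift 1%nat ltac:(lia) ltac:(lia)) as [Hb Hfb].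
    rewrite <- HC. symmetry. apply cder_C_derive.
    apply cder_ext_near with (fun u => a 0%nat + (u - z0) * PS (fun n => a (1 + n)%nat) (u - z0)).
    - exists r. split; [ exact Hr0 | ]. intros u Hu.
      replace u with (z0 + (u - z0)) at 3 by ring. rewrite Hfb by exact Hu. rewrite Cpow_1_r. reflexivity.
    - assert (Hsub : cder (fun u => u - z0) z0 (1 - 0))
        by (apply cder_minus; [ apply cder_id | apply cder_const ]).
      assert (Hz : z0 - z0 = 0) by ring.
      assert (HPd : cder (fun u => PS (fun n => a (1 + n)%nat) (u - z0)) z0
                      (PS (dcoef (fun n => a (1 + n)%nat)) (z0 - z0) * (1 - 0))).
      { apply (cder_comp (PS (fun n => a (1 + n)%nat)) (fun u => u - z0)); [ | exact Hsub ].
        apply PS_cder with r; [ exact Hb | ]. rewrite Hz, Cmod_0. exact Hr0. }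
      pose proof (cder_plus _ _ _ _ _ (cder_const (a 0%nat) z0) (cder_mult _ _ _ _ _ Hsub HPd)) as H.
      cbn beta in H. rewrite Hz, PS_0 in H.
      replace (a 1%nat) with (0 + ((1 - 0) * a (1 + 0)%nat + 0 * (PS (dcoef (fun n => a (1 + n)%nat)) 0 * (1 - 0))))
        by (simpl; ring).
      exact H. }
  (* Otherwise f would be constant near z0, against injectivity. *)
  assert (Hnc : exists n, (1 <= n)%nat /\ a n <> 0).
  { apply NNPP. intros HN.
    assert (Hz : forall n, (1 <= n)%nat -> a n = 0).
    { intros n Hn. apply NNPP. intros H. apply HN. now exists n. }
    destruct (Hshift 1%nat ltac:(lia) ltac:(intros m Hm; apply Hz; lia)) as [_ Hc].
    assert (Hc' : forall h, (Cmod h < r)%R -> f (z0 + h) = a 0%nat).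
    { intros h Hh. rewrite Hc by exact Hh.
      assert (E : PS (fun n => a (1 + n)%nat) h = 0).
      { apply Cseries_unique. intros eps Heps. exists 0%nat. intros n _.
        replace (psum (fun n => a (1 + n)%nat * h ^ n) n) with (RtoC 0).
        - replace (0 - 0) with (RtoC 0) by ring. now rewrite Cmod_0.
        - induction n as [ | n IH ]; [ cbn [psum]; rewrite Hz by lia; ring | ].
          rewrite psum_S, <- IH, Hz by lia. ring. }
      rewrite E. ring. }
    set (t := (Rmin r D / 2)%R).
    assert (Ht : (0 < Rmin r D)%R) by now apply Rmin_pos.
    assert (Htr : (t < r)%R) by (unfold t; pose proof (Rmin_l r D); lra).
    assert (HtD : (t < D)%R) by (unfold t; pose proof (Rmin_r r D); lra).
    assert (Hmt : Cmod t = t) by (rewrite Cmod_R, Rabs_pos_eq; unfold t; lra).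
    assert (E : z0 + t = z0 + 0).
    { apply Hinj.
      - replace (z0 + t - z0) with (RtoC t) by ring. lra.
      - replace (z0 + 0 - z0) with (RtoC 0) by ring. rewrite Cmod_0. exact HD.
      - rewrite !Hc'; [ reflexivity | rewrite Cmod_0; exact Hr0 | lra ]. }
    assert (E' : RtoC t = RtoC 0).
    { replace (RtoC t) with (z0 + t - z0) by ring. rewrite E. ring. }
    apply RtoC_inj in E'. unfold t in E'. lra. }
  destruct (least_nat _ Hnc) as [k [[Hk1 Hak] Hmin]].
  assert (Hk : (2 <= k)%nat).
  { destruct (Nat.eq_dec k 1) as [-> | Hne]; [ contradiction | lia ]. }
  destruct (Hshift k Hk1) as [Hb Hfb].
  { intros m Hm. apply NNPP. intros H. apply (Hmin m); [ lia | split; [ lia | exact H ] ]. }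
  set (b := fun n => a (k + n)%nat) in *.
  assert (Hb0 : PS b 0 = a k) by (rewrite PS_0; unfold b; f_equal; lia).
  (* Normalised to take the value 1 at z0, where the k-th root L is defined. *)
  set (H := fun u => PS b (u - z0) / a k).
  assert (Hz : z0 - z0 = 0) by ring.
  assert (HH : hol H z0).
  { apply hol_div; [ | apply hol_const | exact Hak ].
    now apply PS_sub_hol with r. }
  assert (HH1 : H z0 = 1) by (unfold H; rewrite Hz, Hb0; field; exact Hak).
  destruct (local_root k Hk1) as [L [HL1 HL]].
  set (g := fun u => (u - z0) * L (H u)).
  assert (HLH : hol (fun u => L (H u)) z0).
  { apply (hol_comp L H); [ rewrite HH1; apply (near_at _ _ HL) | exact HH ]. }
  assert (Hg : hol g z0).
  { apply (hol_mult (fun u => u - z0)); [ | exact HLH ].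
    apply hol_minus; [ apply hol_id | apply hol_const ]. }
  assert (Hg0 : g z0 = 0) by (unfold g; rewrite Hz; ring).
  assert (Hg1 : C_derive g z0 = 1).
  { apply cder_C_derive.
    pose proof (cder_mult (fun u => u - z0) (fun u => L (H u)) z0 _ _
      (cder_minus _ _ _ _ _ (cder_id z0) (cder_const z0 z0)) (hol_cder _ _ HLH)) as E.
    cbn beta in E. rewrite Hz, HH1, HL1 in E.
    replace ((1 - 0) * 1 + 0 * C_derive (fun u => L (H u)) z0) with (RtoC 1) in E by ring.
    exact E. }
  assert (Hfg : near z0 (fun u => f u = a 0%nat + a k * g u ^ k)).
  { rewrite <- HH1 in HL.
    pose proof (ccont_near H z0 _ (hol_ccont _ _ HH) HL) as HLn.
    assert (Hball : near z0 (fun u => (Cmod (u - z0) < r)%R)).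
    { apply near_ball. rewrite Hz, Cmod_0. exact Hr0. }
    apply near_impl with (1 := near_and _ _ _ HLn Hball).
    intros u [[Hu _] Hur]. replace u with (z0 + (u - z0)) at 1 by ring.
    rewrite Hfb by exact Hur. unfold g. rewrite Cpow_mult_l, Hu. unfold H. field. exact Hak. }
  destruct Hfg as [d1 [Hd1 Hfg]].
  destruct (hol_local_inverse g z0 (Rmin d1 D) Hg) as [d [G [Hd [_ HG]]]].
  { rewrite Hg1. apply C1_nz. }
  { now apply Rmin_pos. }
  rewrite Hg0 in HG. destruct HG as [e [He HG]].
  assert (Hdd1 : (d <= d1)%R) by (eapply Rle_trans; [ apply Hd | apply Rmin_l ]).
  assert (HdD : (d <= D)%R) by (eapply Rle_trans; [ apply Hd | apply Rmin_r ]).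
  (* y and y w are distinct with the same k-th power, so f agrees at their preimages under g;
     injectivity of f identifies the preimages and hence y with y w. *)
  destruct (root_of_unity k Hk) as [w [Hw1 [Hwk Hwm]]].
  set (y := RtoC (e / 2)).
  assert (Hym : Cmod y = (e / 2)%R) by (unfold y; rewrite Cmod_R, Rabs_pos_eq; lra).
  assert (Hy : (Cmod (y - 0) < e)%R) by (replace (y - 0) with y by ring; lra).
  assert (Hyw : (Cmod (y * w - 0) < e)%R).
  { replace (y * w - 0) with (y * w) by ring. rewrite Cmod_mult, Hwm. lra. }
  destruct (HG _ Hy) as [H1 [H2 _]]. destruct (HG _ Hyw) as [H3 [H4 _]].
  assert (E : G y = G (y * w)).
  { apply Hinj; try lra. rewrite (Hfg (G y)), (Hfg (G (y * w))) by lra.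
    rewrite H2, H4, Cpow_mult_l, Hwk. ring. }
  rewrite <- E, H2 in H4.
  apply Hw1. assert (Hy0 : y <> 0) by (apply Cmod_gt_0; lra).
  transitivity (y * w / y); [ field; exact Hy0 | ]. rewrite <- H4. field. exact Hy0.
Qed.

(** A cluster value a of the real parts is approached along indices phi n >= n at rate 1/(n + 1); a
    cluster value of the imaginary parts along phi completes the point. *)
Lemma Bolzano_Weierstrass_C (s : nat -> C) (M : R) :
  (forall n, (Cmod (s n) <= M)%R) ->
  exists l : C, forall eps N, (0 < eps)%R -> exists n, (N <= n)%nat /\ (Cmod (s n - l) < eps)%R.
Proof.
  intros HM.
  assert (HR : forall u : nat -> R, (forall n, (Rabs (u n) <= M)%R) ->
    exists l : R, forall eps N, (0 < eps)%R -> exists n, (N <= n)%nat /\ (Rabs (u n - l) < eps)%R).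
  { intros u Hu.
    destruct (Bolzano_Weierstrass u (fun x => (- M <= x <= M)%R) (compact_P3 (- M) M)) as [l Hl].
    { intros n. now apply Rabs_le_between. }
    exists l. intros eps N Heps.
    destruct (Hl (disc l (mkposreal eps Heps)) N) as [n Hn].
    - exists (mkposreal eps Heps). intros x Hx. exact Hx.
    - exists n. exact Hn. }
  destruct (HR (fun n => Re (s n))) as [a Ha].
  { intros n. eapply Rle_trans; [ apply re_le_Cmod | apply HM ]. }
  assert (Hphi : forall n, exists m, (n <= m)%nat /\ (Rabs (Re (s m) - a) < / INR (S n))%R).
  { intros n. apply Ha. apply Rinv_0_lt_compat, lt_0_INR. lia. }
  destruct (choice _ Hphi) as [phi Hp].
  destruct (HR (fun n => Im (s (phi n)))) as [b Hb].
  { intros n. eapply Rle_trans; [ apply im_le_Cmod | apply HM ]. }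
  exists (a, b). intros eps N Heps.
  assert (He2 : (0 < eps / 2)%R) by lra.
  destruct (archimed_cor1 (eps / 2) He2) as [K [HK HK0]].
  destruct (Hb (eps / 2)%R (N + K)%nat He2) as [n [Hn Hn']].
  exists (phi n). destruct (Hp n) as [Hp1 Hp2]. split; [ lia | ].
  eapply Rle_lt_trans; [ apply Cmod_le_ReIm | ].
  rewrite Re_minus, Im_minus. simpl.
  assert (/ INR (S n) <= / INR K)%R.
  { apply Rinv_le_contravar; [ apply lt_0_INR; lia | apply le_INR; lia ]. }
  simpl in Hn'. lra.
Qed.

(** * Jack's lemma *)


Lemma is_derive_left_max (f : R -> R) (t l d : R) :
  is_derive f t l -> (0 < d)%R -> (forall s, (t - d < s < t)%R -> (f s <= f t)%R) -> (0 <= l)%R.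
Proof.
  intros Hf Hd Hmax. apply Rnot_lt_le. intros Hl.
  destruct (proj1 (locally_R _ _) (proj2 (is_derive_eps _ _ _) Hf (- l / 2)%R ltac:(lra)))
    as [e [He H]].
  set (h := (Rmin d e / 2)%R).
  assert (Hm : (0 < Rmin d e)%R) by now apply Rmin_pos.
  assert (Hh : (0 < h < d)%R) by (unfold h; pose proof (Rmin_l d e); lra).
  assert (Hh' : (h < e)%R) by (unfold h; pose proof (Rmin_r d e); lra).
  specialize (Hmax (t - h)%R ltac:(lra)).
  assert (Ha : Rabs (t - h - t) = h)
    by (replace (t - h - t)%R with (- h)%R by ring; rewrite Rabs_Ropp; apply Rabs_pos_eq; lra).
  specialize (H (t - h)%R ltac:(lra)). rewrite Ha in H.
  apply Rabs_le_between in H. nra.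
Qed.

(** One-sided monotonicity for f(t) and f(-t) gives f1(0) = 0. With l > 0, f1 would be positive just
    to the right of 0 and the mean value theorem would give f(h) > f(0). *)
Lemma second_derivative_max (f f1 : R -> R) (l d : R) :
  (0 < d)%R -> (forall t, (Rabs t < d)%R -> is_derive f t (f1 t)) -> is_derive f1 0 l ->
  (forall t, (Rabs t < d)%R -> (f t <= f 0)%R) -> f1 0%R = 0%R /\ (l <= 0)%R.
Proof.
  intros Hd Hf Hf1 Hmax.
  assert (H0 : is_derive f 0 (f1 0%R)) by (apply Hf; rewrite Rabs_R0; exact Hd).
  assert (Hz : f1 0%R = 0%R).
  { apply Rle_antisym.
    - assert (Hn : is_derive (fun s => f (- s)%R) 0 (- f1 0)%R).
      { replace (- f1 0)%R with (scal (-1)%R (f1 0%R)) by (unfold scal; simpl; unfold mult; simpl; ring).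
        apply (is_derive_comp f (fun s => (- s)%R)).
        - rewrite Ropp_0. exact H0.
        - auto_derive; auto. }
      apply is_derive_left_max with (d := d) in Hn; [ lra | exact Hd | ].
      intros s Hs. rewrite Ropp_0. apply Hmax. apply Rabs_def1; lra.
    - apply is_derive_left_max with (1 := H0) (2 := Hd).
      intros s Hs. apply Hmax. apply Rabs_def1; lra. }
  split; [ exact Hz | ].
  apply Rnot_lt_le. intros Hl.
  destruct (proj1 (locally_R _ _) (proj2 (is_derive_eps _ _ _) Hf1 (l / 2)%R ltac:(lra)))
    as [e [He H]].
  set (h := (Rmin d e / 2)%R).
  assert (Hm : (0 < Rmin d e)%R) by now apply Rmin_pos.
  assert (Hh : (0 < h < d)%R) by (unfold h; pose proof (Rmin_l d e); lra).
  assert (Hh' : (h < e)%R) by (unfold h; pose proof (Rmin_r d e); lra).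
  destruct (MVT_cor2 f f1 0 h) as [c [Hc Hc']]; [ lra | | ].
  - intros c Hc. apply is_derive_Reals, Hf. rewrite Rabs_pos_eq; lra.
  - specialize (H c). rewrite Hz in H.
    replace (c - 0)%R with c in H by ring. rewrite Rabs_pos_eq in H by lra.
    specialize (H ltac:(lra)). apply Rabs_le_between in H.
    specialize (Hmax h ltac:(rewrite Rabs_pos_eq; lra)).
    assert (0 < f1 c)%R by nra. nra.
Qed.

(** The real inner product Re(conj x * y); it makes |W|^2 differentiable by a product rule. *)
Definition Cdot (x y : C) : R := (Re x * Re y + Im x * Im y)%R.

Lemma Cdot_self (x : C) : Cdot x x = (Cmod x ^ 2)%R.
Proof. rewrite Cmod2_alt. unfold Cdot. ring. Qed.

Lemma is_derive_Cdot (g h : R -> C) (t : R) (g' h' : C) :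
  rder g t g' -> rder h t h' ->
  is_derive (fun s => Cdot (g s) (h s)) t (Cdot g' (h t) + Cdot (g t) h')%R.
Proof.
  intros Hg Hh. unfold Cdot.
  pose proof (rder_Re _ _ _ Hg) as H1. pose proof (rder_Im _ _ _ Hg) as H2.
  pose proof (rder_Re _ _ _ Hh) as H3. pose proof (rder_Im _ _ _ Hh) as H4.
  pose proof (is_derive_plus _ _ _ _ _ (is_derive_mult _ _ _ _ _ H1 H3 Rmult_comm)
    (is_derive_mult _ _ _ _ _ H2 H4 Rmult_comm)) as H.
  replace (Re g' * Re (h t) + Im g' * Im (h t) + (Re (g t) * Re h' + Im (g t) * Im h'))%R
    with (Re g' * Re (h t) + Re (g t) * Re h' + (Im g' * Im (h t) + Im (g t) * Im h'))%R by ring.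
  exact H.
Qed.

(* These are the first- and second-order conditions for [|W|^2] to be maximal at [z0] along the
   circle, and the first-order one along the radius. *)
Lemma Jack (W : C -> C) (z0 : C) :
  hol W z0 -> z0 <> 0 -> Cmod (W z0) = 1%R ->
  near z0 (fun z => (Cmod z < Cmod z0)%R -> (Cmod z0 * Cmod (W z) <= Cmod z)%R) ->
  exists m : R, (1 <= m)%R /\ z0 * C_derive W z0 = m * W z0 /\
    (m <= Re (z0 * C_derive (C_derive W) z0 / C_derive W z0 + 1))%R.
Proof.
  intros HW Hz0 HW1 Hle. pose proof (proj1 (Cmod_gt_0 _) Hz0) as Hz0'.
  pose proof (hol_C_derive _ _ HW) as HW'.
  (* The hypothesis concerns only |z| < |z0|; it is carried to the circle by continuity along radii.
     If |W z| > 1, a point (1 - e) z close enough to z would still have |W| > 1. *)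
  assert (Hcirc : near z0 (fun z => Cmod z = Cmod z0 -> (Cmod (W z) <= 1)%R)).
  { apply near_impl with (1 := near_and _ _ _ (near_near _ _ Hle) (hol_near _ _ HW)).
    intros z [Hz HWz] Hmz. apply Rnot_lt_le. intros Hgt.
    destruct (near_and _ _ _ Hz (hol_ccont _ _ HWz (Cmod (W z) - 1)%R ltac:(lra))) as [d [Hd H]].
    set (e := Rmin (/ 2) (d / (2 * Cmod z))).
    assert (He : (0 < e)%R).
    { apply Rmin_pos; [ lra | apply Rdiv_lt_0_compat; lra ]. }
    assert (He1 : (e <= / 2)%R) by apply Rmin_l.
    assert (He2 : (e * Cmod z < d)%R).
    { assert (e <= d / (2 * Cmod z))%R by apply Rmin_r.
      apply (proj2 (Rle_div_r _ _ (2 * Cmod z) ltac:(lra))) in H0. nra. }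
    assert (Hd1 : Cmod (RtoC (1 - e) * z - z) = (e * Cmod z)%R).
    { replace (RtoC (1 - e) * z - z) with (RtoC (- e) * z)
        by (rewrite RtoC_minus, RtoC_opp; ring).
      rewrite Cmod_mult, Cmod_R, Rabs_Ropp, Rabs_pos_eq; lra. }
    destruct (H (RtoC (1 - e) * z)) as [H1 H2]; [ lra | ].
    assert (Hm : Cmod (RtoC (1 - e) * z) = ((1 - e) * Cmod z)%R)
      by (rewrite Cmod_mult, Cmod_R, Rabs_pos_eq; lra).
    rewrite Hm in H1. specialize (H1 ltac:(nra)).
    pose proof (Cmod_le_plus (W z) (W (RtoC (1 - e) * z))) as H3.
    rewrite (Cmod_minus_sym (W z)) in H3.
    rewrite Hmz in *. nra. }
  set (zeta := W z0) in *.
  set (DW := fun u => u * C_derive W u).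
  assert (HDW : hol DW z0) by (apply (hol_mult (fun u => u)); [ apply hol_id | exact HW' ]).
  set (om := fun t => W (z0 * cis t)). set (om1 := fun t => Ci * DW (z0 * cis t)).
  assert (Hc0 : cis 0 = 1) by (unfold cis; now rewrite cos_0, sin_0).
  assert (Hzc : z0 * cis 0 = z0) by (rewrite Hc0; ring).
  assert (Hpath : forall t, rder (fun t => z0 * cis t) t (z0 * (Ci * cis t)))
    by (intros t; apply rder_scal, rder_cis).
  destruct (near_and _ _ _ Hcirc (hol_near _ _ HW)) as [d0 [Hd0 Hn]].
  assert (Hd : exists d, (0 < d)%R /\ forall t, (Rabs t < d)%R -> (Cmod (z0 * cis t - z0) < d0)%R).
  { pose proof (rder_rcont _ _ _ (Hpath 0%R) d0 Hd0) as H.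
    apply locally_R in H. destruct H as [d [Hd H]]. exists d. split; [ exact Hd | ].
    intros t Ht. specialize (H t). rewrite Hzc, Rminus_0_r in H. now apply H. }
  destruct Hd as [d [Hd Hdt]].
  assert (Hom : forall t, (Rabs t < d)%R -> rder om t (om1 t)).
  { intros t Ht. unfold om1, DW.
    replace (Ci * (z0 * cis t * C_derive W (z0 * cis t)))
      with (C_derive W (z0 * cis t) * (z0 * (Ci * cis t))) by ring.
    apply (rder_comp W (fun t => z0 * cis t)); [ | apply Hpath ].
    apply hol_cder, Hn, Hdt, Ht. }
  assert (Hom2 : rder om1 0 (- (z0 * C_derive DW z0))).
  { replace (- (z0 * C_derive DW z0)) with (Ci * (C_derive DW z0 * (z0 * (Ci * 1))))
      by (transitivity (Ci * Ci * (z0 * C_derive DW z0)); [ ring | rewrite Ci_sqr; ring ]).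
    apply rder_scal. apply (rder_comp DW (fun t => z0 * cis t)).
    - rewrite Hzc. now apply hol_cder.
    - rewrite <- Hc0. apply Hpath. }
  assert (Hom0 : om 0 = zeta) by (unfold om; now rewrite Hzc).
  assert (Hom10 : om1 0 = Ci * DW z0) by (unfold om1; now rewrite Hzc).
  destruct (second_derivative_max (fun t => Cdot (om t) (om t))
    (fun t => (2 * Cdot (om t) (om1 t))%R)
    (2 * (Cdot (om1 0%R) (om1 0%R) + Cdot (om 0%R) (- (z0 * C_derive DW z0))))%R d Hd) as [N1 N2].
  - intros t Ht. pose proof (is_derive_Cdot _ _ _ _ _ (Hom t Ht) (Hom t Ht)) as H.
    replace (2 * Cdot (om t) (om1 t))%R with (Cdot (om1 t) (om t) + Cdot (om t) (om1 t))%R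
      by (unfold Cdot; ring).
    exact H.
  - apply (is_derive_scal (fun t => Cdot (om t) (om1 t)) 0 2).
    apply is_derive_Cdot; [ | exact Hom2 ]. apply Hom. rewrite Rabs_R0. exact Hd.
  - intros t Ht. rewrite Hom0, !Cdot_self, HW1.
    apply pow_incr. split; [ apply Cmod_ge_0 | ].
    apply (Hn (z0 * cis t)); [ now apply Hdt | ].
    rewrite Cmod_mult, Cmod_cis. ring.
  - rewrite Hom0, Hom10 in *.
    (* |W(t z0)|^2 - t^2 is nonpositive for t just below 1 and zero at t = 1, so its derivative
       there is nonnegative; this gives m >= 1. *)
    assert (Hrad : (0 <= 2 * Cdot zeta (DW z0) - 2)%R).
    { destruct Hle as [d1 [Hd1 Hle]].
      assert (Hd1' : (0 < d1 / Cmod z0)%R) by (apply Rdiv_lt_0_compat; lra).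
      apply (is_derive_left_max (fun t => (Cdot (W (0 + RtoC t * z0)%C) (W (0 + RtoC t * z0)%C) - t ^ 2)%R) 1 _
               (Rmin 1 (d1 / Cmod z0))).
      - assert (H1 : rder (fun t => W (0 + RtoC t * z0)) 1 (DW z0)).
        { unfold DW. rewrite Cmult_comm.
          apply (rder_comp W (fun t => 0 + RtoC t * z0)); [ | apply rder_line ].
          replace (0 + 1 * z0) with z0 by ring. now apply hol_cder. }
        pose proof (is_derive_Cdot _ _ _ _ _ H1 H1) as H. cbn beta in H.
        replace (0 + 1 * z0) with z0 in H by ring. fold zeta in H.
        assert (H2 : is_derive (fun t => (t ^ 2)%R) 1 2%R) by (auto_derive; auto; ring).
        pose proof (is_derive_minus _ _ _ _ _ H H2) as H3.
        replace (2 * Cdot zeta (DW z0) - 2)%R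
          with (minus (Cdot (DW z0) zeta + Cdot zeta (DW z0))%R 2%R)
          by (unfold minus, plus, opp, Cdot; simpl; ring).
        exact H3.
      - apply Rmin_pos; lra.
      - intros s Hs.
        pose proof (Rmin_l 1 (d1 / Cmod z0)) as Hm1. pose proof (Rmin_r 1 (d1 / Cmod z0)) as Hm2.
        replace (0 + 1 * z0) with z0 by ring. fold zeta. replace (0 + s * z0) with (s * z0) by ring.
        rewrite !Cdot_self, HW1.
        assert (Hms : Cmod (s * z0) = (s * Cmod z0)%R)
          by (rewrite Cmod_mult, Cmod_R, Rabs_pos_eq; lra).
        assert (Hsd : (Cmod (s * z0 - z0) < d1)%R).
        { replace (s * z0 - z0) with (RtoC (s - 1) * z0) by (rewrite RtoC_minus; ring).
          rewrite Cmod_mult, Cmod_R, Rabs_left by lra.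
          apply Rmult_lt_reg_r with (/ Cmod z0)%R; [ now apply Rinv_0_lt_compat | ].
          rewrite Rmult_assoc, Rinv_r, Rmult_1_r by lra. unfold Rdiv in *. lra. }
        specialize (Hle _ Hsd). rewrite Hms in Hle. specialize (Hle ltac:(nra)).
        assert (Hb : (Cmod (W (s * z0)%C) <= s)%R) by nra.
        pose proof (Cmod_ge_0 (W (s * z0))). simpl. nra. }
    assert (Hzeta : (Re zeta ^ 2 + Im zeta ^ 2 = 1)%R).
    { rewrite <- Cmod2_alt, HW1. ring. }
    set (m := Cdot zeta (DW z0)) in *.
    (* [N1] says that i z0 W'(z0) is orthogonal to zeta, so z0 W'(z0) is a real multiple of zeta,
       and |zeta| = 1 identifies the factor. *)
    assert (HD : DW z0 = m * zeta).
    { unfold m, Cdot in *. destruct zeta as [a b], (DW z0) as [x y]. simpl in *.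
      assert (E : (a * y = b * x)%R) by lra.
      apply Ceq_ReIm; simpl.
      - transitivity ((a * (a * 1) + b * (b * 1)) * x)%R; [ rewrite Hzeta; ring | ].
        transitivity (a * a * x + b * (b * x))%R; [ ring | ]. rewrite <- E. ring.
      - transitivity ((a * (a * 1) + b * (b * 1)) * y)%R; [ rewrite Hzeta; ring | ].
        transitivity (a * (a * y) + b * b * y)%R; [ ring | ]. rewrite E. ring. }
    exists m. split; [ lra | ]. split; [ exact HD | ].
    assert (HW'0 : C_derive W z0 <> 0).
    { intros H. unfold DW in HD. rewrite H, Cmult_0_r in HD.
      assert (Hm0 : Cmod (m * zeta) = 0%R) by (rewrite <- HD; apply Cmod_0).
      rewrite Cmod_mult, HW1, Cmod_R, Rabs_pos_eq in Hm0; lra. }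
    assert (HDD : C_derive DW z0 = C_derive W z0 + z0 * C_derive (C_derive W) z0).
    { apply cder_C_derive.
      replace (C_derive W z0) with (1 * C_derive W z0) at 1 by ring.
      apply (cder_mult (fun u => u)); [ apply cder_id | now apply hol_cder ]. }
    set (X := z0 * C_derive (C_derive W) z0 / C_derive W z0 + 1).
    (* With this form [N2] reads m^2 <= m Re X, and m is positive. *)
    assert (HX : z0 * C_derive DW z0 = m * zeta * X).
    { rewrite <- HD, HDD. unfold DW, X. field. exact HW'0. }
    rewrite HX, HD in N2. unfold Cdot in N2.
    destruct X as [X1 X2], zeta as [a b]. simpl in N2, Hzeta |- *.
    assert (E : (m * m <= m * X1)%R).
    { replace (m * m)%R with (m * m * (a * (a * 1) + b * (b * 1)))%R by (rewrite Hzeta; ring).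
      replace (m * X1)%R with (m * X1 * (a * (a * 1) + b * (b * 1)))%R by (rewrite Hzeta; ring).
      lra. }
    apply Rmult_le_reg_l with m; lra.
Qed.

(** * The lemma of Miller and Mocanu *)


Section Subordination.

Variables (p q : C -> C).
Hypothesis Hq : class_Q q.
Hypothesis Hp : forall z, unit_disc z -> hol p z.
Hypothesis Hpq0 : p 0 = q 0.

Definition in_image (y : C) : Prop := exists u, unit_disc u /\ q u = y.

Lemma regular_disc (z : C) : unit_disc z -> regular_set q z.
Proof.
  unfold unit_disc. intros Hz. split; [ unfold closed_unit_disc; lra | ].
  intros [H _]. unfold unit_circle in H. lra.
Qed.

Lemma hol_regular (z : C) : regular_set q z -> hol q z.
Proof. intros Hz. apply analytic_hol, (proj1 Hq), Hz. Qed.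

Lemma q_injective (z1 z2 : C) : regular_set q z1 -> regular_set q z2 -> q z1 = q z2 -> z1 = z2.
Proof. apply (proj1 (proj2 Hq)). Qed.

(** The class grants q' <> 0 only on the circle; in the open disc it follows from injectivity. *)
Lemma C_derive_q_disc (z : C) : unit_disc z -> C_derive q z <> 0.
Proof.
  intros Hz. unfold unit_disc in Hz.
  apply injective_C_derive with (1 - Cmod z)%R; [ now apply hol_regular, regular_disc | lra | ].
  assert (H : forall u, (Cmod (u - z) < 1 - Cmod z)%R -> regular_set q u).
  { intros u Hu. apply regular_disc. unfold unit_disc. pose proof (Cmod_le_plus u z). lra. }
  intros z1 z2 H1 H2. apply q_injective; auto.
Qed.

Lemma in_image_open (u : C) : unit_disc u -> near (q u) in_image.
Proof.
  intros Hu. destruct (hol_local_inverse q u (1 - Cmod u)) as [d [g [Hd [_ Hg]]]].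
  - now apply hol_regular, regular_disc.
  - now apply C_derive_q_disc.
  - unfold unit_disc in Hu. lra.
  - apply near_impl with (1 := Hg). intros y [H1 [H2 _]]. exists (g y). split; [ | exact H2 ].
    unfold unit_disc. pose proof (Cmod_le_plus (g y) u). lra.
Qed.

(** w picks preimages under q with no continuity assumed. Near each point it must equal a local
    inverse of q composed with p, by injectivity of q, and is therefore holomorphic. *)
Lemma disc_lift (r : R) :
  (r <= 1)%R -> (forall z, (Cmod z < r)%R -> in_image (p z)) ->
  exists w : C -> C, forall z, (Cmod z < r)%R -> unit_disc (w z) /\ q (w z) = p z /\ hol w z.
Proof.
  intros Hr H.
  assert (Hex : forall z, exists u, (Cmod z < r)%R -> unit_disc u /\ q u = p z).
  { intros z. destruct (Rlt_dec (Cmod z) r) as [Hz | Hz].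
    - destruct (H z Hz) as [u Hu]. now exists u.
    - exists 0. intros; contradiction. }
  destruct (choice _ Hex) as [w Hw]. exists w. intros z Hz.
  destruct (Hw z Hz) as [H1 H2]. split; [ exact H1 | ]. split; [ exact H2 | ].
  destruct (hol_local_inverse q (w z) (1 - Cmod (w z))) as [d [g [Hd [_ Hg]]]].
  - now apply hol_regular, regular_disc.
  - now apply C_derive_q_disc.
  - unfold unit_disc in H1. lra.
  - rewrite H2 in Hg.
    assert (Hpz : hol p z) by (apply Hp; unfold unit_disc; lra).
    apply hol_ext with (fun u => g (p u)).
    + assert (Hball : near z (fun u => (Cmod u < r)%R)).
      { apply near_impl with (fun u => (Cmod (u - 0) < r)%R).
        - apply near_ball. now replace (z - 0) with z by ring.
        - intros u Hu. now replace (u - 0) with u in Hu by ring. }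
      apply near_impl with (1 := near_and _ _ _ Hball (ccont_near _ _ _ (hol_ccont _ _ Hpz) Hg)).
      intros u [Hu [H3 [H4 _]]]. destruct (Hw u Hu) as [H5 H6].
      apply q_injective.
      * apply regular_disc. unfold unit_disc. pose proof (Cmod_le_plus (g (p u)) (w z)). lra.
      * now apply regular_disc.
      * now rewrite H6.
    + apply (hol_comp g p); [ | exact Hpz ]. apply (near_at _ _ Hg).
Qed.

Lemma lift_0 (r : R) (w : C -> C) :
  (0 < r)%R -> (forall z, (Cmod z < r)%R -> unit_disc (w z) /\ q (w z) = p z /\ hol w z) -> w 0 = 0.
Proof.
  intros Hr H. destruct (H 0) as [H1 [H2 _]]; [ now rewrite Cmod_0 | ].
  apply q_injective.
  - now apply regular_disc.
  - apply regular_disc. unfold unit_disc. rewrite Cmod_0. lra.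
  - now rewrite H2.
Qed.

Lemma subordinate_of_image : (forall z, unit_disc z -> in_image (p z)) -> subordinate p q.
Proof.
  intros H. destruct (disc_lift 1 (Rle_refl 1) H) as [w Hw]. exists w.
  repeat split.
  - intros z Hz. apply hol_analytic, Hw, Hz.
  - exact (lift_0 1 w Rlt_0_1 Hw).
  - intros z Hz. apply Hw, Hz.
  - intros z Hz. symmetry. apply Hw, Hz.
Qed.

(** The infimum of the moduli is attained: a cluster point of a minimising sequence stays in the
    open disc, and it is an exit point because q(D) is open and p continuous. *)
Lemma minimal_exit_point :
  (exists z, unit_disc z /\ ~ in_image (p z)) ->
  exists z0, unit_disc z0 /\ ~ in_image (p z0) /\
    forall z, (Cmod z < Cmod z0)%R -> in_image (p z).
Proof.
  intros [z1 [Hz1 Hn1]]. unfold unit_disc in Hz1.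
  (* Moduli are negated to turn the infimum into a supremum; the infimum is [- m]. *)
  destruct (completeness (fun x => exists z, unit_disc z /\ ~ in_image (p z) /\ x = (- Cmod z)%R))
    as [m [Hub Hlub]].
  { exists 0%R. intros x [z [_ [_ ->]]]. pose proof (Cmod_ge_0 z). lra. }
  { exists (- Cmod z1)%R, z1. auto. }
  assert (Hlow : forall z, unit_disc z -> ~ in_image (p z) -> (- m <= Cmod z)%R).
  { intros z Hz Hn. assert (- Cmod z <= m)%R; [ | lra ]. apply Hub. now exists z. }
  assert (Hs : forall n, exists z, unit_disc z /\ ~ in_image (p z) /\ (Cmod z < - m + / INR (S n))%R).
  { intros n. apply NNPP. intros HN.
    assert (Hpos : (0 < / INR (S n))%R) by (apply Rinv_0_lt_compat, lt_0_INR; lia).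
    assert (m <= m - / INR (S n))%R; [ | lra ]. apply Hlub.
    intros x [z [Hz [Hn ->]]]. apply Rnot_lt_le. intros Hlt. apply HN. exists z.
    split; [ exact Hz | split; [ exact Hn | lra ] ]. }
  destruct (choice _ Hs) as [s Hs'].
  destruct (Bolzano_Weierstrass_C s 1) as [z0 Hz0].
  { intros n. destruct (Hs' n) as [H _]. unfold unit_disc in H. lra. }
  assert (Hm : (Cmod z0 <= - m)%R).
  { apply Rnot_lt_le. intros Hlt.
    set (e := ((Cmod z0 + m) / 2)%R). assert (He : (0 < e)%R) by (unfold e; lra).
    destruct (archimed_cor1 e He) as [K [HK HK0]].
    destruct (Hz0 e K He) as [n [Hn Hd]].
    destruct (Hs' n) as [_ [_ Hm]].
    pose proof (Cmod_le_plus z0 (s n)) as H. rewrite Cmod_minus_sym in H.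
    assert (/ INR (S n) <= / INR K)%R
      by (apply Rinv_le_contravar; [ apply lt_0_INR; lia | apply le_INR; lia ]).
    unfold e in *. lra. }
  pose proof (Hlow z1 Hz1 Hn1) as Hl1.
  assert (Hd0 : unit_disc z0) by (unfold unit_disc; lra).
  assert (Hn0 : ~ in_image (p z0)).
  { intros [u [Hu Hqu]]. pose proof (in_image_open u Hu) as Hopen. rewrite Hqu in Hopen.
    destruct (ccont_near _ _ _ (hol_ccont _ _ (Hp z0 Hd0)) Hopen) as [d [Hd H]].
    destruct (Hz0 d 0%nat Hd) as [n [_ Hn]]. destruct (Hs' n) as [_ [Hi _]].
    apply Hi, H, Hn. }
  exists z0. split; [ exact Hd0 | ]. split; [ exact Hn0 | ].
  intros z Hz. apply NNPP. intros Hi.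
  assert (H : unit_disc z) by (unfold unit_disc in *; lra).
  pose proof (Hlow z H Hi). lra.
Qed.

(** * Boundary behaviour at the exit point *)

Section Exit.

Variables (z0 : C) (w : C -> C).
Hypothesis Hz0 : unit_disc z0.
Hypothesis Hexit : ~ in_image (p z0).
Hypothesis Hw : forall z, (Cmod z < Cmod z0)%R -> unit_disc (w z) /\ q (w z) = p z /\ hol w z.

Lemma exit_neq_0 : z0 <> 0.
Proof.
  intros E. apply Hexit. exists 0. rewrite E. split; [ | now symmetry ].
  unfold unit_disc. rewrite Cmod_0. lra.
Qed.

(** By continuity q(zeta) = p(z0) at any regular cluster value zeta. An interior one would put p(z0)
    into q(D), and an exceptional one would make the convergent sequence p(s n) unbounded. *)
Lemma exit_adherent (s : nat -> C) :
  (forall n, (Cmod (s n) < Cmod z0)%R) -> clim s z0 ->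
  exists zeta, unit_circle zeta /\ ~ exceptional q zeta /\ q zeta = p z0 /\
    forall eps N, (0 < eps)%R -> exists n, (N <= n)%nat /\ (Cmod (w (s n) - zeta) < eps)%R.
Proof.
  intros Hs Hlim.
  destruct (Bolzano_Weierstrass_C (fun n => w (s n)) 1) as [zeta Hzeta].
  { intros n. destruct (Hw (s n) (Hs n)) as [H _]. unfold unit_disc in H. lra. }
  pose proof (clim_ccont p s z0 Hlim (hol_ccont _ _ (Hp z0 Hz0))) as Hps.
  assert (Hle : (Cmod zeta <= 1)%R).
  { apply Rnot_lt_le. intros Hlt.
    destruct (Hzeta (Cmod zeta - 1)%R 0%nat ltac:(lra)) as [n [_ Hn]].
    destruct (Hw (s n) (Hs n)) as [H _]. unfold unit_disc in H.
    pose proof (Cmod_le_plus zeta (w (s n))) as H1. rewrite Cmod_minus_sym in H1. lra. }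
  assert (Hval : regular_set q zeta -> q zeta = p z0).
  { intros Hreg. apply NNPP. intros Hne.
    set (e := (Cmod (q zeta - p z0) / 2)%R).
    assert (He : (0 < e)%R).
    { unfold e. pose proof (proj1 (Cmod_gt_0 _) (Cminus_eq_contra _ _ Hne)). lra. }
    destruct (hol_ccont _ _ (hol_regular zeta Hreg) e He) as [d [Hd H]].
    destruct (Hps e He) as [N HN].
    destruct (Hzeta d N Hd) as [n [Hn Hnd]].
    specialize (HN n Hn). specialize (H _ Hnd).
    destruct (Hw (s n) (Hs n)) as [_ [H1 _]]. rewrite H1 in H.
    pose proof (Cmod_minus_triangle (q zeta) (p (s n)) (p z0)) as H2.
    rewrite (Cmod_minus_sym (q zeta) (p (s n))) in H2. unfold e in *. lra. }
  assert (Hcirc : unit_circle zeta).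
  { destruct Hle as [Hlt | Heq]; [ | exact Heq ]. exfalso. apply Hexit.
    exists zeta. split; [ exact Hlt | ]. now apply Hval, regular_disc. }
  assert (Hnex : ~ exceptional q zeta).
  { intros [_ Hinf].
    assert (Hr : Rbar_locally p_infty (fun x => (Cmod (p z0) + 1 < x)%R)) by (now exists (Cmod (p z0) + 1)%R).
    specialize (Hinf _ Hr). unfold filtermap, within in Hinf. apply near_locally in Hinf.
    destruct Hinf as [d [Hd H]].
    destruct (Hps 1%R Rlt_0_1) as [N HN].
    destruct (Hzeta d N Hd) as [n [Hn Hnd]].
    destruct (Hw (s n) (Hs n)) as [H1 [H2 _]].
    specialize (H _ Hnd H1). rewrite H2 in H. specialize (HN n Hn).
    pose proof (Cmod_le_plus (p (s n)) (p z0)). lra. }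
  exists zeta. split; [ exact Hcirc | ]. split; [ exact Hnex | ]. split; [ | exact Hzeta ].
  apply Hval. split; [ exact Hle | exact Hnex ].
Qed.

Lemma exit_limit :
  exists zeta, unit_circle zeta /\ ~ exceptional q zeta /\ q zeta = p z0 /\
    forall eps, (0 < eps)%R -> near z0 (fun z => (Cmod z < Cmod z0)%R -> (Cmod (w z - zeta) < eps)%R).
Proof.
  pose proof (proj1 (Cmod_gt_0 _) exit_neq_0) as Hm0.
  assert (Hinv : forall n, (0 < / INR (S (S n)) <= / 2)%R).
  { intros n. split; [ apply Rinv_0_lt_compat, lt_0_INR; lia | ].
    apply Rinv_le_contravar; [ lra | apply (le_INR 2); lia ]. }
  (* A radial approach fixes the candidate limit; the shift n + 2 keeps the factor in [1/2, 1), so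
     that all points lie strictly inside. *)
  destruct (exit_adherent (fun n => RtoC (1 - / INR (S (S n))) * z0)) as [zeta [H1 [H2 [H3 _]]]].
  - intros n. specialize (Hinv n). rewrite Cmod_mult, Cmod_R, Rabs_pos_eq by lra. nra.
  - intros eps Heps.
    assert (He : (0 < eps / Cmod z0)%R) by (apply Rdiv_lt_0_compat; lra).
    destruct (archimed_cor1 _ He) as [K [HK HK0]]. exists K. intros n Hn.
    replace (RtoC (1 - / INR (S (S n))) * z0 - z0) with (RtoC (- / INR (S (S n))) * z0)
      by (rewrite RtoC_minus, RtoC_opp; ring).
    specialize (Hinv n). rewrite Cmod_mult, Cmod_R, Rabs_Ropp, Rabs_pos_eq by lra.
    assert (/ INR (S (S n)) <= / INR K)%R
      by (apply Rinv_le_contravar; [ apply lt_0_INR; lia | apply le_INR; lia ]).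
    assert (HK' : (/ INR (S (S n)) < eps / Cmod z0)%R) by lra.
    apply (proj2 (Rlt_div_r _ _ (Cmod z0) Hm0)) in HK'. exact HK'.
  - exists zeta. split; [ exact H1 | ]. split; [ exact H2 | ]. split; [ exact H3 | ].
    (* A sequence violating the limit would have its own boundary cluster value with the same image
       p(z0); injectivity of q on the regular set makes it equal to zeta, a contradiction. *)
    intros eps Heps. apply NNPP. intros HN.
    assert (Hs : forall n, exists z, (Cmod (z - z0) < / INR (S n))%R /\ (Cmod z < Cmod z0)%R /\
                                     (eps <= Cmod (w z - zeta))%R).
    { intros n. apply NNPP. intros HN'. apply HN.
      exists (/ INR (S n))%R. split; [ apply Rinv_0_lt_compat, lt_0_INR; lia | ].
      intros z Hz Hzm. apply Rnot_le_lt. intros Hle. apply HN'. now exists z. }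
    destruct (choice _ Hs) as [s Hs'].
    destruct (exit_adherent s) as [zeta' [H4 [H5 [H6 H7]]]].
    + intros n. apply Hs'.
    + intros e He. destruct (archimed_cor1 e He) as [K [HK HK0]]. exists K. intros n Hn.
      destruct (Hs' n) as [H _].
      assert (/ INR (S n) <= / INR K)%R
        by (apply Rinv_le_contravar; [ apply lt_0_INR; lia | apply le_INR; lia ]).
      lra.
    + assert (E : zeta' = zeta).
      { apply q_injective; [ | | now rewrite H3 ]; split; auto;
          unfold unit_circle, closed_unit_disc in *; lra. }
      destruct (H7 eps 0%nat Heps) as [n [_ Hn]]. rewrite E in Hn.
      destruct (Hs' n) as [_ [_ H]]. lra.
Qed.

Lemma exit_Jack :
  exists (zeta : C) (m : R),
    unit_circle zeta /\ ~ exceptional q zeta /\ (1 <= m)%R /\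
    p z0 = q zeta /\ z0 * C_derive p z0 = m * zeta * C_derive q zeta /\
    (m * Re (zeta * C_derive (C_derive q) zeta / C_derive q zeta + 1)
       <= Re (z0 * C_derive (C_derive p) z0 / C_derive p z0 + 1))%R.
Proof.
  pose proof exit_neq_0 as Hz0n. pose proof (proj1 (Cmod_gt_0 _) Hz0n) as Hm0.
  destruct exit_limit as [zeta [Hc [Hnex [Hval Hlim]]]].
  assert (Hreg : regular_set q zeta)
    by (split; [ unfold closed_unit_disc, unit_circle in *; lra | exact Hnex ]).
  pose proof (hol_regular zeta Hreg) as Hqz.
  pose proof (proj2 (proj2 Hq) zeta Hc Hnex) as Hq'.
  pose proof (Hp z0 Hz0) as Hpz.
  destruct (hol_local_inverse q zeta 1 Hqz Hq' Rlt_0_1) as [d [g [Hd [Hinj Hg]]]].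
  rewrite Hval in Hg.
  set (W := fun z => g (p z)).
  pose proof (ccont_near _ _ _ (hol_ccont _ _ Hpz) Hg) as HgW.
  assert (HW : hol W z0) by (apply (hol_comp g p); [ apply (near_at _ _ Hg) | exact Hpz ]).
  assert (HW0 : W z0 = zeta).
  { destruct (near_at _ _ Hg) as [H1 [H2 _]]. apply Hinj; [ exact H1 | | ].
    - replace (zeta - zeta) with (RtoC 0) by ring. rewrite Cmod_0. lra.
    - unfold W. now rewrite H2. }
  assert (Hpq : near z0 (fun z => p z = q (W z))).
  { apply near_impl with (1 := HgW). intros z [_ [H _]]. now symmetry. }
  destruct (Jack W z0 HW Hz0n) as [m [Hm [HDW HRe]]].
  { rewrite HW0. exact Hc. }
  { apply near_impl with (1 := near_and _ _ _ HgW (Hlim d (proj1 Hd))).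
    intros z [[H1 [H2 _]] H3] Hz. specialize (H3 Hz). destruct (Hw z Hz) as [_ [H4 _]].
    (* W z might lie outside the closed disc, so injectivity of q in a full ball around zeta is the
       one to use; [exit_limit] brings w z into that ball. *)
    assert (E : W z = w z) by (apply Hinj; auto; unfold W; now rewrite H2, H4).
    rewrite E. apply Schwarz.
    - intros u Hu. apply Hw, Hu.
    - now apply (lift_0 (Cmod z0)).
    - intros u Hu. destruct (Hw u Hu) as [H _]. unfold unit_disc in H. lra.
    - exact Hz. }
  rewrite HW0 in HDW.
  assert (HpD : near z0 (fun z => C_derive q (W z) * C_derive W z = C_derive p z)).
  { assert (Hqn : near z0 (fun z => hol q (W z))).
    { apply (ccont_near W z0); [ now apply hol_ccont | ]. rewrite HW0. now apply hol_near. }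
    apply near_impl with (1 := near_and _ _ _ (near_near _ _ Hpq) (near_and _ _ _ Hqn (hol_near _ _ HW))).
    intros z [H1 [H2 H3]]. symmetry. apply cder_C_derive.
    apply cder_ext_near with (fun z => q (W z)).
    - apply near_impl with (1 := H1). intros u Hu. now symmetry.
    - apply (cder_comp q W); now apply hol_cder. }
  assert (Hp1 : C_derive p z0 = C_derive q zeta * C_derive W z0).
  { rewrite <- (near_at _ _ HpD). now rewrite HW0. }
  assert (Hp2 : C_derive (C_derive p) z0
    = C_derive (C_derive q) zeta * C_derive W z0 * C_derive W z0
      + C_derive q zeta * C_derive (C_derive W) z0).
  { apply cder_C_derive. apply cder_ext_near with (1 := HpD).
    rewrite <- HW0.
    apply (cder_mult (fun z => C_derive q (W z)) (C_derive W)).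
    - apply (cder_comp (C_derive q) W); [ | now apply hol_cder ].
      rewrite HW0. now apply hol_cder, hol_C_derive.
    - now apply hol_cder, hol_C_derive. }
  assert (HW' : C_derive W z0 <> 0).
  { intros H. rewrite H, Cmult_0_r in HDW.
    assert (Hmm : Cmod (m * zeta) = 0%R) by (rewrite <- HDW; apply Cmod_0).
    unfold unit_circle in Hc. rewrite Cmod_mult, Hc, Cmod_R, Rabs_pos_eq in Hmm; lra. }
  exists zeta, m. split; [ exact Hc | ]. split; [ exact Hnex | ]. split; [ exact Hm | ].
  split; [ now symmetry | ]. split.
  - rewrite Hp1, <- HDW. ring.
  (* Differentiating p = q(W) twice and inserting z0 W'(z0) = m zeta splits the expression; Jack's
     lemma bounds the real part of the last summand below by m. *)
  - replace (z0 * C_derive (C_derive p) z0 / C_derive p z0 + 1)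
      with (m * (zeta * C_derive (C_derive q) zeta / C_derive q zeta)
            + (z0 * C_derive (C_derive W) z0 / C_derive W z0 + 1)).
    + rewrite !re_plus, re_scal_l, !re_RtoC. rewrite re_plus, re_RtoC in HRe. lra.
    + transitivity (z0 * C_derive W z0 * (C_derive (C_derive q) zeta / C_derive q zeta)
        + (z0 * C_derive (C_derive W) z0 / C_derive W z0 + 1)).
      * rewrite HDW. field. auto.
      * rewrite Hp1, Hp2. field. auto.
Qed.

End Exit.

Lemma Miller_Mocanu :
  ~ subordinate p q ->
  exists (z0 zeta : C) (m : R),
    unit_disc z0 /\ z0 <> 0 /\ unit_circle zeta /\ ~ exceptional q zeta /\ (1 <= m)%R /\
    p z0 = q zeta /\ z0 * C_derive p z0 = m * zeta * C_derive q zeta /\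
    (m * Re (zeta * C_derive (C_derive q) zeta / C_derive q zeta + 1)
       <= Re (z0 * C_derive (C_derive p) z0 / C_derive p z0 + 1))%R.
Proof.
  intros Hns. destruct minimal_exit_point as [z0 [Hz0 [Hex Hin]]].
  { apply NNPP. intros HN. apply Hns, subordinate_of_image. intros z Hz.
    apply NNPP. intros Hi. apply HN. now exists z. }
  destruct (disc_lift (Cmod z0)) as [w Hw]; [ unfold unit_disc in Hz0; lra | exact Hin | ].
  destruct (exit_Jack z0 w Hz0 Hex Hw) as [zeta [m H]].
  exists z0, zeta, m. split; [ exact Hz0 | ]. split; [ exact (exit_neq_0 z0 Hex) | exact H ].
Qed.

End Subordination.

(** * The Bessel operators *)


Lemma conv_radius_bounded_mult (a b : nat -> C) (K r : R) :
  (forall n, (Cmod (b n) <= K)%R) -> conv_radius a r -> conv_radius (fun n => b n * a n) r.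
Proof.
  intros Hb Ha s Hs. destruct (Ha s Hs) as [M HM]. exists (K * M)%R. intros n.
  rewrite Cmod_mult, Rmult_assoc. apply Rmult_le_compat; auto.
  - apply Cmod_ge_0.
  - apply Rmult_le_pos; [ apply Cmod_ge_0 | apply pow_le; lra ].
Qed.

Lemma eventually_decreasing_bounded (u : nat -> R) (N : nat) :
  (forall n, (N <= n)%nat -> (u (S n) <= u n)%R) -> exists K, forall n, (u n <= K)%R.
Proof.
  intros Hu.
  assert (HB : forall k, exists K, forall n, (n <= k)%nat -> (u n <= K)%R).
  { induction k as [ | k [K HK] ].
    - exists (u 0%nat). intros n Hn. replace n with 0%nat by lia. lra.
    - exists (Rmax K (u (S k))). intros n Hn.
      destruct (Nat.eq_dec n (S k)) as [-> | Hne]; [ apply Rmax_r | ].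
      eapply Rle_trans; [ apply HK; lia | apply Rmax_l ]. }
  destruct (HB N) as [K HK]. exists K. intros n.
  destruct (Nat.le_gt_cases n N) as [H | H]; [ auto | ].
  assert (Hd : forall j, (u (N + j)%nat <= K)%R).
  { induction j as [ | j IH ].
    - rewrite Nat.add_0_r. apply HK. lia.
    - rewrite Nat.add_succ_r. eapply Rle_trans; [ apply Hu; lia | exact IH ]. }
  replace n with (N + (n - N))%nat by lia. apply Hd.
Qed.

(** The condition under which no [pochhammer l n] vanishes, that is, l is not 0, -1, -2, ... *)
Definition regular_parameter (l : C) : Prop := forall n : nat, l + INR n <> 0.

Lemma pochhammer_neq_0 (l : C) (n : nat) : regular_parameter l -> pochhammer l n <> 0.
Proof.
  intros Hl. induction n as [ | n IH ]; simpl; [ apply C1_nz | ].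
  apply Cmult_neq_0; [ exact IH | apply Hl ].
Qed.

Lemma pochhammer_succ (l : C) (n : nat) : l * pochhammer (l + 1) n = pochhammer l n * (l + INR n).
Proof.
  induction n as [ | n IH ].
  - simpl. ring.
  - change (pochhammer (l + 1) (S n)) with (pochhammer (l + 1) n * (l + 1 + INR n)).
    change (pochhammer l (S n)) with (pochhammer l n * (l + INR n)).
    rewrite Cmult_assoc, IH, S_INR, RtoC_plus. ring.
Qed.

Lemma RtoC_neq_0 (x : R) : x <> 0%R -> RtoC x <> 0.
Proof. intros H E. apply H. now apply RtoC_inj. Qed.

Lemma fact_neq_0_C (n : nat) : RtoC (INR (fact n)) <> 0.
Proof. apply RtoC_neq_0, not_0_INR, fact_neq_0. Qed.

Lemma pow4_neq_0 (n : nat) : (RtoC 4) ^ n <> 0.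
Proof. apply Cpow_nz, RtoC_neq_0. lra. Qed.

Definition bessel_mult (c l : C) (n : nat) : C :=
  (- c) ^ n / (4 ^ n * pochhammer l n * INR (fact n)).

(** This is B_l f divided by z, with value 1 at 0; quotients of such functions need no special value
    at the origin. *)
Definition bessel_fun (c l : C) (f : class_A) : C -> C :=
  PS (fun n => bessel_mult c l n * A_coef f (S n)).

Lemma bessel_mult_S (c l : C) (n : nat) : regular_parameter l ->
  bessel_mult c l (S n) = bessel_mult c l n * (- c / (4 * (l + INR n) * INR (S n))).
Proof.
  intros Hl. unfold bessel_mult.
  rewrite !Cpow_S, fact_simpl, mult_INR, RtoC_mult. simpl pochhammer.
  pose proof (pochhammer_neq_0 l n Hl). pose proof (Hl n). pose proof (fact_neq_0_C n).
  pose proof (pow4_neq_0 n).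
  assert (RtoC (INR (S n)) <> 0) by (apply RtoC_neq_0, not_0_INR; lia).
  field. repeat split; auto.
Qed.

(** Consecutive multipliers have ratio of modulus |c| / (4 |l + n| (n + 1)), which is at most 1 once
    n exceeds |c| + |l|. *)
Lemma bessel_mult_bounded (c l : C) : regular_parameter l ->
  exists K : R, forall n, (Cmod (bessel_mult c l n) <= K)%R.
Proof.
  intros Hl. pose proof (Cmod_ge_0 c) as Hc. pose proof (Cmod_ge_0 l) as Hl0.
  destruct (INR_unbounded (Cmod c + Cmod l)) as [N HN].
  apply eventually_decreasing_bounded with (N := N). intros n Hn.
  rewrite bessel_mult_S, Cmod_mult by exact Hl.
  rewrite <- (Rmult_1_r (Cmod (bessel_mult c l n))) at 2.
  apply Rmult_le_compat_l; [ apply Cmod_ge_0 | ].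
  assert (HSn : (1 <= INR (S n))%R) by (apply (le_INR 1); lia).
  assert (Hln : (Cmod c < Cmod (l + INR n))%R).
  { apply le_INR in Hn. pose proof (Cmod_le_plus (INR n) (- l)) as H.
    replace (INR n - - l) with (l + INR n) in H by ring.
    rewrite Cmod_opp, Cmod_R, Rabs_pos_eq in H by apply pos_INR. lra. }
  rewrite Cmod_div.
  2:{ repeat apply Cmult_neq_0; [ apply RtoC_neq_0; lra | apply Hl | apply RtoC_neq_0; lra ]. }
  rewrite !Cmod_mult, Cmod_opp, !Cmod_R, !Rabs_pos_eq by lra.
  assert (H1 : (Cmod (l + INR n) <= 4 * Cmod (l + INR n) * INR (S n))%R) by nra.
  apply Rle_div_l; lra.
Qed.

Lemma A_coef_conv_radius (f : class_A) : conv_radius (A_coef f) 1.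
Proof.
  apply conv_radius_of_csum. intros z Hz. exists (f z).
  apply is_pseries_csum, A_expansion, Hz.
Qed.

Lemma bessel_conv_radius (c l : C) (f : class_A) : regular_parameter l ->
  conv_radius (fun n => bessel_mult c l n * A_coef f (S n)) 1.
Proof.
  intros Hl. destruct (bessel_mult_bounded c l Hl) as [K HK].
  apply (conv_radius_bounded_mult (fun n => A_coef f (S n)) _ K); [ exact HK | ].
  apply (conv_radius_tail (A_coef f) 1), A_coef_conv_radius.
Qed.

Lemma bessel_op_fun (c l : C) (f : class_A) (z : C) : regular_parameter l ->
  unit_disc z -> bessel_op c l f z = z * bessel_fun c l f z.
Proof.
  intros Hl Hz. apply Cseries_unique.
  apply clim_ext with (2 := clim_scal z _ _ (PS_csum _ 1 z (bessel_conv_radius c l f Hl) Hz)).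
  assert (H : forall n, (- c) ^ n * A_coef f (S n) / (4 ^ n * pochhammer l n)
                    * (z ^ S n / INR (fact n)) = z * (bessel_mult c l n * A_coef f (S n) * z ^ n)).
  { intros n. unfold bessel_mult. rewrite Cpow_S.
    pose proof (pochhammer_neq_0 l n Hl). pose proof (fact_neq_0_C n). pose proof (pow4_neq_0 n).
    field. auto. }
  intros n. induction n as [ | n IH ].
  - cbn [psum]. now rewrite H.
  - rewrite !psum_S, <- IH, H. ring.
Qed.

Lemma bessel_fun_0 (c l : C) (f : class_A) : bessel_fun c l f 0 = 1.
Proof.
  unfold bessel_fun. rewrite PS_0, A_coef1. unfold bessel_mult. simpl. field.
Qed.

Lemma bessel_fun_hol (c l : C) (f : class_A) (z : C) : regular_parameter l ->
  unit_disc z -> hol (bessel_fun c l f) z.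
Proof. intros Hl Hz. apply PS_hol with 1%R; [ now apply bessel_conv_radius | exact Hz ]. Qed.

(** Coefficientwise this is n b_n = l (a_n - b_n), which follows from l (l+1)_n = (l)_n (l + n). *)
Lemma bessel_recurrence (c l : C) (f : class_A) (z : C) :
  regular_parameter l -> regular_parameter (l + 1) -> unit_disc z ->
  z * C_derive (bessel_fun c (l + 1) f) z = l * (bessel_fun c l f z - bessel_fun c (l + 1) f z).
Proof.
  intros Hl Hl1 Hz.
  pose proof (bessel_conv_radius c l f Hl) as H0. pose proof (bessel_conv_radius c (l + 1) f Hl1) as H1.
  unfold bessel_fun at 1. rewrite (cder_C_derive _ _ _ (PS_cder _ 1 z H1 Hz)).
  set (a := fun n => bessel_mult c l n * A_coef f (S n)) in *.
  set (b := fun n => bessel_mult c (l + 1) n * A_coef f (S n)) in *.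
  assert (Hab : forall n, INR n * b n = l * (a n - b n)).
  { intros n. unfold a, b, bessel_mult.
    pose proof (pochhammer_neq_0 l n Hl) as P1. pose proof (fact_neq_0_C n). pose proof (pow4_neq_0 n).
    pose proof (Hl n). pose proof (Hl 0%nat) as L0.
    replace (l + INR 0) with l in L0 by (simpl; ring).
    assert (Hp : pochhammer (l + 1) n = pochhammer l n * (l + INR n) / l)
      by (rewrite <- pochhammer_succ; field; exact L0).
    rewrite Hp. field. auto. }
  apply clim_unique with (1 := clim_scal z _ _ (PS_csum _ 1 z (conv_radius_dcoef _ _ H1) Hz)).
  apply clim_ext with (fun n => l * (psum (fun n => a n * z ^ n) (S n) + (-1) * psum (fun n => b n * z ^ n) (S n))).
  - intros n. transitivity (psum (fun n => INR n * b n * z ^ n) (S n)).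
    + generalize (S n). intros k. induction k as [ | k IH ].
      * cbn [psum]. rewrite Hab. ring.
      * rewrite !psum_S, <- IH, Hab. ring.
    (* The term of index 0 of the sum of n b_n z^n vanishes, so its partial sum to [S n] is z times
       the partial sum to n of the derived series. *)
    + induction n as [ | n IH ].
      * rewrite psum_S. cbn [psum Cpow]. unfold dcoef. simpl INR. ring.
      * rewrite psum_S, IH, (psum_S _ n). unfold dcoef. rewrite (Cpow_S z (S n)). ring.
  - replace (bessel_fun c l f z - bessel_fun c (l + 1) f z)
      with (PS a z + (-1) * PS b z) by (unfold bessel_fun, a, b; ring).
    apply clim_scal, clim_plus; [ | apply clim_scal ];
      apply (clim_S (psum _)); now apply PS_csum with 1%R.
Qed.

(** The logarithmic derivative of the quotient is a difference of two recurrences, for l - 1 and for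
    l. *)
Lemma bessel_quot_deriv (c l : C) (f : class_A) (z : C) :
  regular_parameter (l - 1) -> regular_parameter l -> regular_parameter (l + 1) -> unit_disc z ->
  bessel_fun c l f z <> 0 -> bessel_fun c (l + 1) f z <> 0 ->
  z * C_derive (fun u => bessel_fun c l f u / bessel_fun c (l + 1) f u) z =
    bessel_fun c l f z / bessel_fun c (l + 1) f z
    * ((l - 1) * (bessel_fun c (l - 1) f z / bessel_fun c l f z) + 1
       - l * (bessel_fun c l f z / bessel_fun c (l + 1) f z)).
Proof.
  intros Hm Hl Hp Hz H0 H1.
  pose proof (bessel_recurrence c l f z Hl Hp Hz) as R1.
  assert (El : l - 1 + 1 = l) by ring.
  pose proof (bessel_recurrence c (l - 1) f z Hm) as R0. rewrite El in R0. specialize (R0 Hl Hz).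
  rewrite (cder_C_derive _ _ _ (cder_div _ _ _ _ _ (hol_cder _ _ (bessel_fun_hol c l f z Hl Hz))
    (hol_cder _ _ (bessel_fun_hol c (l + 1) f z Hp Hz)) H1)).
  transitivity ((z * C_derive (bessel_fun c l f) z * bessel_fun c (l + 1) f z
     - bessel_fun c l f z * (z * C_derive (bessel_fun c (l + 1) f) z))
     / (bessel_fun c (l + 1) f z * bessel_fun c (l + 1) f z)); [ field; exact H1 | ].
  rewrite R0, R1. field. auto.
Qed.

Lemma bessel_quot_fun (c l m : C) (f : class_A) (z : C) :
  regular_parameter l -> regular_parameter m -> unit_disc z -> bessel_fun c m f z <> 0 ->
  bessel_quot c l m f z = bessel_fun c l f z / bessel_fun c m f z.
Proof.
  intros Hl Hm Hz H. unfold bessel_quot. destruct (Ceq_dec z 0) as [-> | Hz0].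
  - rewrite !bessel_fun_0. field.
  - rewrite !bessel_op_fun by assumption. field. auto.
Qed.

Lemma bessel_fun_neq_0 (c l : C) (f : class_A) (z : C) :
  regular_parameter l -> no_zero_in_punctured_disc (bessel_op c l f) -> unit_disc z ->
  bessel_fun c l f z <> 0.
Proof.
  intros Hl H Hz. destruct (Ceq_dec z 0) as [-> | Hz0].
  - rewrite bessel_fun_0. apply C1_nz.
  - intros E. apply (H z Hz Hz0). rewrite bessel_op_fun by assumption. rewrite E. ring.
Qed.

(* The quotient of the admissibility condition is [z p''(z) / p'(z) + 1] for
   [p = B_kappa f / B_(kappa+1) f], here computed from the differential equations of [p] and of
   [v = B_(kappa-1) f / B_kappa f]. *)
Lemma admissible_quotient (kappa p v w z p1 p2 v1 : C) :
  z <> 0 -> p <> 0 -> p1 <> 0 ->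
  z * p1 = p * ((kappa - 1) * v + 1 - kappa * p) ->
  z * v1 = v * ((kappa - 2) * w + 1 - (kappa - 1) * v) ->
  p1 + z * p2 = p1 * ((kappa - 1) * v + 1 - kappa * p) + p * ((kappa - 1) * v1 - kappa * p1) ->
  (kappa - 1) * v * ((kappa - 1) * (w - v) + 1 - w) / ((kappa - 1) * v + 1 - kappa * p)
    - (2 * kappa * p - 1 - (kappa - 1) * v) = z * p2 / p1 + 1.
Proof.
  intros Hz Hp Hp1 E1 E2 E3.
  (* E is z p'/p, nonzero together with p'. The numerator is (kappa - 1) z v', since (kappa - 1)(w -
     v) + 1 - w = (kappa - 2) w + 1 - (kappa - 1) v. *)
  set (E := (kappa - 1) * v + 1 - kappa * p) in *.
  assert (HE : E <> 0).
  { intros H. rewrite H, Cmult_0_r in E1. revert E1. now apply Cmult_neq_0. }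
  assert (EE : p1 = p * E / z) by (rewrite <- E1; field; exact Hz).
  replace ((kappa - 1) * v * ((kappa - 1) * (w - v) + 1 - w))
    with ((kappa - 1) * (z * v1)) by (rewrite E2; ring).
  replace (2 * kappa * p - 1 - (kappa - 1) * v) with (kappa * p - E) by (unfold E; ring).
  transitivity ((p1 + z * p2) / p1); [ rewrite E3 | field; exact Hp1 ].
  transitivity (E + (kappa - 1) * v1 * (p / p1) - kappa * p); [ | field; exact Hp1 ].
  rewrite EE. field. auto.
Qed.

Lemma subordinate_ext (p1 p2 q : C -> C) :
  (forall z, unit_disc z -> p1 z = p2 z) -> subordinate p1 q -> subordinate p2 q.
Proof.
  intros H [w [H1 [H2 [H3 H4]]]]. exists w. repeat split; auto.
  intros z Hz. rewrite <- H by exact Hz. now apply H4.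
Qed.

Local Open Scope R_scope.

Theorem theorem2p10 :
  forall (c kappa : C),
    (forall n : nat, kappa <> 2 - INR n) ->
  forall (Omega : C -> Prop) (q : C -> C),
    class_Q1 q -> class_H1 q ->
  forall phi : C -> C -> C -> C -> C,
    admissible kappa Omega q phi ->
  forall f : class_A,
    no_zero_in_punctured_disc (bessel_op c (kappa + 1) f) ->
    no_zero_in_punctured_disc (bessel_op c kappa f) ->
    no_zero_in_punctured_disc (bessel_op c (kappa - 1) f) ->
    (forall z : C, unit_disc z ->
       Omega (phi (bessel_quot c kappa (kappa + 1) f z)
                  (bessel_quot c (kappa - 1) kappa f z)
                  (bessel_quot c (kappa - 2) (kappa - 1) f z)
                  z)) ->
    subordinate (bessel_quot c kappa (kappa + 1) f) q.
Proof.
  intros c kappa Hk Omega q [Hq Hq0] _ phi Hphi f N1 N0 Nm HOmega.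
  Local Open Scope C_scope.
  (* kappa - 2 + j + n = 0 would make kappa equal to 2 - (j + n), an excluded value; j = 0, 1, 2, 3
     covers all four parameters. *)
  assert (Hreg : forall j : nat, regular_parameter (kappa - 2 + INR j)).
  { intros j n E. apply (Hk (j + n)%nat).
    rewrite RtoC_minus, plus_INR, RtoC_plus. apply Ceq_minus. rewrite <- E. ring. }
  assert (Rmm : regular_parameter (kappa - 2))
    by (replace (kappa - 2) with (kappa - 2 + INR 0) by (simpl; ring); apply Hreg).
  assert (Rm : regular_parameter (kappa - 1))
    by (replace (kappa - 1) with (kappa - 2 + INR 1) by (simpl; ring); apply Hreg).
  assert (R0 : regular_parameter kappa)
    by (replace kappa with (kappa - 2 + INR 2) by (simpl; rewrite RtoC_plus; ring); apply Hreg).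
  assert (R1 : regular_parameter (kappa + 1))
    by (replace (kappa + 1) with (kappa - 2 + INR 3) by (simpl; rewrite !RtoC_plus; ring); apply Hreg).
  assert (Hk1 : kappa - 1 <> 0).
  { intros E. apply (Rm 0%nat). rewrite E. simpl. ring. }
  pose proof (fun z => bessel_fun_neq_0 c (kappa + 1) f z R1 N1) as Z1.
  pose proof (fun z => bessel_fun_neq_0 c kappa f z R0 N0) as Z0.
  pose proof (fun z => bessel_fun_neq_0 c (kappa - 1) f z Rm Nm) as Zm.
  set (p := fun z => bessel_fun c kappa f z / bessel_fun c (kappa + 1) f z).
  set (v := fun z => bessel_fun c (kappa - 1) f z / bessel_fun c kappa f z).
  set (w := fun z => bessel_fun c (kappa - 2) f z / bessel_fun c (kappa - 1) f z).
  assert (Hp : forall z, unit_disc z -> hol p z)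
    by (intros z Hz; apply hol_div; auto; now apply bessel_fun_hol).
  assert (Hv : forall z, unit_disc z -> hol v z)
    by (intros z Hz; apply hol_div; auto; now apply bessel_fun_hol).
  assert (Dp : forall z, unit_disc z ->
    z * C_derive p z = p z * ((kappa - 1) * v z + 1 - kappa * p z)).
  { intros z Hz. exact (bessel_quot_deriv c kappa f z Rm R0 R1 Hz (Z0 z Hz) (Z1 z Hz)). }
  assert (Dv : forall z, unit_disc z ->
    z * C_derive v z = v z * ((kappa - 2) * w z + 1 - (kappa - 1) * v z)).
  { intros z Hz. pose proof (bessel_quot_deriv c (kappa - 1) f z) as H.
    replace (kappa - 1 - 1) with (kappa - 2) in H by ring.
    replace (kappa - 1 + 1) with kappa in H by ring.
    exact (H Rmm Rm R0 Hz (Zm z Hz) (Z0 z Hz)). }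
  (* Inside the disc the factors z cancel and the prescribed value 1 at 0 is the value of p. *)
  apply subordinate_ext with p.
  { intros z Hz. unfold p. rewrite bessel_quot_fun; auto. }
  apply NNPP. intros Hns.
  destruct (Miller_Mocanu p q Hq Hp) with (2 := Hns)
    as [z [zeta [m [Hz [Hz0 [Hc [Hex [Hm [Hpq [Hd Hre]]]]]]]]]].
  { unfold p. rewrite !bessel_fun_0, Hq0. field. }
  assert (Hpz : p z <> 0).
  { intros E. apply (Z0 z Hz). transitivity (p z * bessel_fun c (kappa + 1) f z).
    - unfold p. field. now apply Z1.
    - rewrite E. ring. }
  (* z p'(z) = m zeta q'(zeta), whose three factors are nonzero. *)
  assert (Hp1 : C_derive p z <> 0).
  { intros E. rewrite E, Cmult_0_r in Hd. symmetry in Hd. revert Hd.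
    apply Cmult_neq_0; [ apply Cmult_neq_0 | ].
    - apply RtoC_neq_0. lra.
    - apply Cmod_gt_0. rewrite Hc. lra.
    - apply (proj2 (proj2 Hq)); assumption. }
  assert (D2p : C_derive p z + z * C_derive (C_derive p) z
    = C_derive p z * ((kappa - 1) * v z + 1 - kappa * p z)
      + p z * ((kappa - 1) * C_derive v z - kappa * C_derive p z)).
  { assert (HL : cder (fun u => u * C_derive p u) z (1 * C_derive p z + z * C_derive (C_derive p) z))
      by (apply (cder_mult (fun u => u)); [ apply cder_id | now apply hol_cder, hol_C_derive, Hp ]).
    assert (HR : cder (fun u => p u * ((kappa - 1) * v u + 1 - kappa * p u)) z
      (C_derive p z * ((kappa - 1) * v z + 1 - kappa * p z)
       + p z * ((kappa - 1) * C_derive v z + 0 - kappa * C_derive p z))).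
    { apply (cder_mult p (fun u => (kappa - 1) * v u + 1 - kappa * p u));
        [ now apply hol_cder, Hp | ].
      apply (cder_minus (fun u => (kappa - 1) * v u + 1) (fun u => kappa * p u)).
      - apply (cder_plus (fun u => (kappa - 1) * v u)); [ | apply cder_const ].
        now apply cder_scal, hol_cder, Hv.
      - now apply cder_scal, hol_cder, Hp. }
    (* The first-order equation holds on the whole disc, so both sides may be differentiated and
       uniqueness of the derivative gives the second-order relation. *)
    assert (Hball : near z (fun u => u * C_derive p u = p u * ((kappa - 1) * v u + 1 - kappa * p u))).
    { apply near_impl with (fun u => (Cmod (u - 0) < 1)%R).
      - apply near_ball. now replace (z - 0) with z by ring.
      - intros u Hu. apply Dp. now replace (u - 0) with u in Hu by ring. }
    pose proof (cder_unique _ _ _ _ (cder_ext_near _ _ _ _ Hball HL) HR) as E.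
    transitivity (1 * C_derive p z + z * C_derive (C_derive p) z); [ ring | ].
    rewrite E. ring. }
  apply (Hphi (p z) (v z) (w z) z zeta m); auto.
  (* The admissible v has m zeta q'(zeta)/q(zeta) = z p'(z)/p(z) in it; the equation of p solved for
     v is exactly that formula. *)
  - rewrite <- Hpq, <- Hd, Dp by exact Hz. field. auto.
  - now rewrite <- Hpq.
  - rewrite (admissible_quotient kappa (p z) (v z) (w z) z (C_derive p z)
      (C_derive (C_derive p) z) (C_derive v z)); auto.
    now apply Rle_ge.
  - specialize (HOmega z Hz). rewrite !bessel_quot_fun in HOmega by auto. exact HOmega.
Qed.
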